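(* Let $L,T,\omega,b\in(0,\infty)$, let $\mathbf{e_g}\in\mathbb{R}^3$ with $|\mathbf{e_g}|=1$, and let $\mathbf f:[0,L]\times[0,T]\to\mathbb{R}^3$ be continuous. For $N\in\mathbb{N}$ and $\tau=T/N$ let $\lambda_{k+1}=-J'_{k+1}(\mathbf r_{k+1})(e'_{k+1})^{-1}\in\mathcal{H}^{-1}(\Omega_L)$, $k=1,\dots,N-1$, be the discrete Lagrange multipliers defined in the context, $\lambda_0=\lambda_1=0$, and let $\lambda^\tau$ be the corresponding piecewise linear in time interpolation. Then $\lambda^\tau\in\mathcal{H}^{-1,0}(\Omega)$, and there exists $0<C<\infty$, independent of $N\in\mathbb{N}$, such that $$\big|{}_{\mathcal{H}^1_{0,L,T}(\Omega)}\langle g\otimes h,\lambda^\tau\rangle_{\mathcal{H}^{-1}(\Omega)}\big|\le C\,\|g\|_{\mathcal{H}^1(\Omega_L)}\|h\|_{\mathcal{H}^1(\Omega_T)}$$ for all $g\in\mathcal{H}^1_{0,L}(\Omega_L)$ and $h\in\mathcal{H}^1_{0,T}(\Omega_T)$.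
   Context: $\Omega_a=(0,a)$, $\Omega=\Omega_L\times\Omega_T$. $\mathcal{H}^m=\mathcal{W}^{m,2}$. For $m\in[0,\infty)$, $\mathcal{H}^m_{0,a}(\Omega_a;\mathbb{R}^n)=\{\mathbf v\in\mathcal{H}^m(\Omega_a;\mathbb{R}^n):\partial_s^\alpha\mathbf v(a)=\mathbf 0\text{ for all }\alpha\in\mathbb{N}_0,\ \alpha+1/2<m\}$ with the $\mathcal{H}^m$-norm (range suppressed if $n=1$); $\mathcal{H}^{-m}(\Omega_a)$ is the dual of $\mathcal{H}^m_{0,a}(\Omega_a)$. $\mathcal{H}^{m_L,m_T}_{0,L,T}(\Omega)$ is the completion of the algebraic tensor product $\mathcal{H}^{m_L}_{0,L}(\Omega_L)\otimes\mathcal{H}^{m_T}_{0,T}(\Omega_T)$ with respect to the tensor product inner product, $\mathcal{H}^{-m_L,-m_T}(\Omega)$ its dual; if $m_L=m_T$ only one index is written. $(g\otimes h)(s,t)=g(s)h(t)$. Spaces of square integrable functions are identified with their duals. For $N\in\mathbb{N}$ let $\tau=T/N$, $t_k=k\tau$, $\mathbf f_k=\mathbf f(\cdot,t_k)$. Let $\mathcal V=\{\mathbf v\in\mathcal{H}^2(\Omega_L;\mathbb{R}^3):\mathbf v(L)=\mathbf 0,\ \partial_s\mathbf v(L)=-\mathbf{e_g}\}$. Set $\mathbf r_0(s)=\mathbf r_1(s)=(L-s)\mathbf{e_g}$. Recursively for $k=1,\dots,N-1$, given $\mathbf r_{k-1},\mathbf r_k\in\mathcal V$, put $\mathrm D^2_{k+1}\mathbf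 v=(\mathbf v-2\mathbf r_k+\mathbf r_{k-1})/\tau^2$, $$J_{k+1}(\mathbf v)=\omega\|\tau\mathrm D_{k+1}^2\mathbf v\|^2_{\mathcal{L}^2(\Omega_L)}+b\|\partial_{ss}\mathbf v\|^2_{\mathcal{L}^2(\Omega_L)}-2(\mathbf f_{k+1},\mathbf v)_{\mathcal{L}^2(\Omega_L)},\quad e_{k+1}(\mathbf v)=2\,\partial_s(\mathbf v-\mathbf r_k)\cdot\partial_s\mathbf r_k,$$ $\mathcal K_{k+1}=\{\mathbf v\in\mathcal V: e_{k+1}(\mathbf v)=0\}$; $\mathbf r_{k+1}$ is the unique minimizer of $J_{k+1}$ over $\mathcal K_{k+1}$. Here $J'_{k+1}(\mathbf v)[\boldsymbol\phi]=2\big(\omega(\mathrm D^2_{k+1}\mathbf v,\boldsymbol\phi)_{\mathcal{L}^2}+b(\partial_{ss}\mathbf v,\partial_{ss}\boldsymbol\phi)_{\mathcal{L}^2}-(\mathbf f_{k+1},\boldsymbol\phi)_{\mathcal{L}^2}\big)$ for $\boldsymbol\phi\in\mathcal{H}^2_{0,L}(\Omega_L;\mathbb{R}^3)$, and $(e'_{k+1})^{-1}:\mathcal{H}^1_{0,L}(\Omega_L)\to\mathcal{H}^2_{0,L}(\Omega_L;\mathbb{R}^3)$ is $$(e'_{k+1})^{-1}[\psi](s)=-\int_s^L\frac{\psi\,\partial_u\mathbf r_k}{2|\partial_u\mathbf r_k|^2}\,du$$ (well defined because $|\partial_s\mathbf r_k|\ge1$), so $\lambda_{k+1}[g]=-J'_{k+1}(\mathbf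 r_{k+1})[(e'_{k+1})^{-1}[g]]$. Interpolation: $\lambda^\tau(t)=\frac{t-t_{k-1}}{\tau}(\lambda_k-\lambda_{k-1})+\lambda_{k-1}$ for $t\in(t_{k-1},t_k]$, $k=1,\dots,N$, acting by $\langle g\otimes h,\lambda^\tau\rangle=\int_0^T{}_{\mathcal{H}^1_{0,L}(\Omega_L)}\langle g,\lambda^\tau(t)\rangle_{\mathcal{H}^{-1}(\Omega_L)}h(t)\,dt$. *)

(* Defs.v *)
From HB Require Import structures.
From mathcomp Require Import all_boot all_order all_algebra.
From mathcomp Require Import all_classical all_reals all_analysis.

Set Implicit Arguments.
Unset Strict Implicit.
Unset Printing Implicit Defensive.

Import Order.TTheory GRing.Theory Num.Theory.
Import numFieldNormedType.Exports.

Local Open Scope classical_set_scope.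
Local Open Scope ring_scope.

(* Elements of L^2(0,a) and H^m(0,a) are represented by functions on the whole
   line of which only the restriction to ]0,a[, up to null sets, matters. *)

Definition leb (R : realType) := @lebesgue_measure R.

Definition square_integrable (R : realType) (a : R) (u : R -> R) : Prop :=
  measurable_fun `]0, a[ u /\
  (@leb R).-integrable `]0, a[ (fun x => ((u x) ^+ 2)%:E).

Definition test_function (R : realType) (a : R) (phi : R -> R) : Prop :=
  (forall (n : nat) (x : R), derivable (derive1n n phi) x 1) /\
  exists c d : R, [/\ 0 < c, d < a & forall x, x \notin `[c, d] -> phi x = 0].

Definition weak_derivative (R : realType) (a : R) (n : nat) (u v : R -> R)
    : Prop :=
  square_integrable a v /\
  forall phi, test_function a phi ->
    \int[@leb R]_(x in `]0, a[) (u x * derive1n n phi x) =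
    (-1) ^+ n * \int[@leb R]_(x in `]0, a[) (v x * phi x).

(* The n-th weak derivative, chosen among its almost everywhere equal
   versions. *)
Definition wD (R : realType) (a : R) (n : nat) (u : R -> R) : R -> R :=
  get [set v | weak_derivative a n u v].

Definition sobolev (R : realType) (m : nat) (a : R) (u : R -> R) : Prop :=
  square_integrable a u /\
  forall n : nat, (n <= m)%N -> exists v, weak_derivative a n u v.

Definition sobolev_ip (R : realType) (m : nat) (a : R) (u v : R -> R) : R :=
  \sum_(n < m.+1) \int[@leb R]_(x in `]0, a[) (wD a n u x * wD a n v x).

Definition sobolev_norm (R : realType) (m : nat) (a : R) (u : R -> R) : R :=
  Num.sqrt (sobolev_ip m a u u).

(* The value at a is that of the continuous representative of u on [0,a]. *)
Definition end_value (R : realType) (a : R) (u : R -> R) (c : R) : Prop :=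
  exists w : R -> R,
    [/\ {within `[0, a], continuous w},
        {ae @leb R, forall x, x \in `]0, a[ -> u x = w x} & w a = c].

(* For natural numbers n and m, n + 1/2 < m means n < m. *)
Definition sobolev0 (R : realType) (m : nat) (a : R) (u : R -> R) : Prop :=
  sobolev m a u /\ forall n : nat, (n < m)%N -> end_value a (wD a n u) 0.

(* A formal sum of pairs represents an element of the algebraic tensor product
   H^mL_{0,L}(0,L) (x) H^mT_{0,T}(0,T); two formal sums represent the same
   element iff tensor_norm vanishes on their difference. *)
Definition formal_tensor (R : realType) := seq ((R -> R) * (R -> R)).

Definition is_tensor (R : realType) (mL mT : nat) (L T : R)
    (u : formal_tensor R) : Prop :=
  forall x, x \in u -> sobolev0 mL L x.1 /\ sobolev0 mT T x.2.

Definition tensor_ip (R : realType) (mL mT : nat) (L T : R)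
    (u v : formal_tensor R) : R :=
  \sum_(x <- u) \sum_(y <- v) sobolev_ip mL L x.1 y.1 * sobolev_ip mT T x.2 y.2.

Definition tensor_norm (R : realType) (mL mT : nat) (L T : R)
    (u : formal_tensor R) : R :=
  Num.sqrt (tensor_ip mL mT L T u u).

Definition tensor_scale (R : realType) (c : R) (u : formal_tensor R)
    : formal_tensor R :=
  [seq ((fun s => c * x.1 s), x.2) | x <- u].

(* The completion H^{mL,mT}_{0,L,T}(Omega), presented by Cauchy sequences;
   sequences at distance 0 for completion_norm are the same element. *)
Definition tensor_completion (R : realType) (mL mT : nat) (L T : R)
    (u : nat -> formal_tensor R) : Prop :=
  (forall n, is_tensor mL mT L T (u n)) /\
  forall e : R, 0 < e -> exists n0 : nat, forall p q : nat,
    (n0 <= p)%N -> (n0 <= q)%N ->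
    tensor_norm mL mT L T (u p ++ tensor_scale (-1) (u q)) < e.

Definition completion_norm (R : realType) (mL mT : nat) (L T : R)
    (u : nat -> formal_tensor R) : R :=
  limn (fun n => tensor_norm mL mT L T (u n)).

(* The dual H^{-mL,-mT}(Omega). A linear functional that is bounded by the
   seminorm completion_norm takes equal values on Cauchy sequences that present
   the same element of the completion. *)
Definition tensor_dual (R : realType) (mL mT : nat) (L T : R)
    (Lam : (nat -> formal_tensor R) -> R) : Prop :=
  [/\ forall u v, tensor_completion mL mT L T u ->
        tensor_completion mL mT L T v ->
        Lam (fun n => u n ++ v n) = Lam u + Lam v,
      forall (c : R) u, tensor_completion mL mT L T u ->
        Lam (fun n => tensor_scale c (u n)) = c * Lam u
    & exists M : R, forall u, tensor_completion mL mT L T u ->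
        `|Lam u| <= M * completion_norm mL mT L T u].

Definition elementary_tensor (R : realType) (g h : R -> R)
    : nat -> formal_tensor R := fun=> [:: (g, h)].

(* B, given by its values B g h on the elementary tensors g (x) h, belongs to
   H^{-mL,-mT}(Omega). *)
Definition in_tensor_dual (R : realType) (mL mT : nat) (L T : R)
    (B : (R -> R) -> (R -> R) -> R) : Prop :=
  exists Lam, tensor_dual mL mT L T Lam /\
    forall g h, sobolev0 mL L g -> sobolev0 mT T h ->
      Lam (elementary_tensor g h) = B g h.

Definition dotp (R : realType) (u v : 'rV[R]_3) : R :=
  \sum_(i < 3) u ord0 i * v ord0 i.

(* Euclidean norm; the norm `|u| on row vectors is the maximum norm. *)
Definition enorm (R : realType) (u : 'rV[R]_3) : R := Num.sqrt (dotp u u).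

Definition coordf (R : realType) (v : R -> 'rV[R]_3) (i : 'I_3) : R -> R :=
  fun s => v s ord0 i.

Definition vD (R : realType) (a : R) (n : nat) (v : R -> 'rV[R]_3)
    : R -> 'rV[R]_3 :=
  fun s => \row_i wD a n (coordf v i) s.

Definition L2_ip (R : realType) (a : R) (u v : R -> 'rV[R]_3) : R :=
  \int[@leb R]_(s in `]0, a[) dotp (u s) (v s).

Definition calV (R : realType) (L : R) (eg : 'rV[R]_3) (v : R -> 'rV[R]_3)
    : Prop :=
  forall i : 'I_3,
    [/\ sobolev 2 L (coordf v i),
        end_value L (wD L 0 (coordf v i)) 0
      & end_value L (wD L 1 (coordf v i)) (- eg ord0 i)].

(* One time step: p, q and F stand for r_{k-1}, r_k and f_{k+1}. *)

Definition D2 (R : realType) (tau : R) (p q v : R -> 'rV[R]_3)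
    : R -> 'rV[R]_3 :=
  fun s => (tau ^+ 2)^-1 *: (v s - 2 *: q s + p s).

Definition J (R : realType) (L omega b tau : R) (p q F v : R -> 'rV[R]_3) : R :=
  omega * L2_ip L (fun s => tau *: D2 tau p q v s)
                  (fun s => tau *: D2 tau p q v s)
  + b * L2_ip L (vD L 2 v) (vD L 2 v)
  - 2 * L2_ip L F v.

Definition J' (R : realType) (L omega b tau : R) (p q F v phi : R -> 'rV[R]_3)
    : R :=
  2 * (omega * L2_ip L (D2 tau p q v) phi
       + b * L2_ip L (vD L 2 v) (vD L 2 phi)
       - L2_ip L F phi).

Definition e_constr (R : realType) (L : R) (q v : R -> 'rV[R]_3) : R -> R :=
  fun s => 2 * dotp (vD L 1 (fun x => v x - q x) s) (vD L 1 q s).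

Definition calK (R : realType) (L : R) (eg : 'rV[R]_3) (q v : R -> 'rV[R]_3)
    : Prop :=
  calV L eg v /\
  {ae @leb R, forall s, s \in `]0, L[ -> e_constr L q v s = 0}.

Definition is_minimizer (R : realType) (A : (R -> 'rV[R]_3) -> Prop)
    (G : (R -> 'rV[R]_3) -> R) (v : R -> 'rV[R]_3) : Prop :=
  A v /\ forall w, A w -> G v <= G w.

(* (e'_{k+1})^{-1} *)
Definition e'_inv (R : realType) (L : R) (q : R -> 'rV[R]_3) (psi : R -> R)
    : R -> 'rV[R]_3 :=
  fun s => \row_i - \int[@leb R]_(x in `]s, L[)
    (psi x * vD L 1 q x ord0 i / (2 * enorm (vD L 1 q x) ^+ 2)).

Definition tau_ (R : realType) (T : R) (N : nat) : R := T / N%:R.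

Definition t_ (R : realType) (T : R) (N k : nat) : R := k%:R * tau_ T N.

Definition f_ (R : realType) (T : R) (N : nat) (f : R * R -> 'rV[R]_3) (k : nat)
    : R -> 'rV[R]_3 :=
  fun s => f (s, t_ T N k).

(* r_0, ..., r_N are the iterates of the scheme (up to null sets, since the
   minimizers are unique in L^2); r_k for k > N is irrelevant. *)
Definition scheme (R : realType) (L T omega b : R) (eg : 'rV[R]_3)
    (f : R * R -> 'rV[R]_3) (N : nat) (r : nat -> R -> 'rV[R]_3) : Prop :=
  [/\ r 0%N = (fun s => (L - s) *: eg),
      r 1%N = (fun s => (L - s) *: eg)
    & forall k : nat, (1 <= k < N)%N ->
        is_minimizer (calK L eg (r k))
          (J L omega b (tau_ T N) (r k.-1) (r k) (f_ T N f k.+1)) (r k.+1)].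

Definition lambda_ (R : realType) (L T omega b : R) (f : R * R -> 'rV[R]_3)
    (N : nat) (r : nat -> R -> 'rV[R]_3) (k : nat) (g : R -> R) : R :=
  if k is j.+2 then
    - J' L omega b (tau_ T N) (r j) (r j.+1) (f_ T N f j.+2) (r j.+2)
        (e'_inv L (r j.+1) g)
  else 0.

(* The pairing of g with lambda^tau(t); for t in ]0,T] exactly one summand has
   a nonzero indicator. *)
Definition lambda_tau (R : realType) (L T omega b : R)
    (f : R * R -> 'rV[R]_3) (N : nat) (r : nat -> R -> 'rV[R]_3)
    (t : R) (g : R -> R) : R :=
  \sum_(1 <= k < N.+1) (t \in `]t_ T N k.-1, t_ T N k])%:R *
    ((t - t_ T N k.-1) / tau_ T N *
       (lambda_ L T omega b f N r k g - lambda_ L T omega b f N r k.-1 g)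
     + lambda_ L T omega b f N r k.-1 g).

Definition lambda_tau_pairing (R : realType) (L T omega b : R)
    (f : R * R -> 'rV[R]_3) (N : nat) (r : nat -> R -> 'rV[R]_3)
    (g h : R -> R) : R :=
  \int[@leb R]_(t in `]0, T[) (lambda_tau L T omega b f N r t g * h t).

(* Main.v *)
(** The competitor [(1 - theta) r_{k+1} + theta r_k] in the minimization gives
    a discrete energy estimate: the velocities [(r_{k+1} - r_k) / tau] and the
    curvatures [r_k''] are bounded in L^2 uniformly in [N].  Hence every term
    of [lambda_{k+1}[g]] is bounded by [C |g|] except the inertial one, a
    difference of velocities divided by [tau].  After pairing with [h], a
    summation by parts in time moves this difference onto the time weights,
    whose variation is controlled by [h'], and onto [(e'_{k+1})^{-1}[g]].  The
    constraint makes the difference of two consecutive fields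
    [r_k' / (2 |r_k'|^2)] linear in [r_{k+1}' - r_k'], with H^1 coefficients,
    so an integration by parts in space bounds it by the L^2 norm of
    [r_{k+1} - r_k], which is [O(tau)].
    For fixed [N], [lambda^tau] is a finite sum of functionals
    [lambda_k (x) mu], each bounded on the tensor product because a nonnegative
    form contracts with a Gram matrix to a nonnegative number. *)
Require Import Defs.
From HB Require Import structures.
From mathcomp Require Import all_boot all_order all_algebra.
From mathcomp Require Import all_classical all_reals all_analysis.
From mathcomp Require Import measurable_realfun.
From mathcomp Require Import ring lra.
Import Order.TTheory GRing.Theory Num.Theory.
Import numFieldNormedType.Exports.
Local Open Scope classical_set_scope.
Local Open Scope ring_scope.

Set Implicit Arguments.
Unset Strict Implicit.

(** Taken one by one, the inertial parts of the multipliers are only O(1/tau); accelerations are not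
    controlled, which is why h needs a derivative. After the summation by parts the field must
    change by O(tau) from one step to the next. The derivative r_{k+1}' - r_k' does not:
    interpolating O(tau) in L^2 with O(1) in H^2 gives only O(tau^{1/2}). Moving that derivative
    onto the coefficients recovers the full power; at L the boundary term drops because all curves
    end at 0. The coefficients are bounded uniformly because |r_k'| >= 1: the increment of the
    tangent is orthogonal to r_k', so the speed cannot decrease. The energy needs no Gronwall
    argument, since its square root grows by at most a multiple of tau per step. Weak derivatives
    are chosen versions, fixed only up to null sets, while the constraint and the end values are
    used pointwise. Everything is therefore carried by absolutely continuous representatives, whose
    calculus is derived from Lebesgue points and explicit test functions. *)

Lemma eq_ler {R : realType} (x y : R) : x = y -> x <= y.
Proof. by move=> ->. Qed.

(** Both Cauchy-Schwarz inequalities of the proof, for $L^2$ and for the tensor form, are read off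
    this discriminant; since the leading coefficient may vanish, it also serves degenerate forms. *)
Lemma quadratic_disc {R : realType} (A B C : R) :
  (forall t, 0 <= A + 2 * t * B + t ^+ 2 * C) -> B ^+ 2 <= A * C.
Proof.
move=> h; pose p := Poly [:: A; 2 * B; C].
have := @deg_le2_poly_ge0 _ p (size_Poly _); rewrite !coefE/= => disc.
suff : (2 * B) ^+ 2 - 4 * C * A <= 0 by lra.
by apply: disc => x; rewrite horner_Poly/= mul0r add0r; have := h x; lra.
Qed.

Lemma sum3_bound {R : realType} (F : 'I_3 -> R) (c : R) : (forall i, `|F i| <= c) -> `|\sum_i F i| <= 3 * c.
Proof.
move=> h; apply: le_trans (ler_norm_sum _ _ _) _.
apply: le_trans (ler_sum _ (fun i _ => h i)) _.
by rewrite sumr_const card_ord mulr_natl.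
Qed.

(** * Integration and the space L^2 on open intervals *)

Section Interval.
Context {R : realType}.
Implicit Types (x y z a c k : R) (u v w f g : R -> R).

(** The domain is a set, not an oriented interval: the integral is 0 when [y <= x], so additivity
    requires ordered endpoints. *)
Definition I x y f : R := \int[@leb R]_(s in `]x, y[) f s.
Definition itg x y f : Prop := (@leb R).-integrable `]x, y[ (fun s => (f s)%:E).
Definition L2 x y u : Prop :=
  measurable_fun `]x, y[ u /\ itg x y (fun s => u s ^+ 2).
(** Equality almost everywhere is the only sense in which the chosen weak derivatives [wD] are
    determined. *)
Definition aeq x y u v : Prop :=
  {ae @leb R, forall s, s \in `]x, y[ -> u s = v s}.

Lemma mem_oo_sub x y x' y' : x' <= x -> y <= y' ->
  `]x, y[ `<=` `]x', y'[.
Proof.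
move=> xx yy s /=; rewrite !in_itv/= => /andP[h1 h2].
by rewrite (le_lt_trans xx h1) (lt_le_trans h2 yy).
Qed.

Lemma ae_leb_imp (P Q : R -> Prop) : (forall s, P s -> Q s) ->
  {ae @leb R, forall s, P s} -> {ae @leb R, forall s, Q s}.
Proof.
move=> h; apply: filterS => //.
exact: (ae_filter_ringOfSetsType (@lebesgue_measure R)).
Qed.

Lemma ae_leb_imp2 (P Q S : R -> Prop) : (forall s, P s -> Q s -> S s) ->
  {ae @leb R, forall s, P s} -> {ae @leb R, forall s, Q s} ->
  {ae @leb R, forall s, S s}.
Proof.
move=> h; apply: filterS2 => //.
exact: (ae_filter_ringOfSetsType (@lebesgue_measure R)).
Qed.

Lemma itg_meas x y f : itg x y f -> measurable_fun `]x, y[ f.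
Proof. by move=> /(measurable_int (@leb R)) /measurable_EFinP. Qed.

Lemma itg_sub x y x' y' f : x' <= x -> y <= y' -> itg x' y' f -> itg x y f.
Proof.
move=> xx yy; apply: integrableS; [exact: measurable_itv..|].
exact: mem_oo_sub.
Qed.

Lemma meas_sub x y x' y' f : x' <= x -> y <= y' ->
  measurable_fun `]x', y'[ f -> measurable_fun `]x, y[ f.
Proof.
move=> xx yy; apply: measurable_funS; first exact: measurable_itv.
exact: mem_oo_sub.
Qed.

Lemma le_itg x y f g : measurable_fun `]x, y[ f ->
  (forall s, s \in `]x, y[ -> `|f s| <= g s) -> itg x y g -> itg x y f.
Proof.
move=> mf fg; apply: le_integrable; first exact: measurable_itv.
  exact/measurable_EFinP.
move=> s /= sxy; rewrite lee_fin (le_trans (fg _ sxy))//; exact: ler_norm.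
Qed.

Lemma eq_itg x y f g : (forall s, s \in `]x, y[ -> f s = g s) ->
  itg x y f -> itg x y g.
Proof.
move=> fg; apply: eq_integrable; first exact: measurable_itv.
by move=> s; rewrite inE/= => sxy; rewrite fg.
Qed.

Lemma eq_I x y f g : (forall s, s \in `]x, y[ -> f s = g s) ->
  I x y f = I x y g.
Proof. by move=> fg; apply: eq_Rintegral => s; rewrite inE/=; exact: fg. Qed.

Lemma itgD x y f g : itg x y f -> itg x y g -> itg x y (fun s => f s + g s).
Proof.
move=> hf hg; have := @integrableD _ _ R (@lebesgue_measure R) `]x, y[%classic (measurable_itv _) _ _ hf hg.
exact.
Qed.

Lemma itgZ x y c f : itg x y f -> itg x y (fun s => c * f s).
Proof.
move=> hf; have := @integrableZl _ _ R (@lebesgue_measure R) `]x, y[%classic (measurable_itv _) c _ hf.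
exact.
Qed.

Lemma itgN x y f : itg x y f -> itg x y (fun s => - f s).
Proof.
move=> /(@itgZ x y (-1)); apply: eq_itg => s _; exact: mulN1r.
Qed.

Lemma itgB x y f g : itg x y f -> itg x y g -> itg x y (fun s => f s - g s).
Proof. by move=> hf /itgN; exact: itgD. Qed.

Lemma itg_norm x y f : itg x y f -> itg x y (fun s => `|f s|).
Proof. exact: integrable_norm. Qed.

Lemma leb_oo_lty x y : (@leb R `]x, y[ < +oo)%E.
Proof.
rewrite /leb lebesgue_measure_itv/=; case: ifP => _ //.
by rewrite -EFinB ltry.
Qed.

Lemma itg_bdd x y k f : measurable_fun `]x, y[ f ->
  (forall s, s \in `]x, y[ -> `|f s| <= k) -> itg x y f.
Proof.
move=> mf fk; apply: measurable_bounded_integrable => //.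
- exact: leb_oo_lty.
- exists k; split; first by rewrite num_real.
  move=> M kM s /= sxy; exact: le_trans (fk _ sxy) (ltW kM).
Qed.

Lemma itg_cst x y c : itg x y (fun=> c).
Proof. by apply: (@itg_bdd x y `|c|) => // s _. Qed.

Lemma ID x y f g : itg x y f -> itg x y g ->
  I x y (fun s => f s + g s) = I x y f + I x y g.
Proof. by move=> *; apply: RintegralD => //; exact: measurable_itv. Qed.

Lemma IB x y f g : itg x y f -> itg x y g ->
  I x y (fun s => f s - g s) = I x y f - I x y g.
Proof. by move=> *; apply: RintegralB => //; exact: measurable_itv. Qed.

Lemma IZ x y c f : itg x y f -> I x y (fun s => c * f s) = c * I x y f.
Proof. by move=> *; apply: RintegralZl => //; exact: measurable_itv. Qed.

Lemma IN x y f : itg x y f -> I x y (fun s => - f s) = - I x y f.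
Proof.
move=> hf; rewrite -mulN1r -IZ//; apply: eq_I => s _; by rewrite mulN1r.
Qed.

Lemma itg_sum {J : Type} (r : seq J) (P : pred J) (F : J -> R -> R) x y :
  (forall j, P j -> itg x y (F j)) -> itg x y (fun s => \sum_(j <- r | P j) F j s).
Proof.
move=> h; elim: r => [|j r IH].
  by apply: eq_itg (itg_cst x y 0) => s _; rewrite big_nil.
case Pj: (P j).
  by apply: eq_itg (itgD (h _ Pj) IH) => s _; rewrite big_cons Pj.
by apply: eq_itg IH => s _; rewrite big_cons Pj.
Qed.

Lemma I_ge0 x y f : (forall s, s \in `]x, y[ -> 0 <= f s) -> 0 <= I x y f.
Proof. by move=> h; apply: Rintegral_ge0 => s /=; exact: h. Qed.

Lemma I_sqr_ge0 x y u : 0 <= I x y (fun s => u s ^+ 2).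
Proof. by apply: I_ge0 => s _; exact: sqr_ge0. Qed.

Lemma le_I x y f g : itg x y f -> itg x y g ->
  (forall s, s \in `]x, y[ -> f s <= g s) -> I x y f <= I x y g.
Proof.
by move=> hf hg h; apply: le_Rintegral => //; exact: measurable_itv.
Qed.

Lemma norm_I x y f : itg x y f -> `|I x y f| <= I x y (fun s => `|f s|).
Proof. by move=> *; apply: le_normr_Rintegral => //; exact: measurable_itv. Qed.

Lemma I_cst x y c : x <= y -> I x y (fun=> c) = c * (y - x).
Proof.
move=> xy; rewrite /I Rintegral_cst; last exact: measurable_itv.
rewrite /= /leb lebesgue_measure_itv/=; case: ifP => //.
by rewrite lte_fin => /negbT; rewrite -leNgt => yx; congr (_ * _); rewrite /=; lra.
Qed.

Lemma I_eq0 x y f : (forall s, s \in `]x, y[ -> f s = 0) -> I x y f = 0.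
Proof.
move=> h; rewrite (eq_I (_ : forall s, s \in `]x, y[ -> f s = 0 * 0)) => [|s /h ->].
  by rewrite IZ ?mul0r//; exact: itg_cst.
by rewrite mulr0.
Qed.

Lemma I_sum {J : Type} (r : seq J) (P : pred J) (F : J -> R -> R) x y :
  (forall j, P j -> itg x y (F j)) ->
  I x y (fun s => \sum_(j <- r | P j) F j s) = \sum_(j <- r | P j) I x y (F j).
Proof.
move=> h; elim: r => [|j r IH].
  by rewrite big_nil; apply: I_eq0 => s _; rewrite big_nil.
rewrite big_cons; case Pj: (P j).
  rewrite -IH -ID//; [|exact: h|exact: itg_sum].
  by apply: eq_I => s _; rewrite big_cons Pj.
by rewrite -IH; apply: eq_I => s _; rewrite big_cons Pj.
Qed.

Lemma I_empty x y f : y <= x -> I x y f = 0.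
Proof.
by move=> yx; rewrite /I set_itv_ge ?Rintegral_set0// bnd_simp -leNgt.
Qed.

Lemma le_I_norm x y f g : itg x y f -> itg x y g ->
  (forall s, s \in `]x, y[ -> `|f s| <= g s) -> `|I x y f| <= I x y g.
Proof.
move=> hf hg h; apply: le_trans (norm_I hf) _.
by apply: le_I => //; exact: itg_norm.
Qed.

Lemma norm_I_le x y k f : x <= y -> measurable_fun `]x, y[ f ->
  (forall s, s \in `]x, y[ -> `|f s| <= k) -> `|I x y f| <= k * (y - x).
Proof.
move=> xy mf h; rewrite -I_cst//; apply: le_I_norm => //.
- exact: itg_bdd mf h.
- exact: itg_cst.
Qed.

Lemma I_split x y z f : x <= y -> y <= z -> itg x z f ->
  I x z f = I x y f + I y z f.
Proof.
move=> xy yz hf; have [xy'|yx] := ltP x y; last first.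
  by rewrite (@I_empty x y)// add0r (_ : x = y)//; apply/eqP; rewrite eq_le xy.
have [yz'|zy] := ltP y z; last first.
  by rewrite (@I_empty y z)// addr0 (_ : y = z)//; apply/eqP; rewrite eq_le yz.
have h := @Rintegral_itvB R f (BRight x) (BLeft z) y.
have hs : (@lebesgue_measure R).-integrable `]x, z[ (EFin \o f) by exact: hf.
have {h} := h hs; rewrite !bnd_simp => /(_ xy yz').
rewrite -/(I x z f) -/(I y z f) -Rintegral_itv_bndo_bndc; last exact: itg_sub hf.
by rewrite -/(I x y f) => <-; rewrite addrC subrK.
Qed.

Lemma I_sub_le x y x' y' f : x' <= x -> x <= y -> y <= y' -> itg x' y' f ->
  (forall s, s \in `]x', y'[ -> 0 <= f s) -> I x y f <= I x' y' f.
Proof.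
move=> xx xy yy hf f0.
rewrite (@I_split x' x y')//; last exact: le_trans yy.
rewrite (@I_split x y y')//; last exact: itg_sub hf.
have h1 : 0 <= I x' x f.
  by apply: I_ge0 => s sx; apply: f0; apply: mem_oo_sub sx => //; exact: le_trans yy.
have h2 : 0 <= I y y' f.
  by apply: I_ge0 => s sx; apply: f0; apply: mem_oo_sub sx => //; exact: le_trans xy.
by lra.
Qed.

Lemma aeq_I x y u v : measurable_fun `]x, y[ u -> measurable_fun `]x, y[ v ->
  aeq x y u v -> I x y u = I x y v.
Proof.
move=> mu mv uv; congr fine; apply: ae_eq_integral => //.
- exact/measurable_EFinP.
- exact/measurable_EFinP.
- by apply: ae_leb_imp uv => s h /= sxy; rewrite h.
Qed.

Lemma aeq_itg x y u v : measurable_fun `]x, y[ v ->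
  aeq x y u v -> itg x y u -> itg x y v.
Proof.
move=> mv uv iu; have mu := itg_meas iu.
apply/integrableP; split; first exact/measurable_EFinP.
have /integrableP[_] := iu.
congr (_ < _)%E; apply: ae_eq_integral => //.
- by apply: measurableT_comp => //; exact/measurable_EFinP.
- by apply: measurableT_comp => //; exact/measurable_EFinP.
- by apply: ae_leb_imp uv => s h /= sxy; rewrite h.
Qed.

Lemma aeqW x y u v : (forall s, s \in `]x, y[ -> u s = v s) -> aeq x y u v.
Proof. by move=> h; apply: aeW. Qed.

Lemma aeq_sym x y u v : aeq x y u v -> aeq x y v u.
Proof. by apply: ae_leb_imp => s h /h. Qed.

Lemma aeq_trans x y u v w : aeq x y u v -> aeq x y v w -> aeq x y u w.
Proof. by apply: ae_leb_imp2 => s h1 h2 sxy; rewrite h1 ?h2. Qed.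

Lemma aeq_sub x y x' y' u v : x' <= x -> y <= y' -> aeq x' y' u v -> aeq x y u v.
Proof.
move=> xx yy; apply: ae_leb_imp => s h sxy; apply: h; exact: mem_oo_sub sxy.
Qed.

Lemma L2_sub x y x' y' f : x' <= x -> y <= y' -> L2 x' y' f -> L2 x y f.
Proof. by move=> xx yy [h1 h2]; split; [exact: meas_sub h1|exact: itg_sub h2]. Qed.

Lemma L2_mul x y u v : L2 x y u -> L2 x y v -> itg x y (fun s => u s * v s).
Proof.
move=> [mu iu] [mv iv]; apply: le_itg (itgD iu iv).
  exact: measurable_funM.
move=> s _; rewrite ler_norml; apply/andP; split; nra.
Qed.

Lemma L2_bmul x y k w u : measurable_fun `]x, y[ w ->
  (forall s, s \in `]x, y[ -> `|w s| <= k) -> L2 x y u ->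
  L2 x y (fun s => w s * u s).
Proof.
move=> mw wk [mu iu]; split; first exact: measurable_funM.
apply: le_itg (itgZ (k ^+ 2) iu).
  by apply: measurable_funX; exact: measurable_funM.
move=> s sxy; rewrite ger0_norm ?sqr_ge0// exprMn.
have /ler_normlP[] := wk _ sxy => h1 h2.
by apply: ler_wpM2r; [exact: sqr_ge0|nra].
Qed.

Lemma L2_bdd x y k w : measurable_fun `]x, y[ w ->
  (forall s, s \in `]x, y[ -> `|w s| <= k) -> L2 x y w.
Proof.
move=> mw wk; split => //; apply: (@itg_bdd _ _ (k ^+ 2)).
  exact: measurable_funX.
by move=> s sxy; rewrite normrX; have := wk _ sxy; have := normr_ge0 (w s); nra.
Qed.

Lemma L2_cst x y c : L2 x y (fun=> c).
Proof. by apply: (@L2_bdd x y `|c|) => // s _. Qed.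

Lemma eq_L2 x y u v : (forall s, s \in `]x, y[ -> u s = v s) ->
  L2 x y u -> L2 x y v.
Proof.
move=> uv [mu iu]; split.
  apply: eq_measurable_fun mu => s; rewrite inE/= => sxy; exact: uv.
by apply: eq_itg iu => s sxy; rewrite uv.
Qed.

Lemma L2D x y u v : L2 x y u -> L2 x y v -> L2 x y (fun s => u s + v s).
Proof.
move=> hu hv; split; first by apply: measurable_funD; [case: hu|case: hv].
apply: eq_itg (itgD (itgD (proj2 hu) (proj2 hv))
  (itgZ 2 (L2_mul hu hv))) => s _.
by ring.
Qed.

Lemma L2Z x y c u : L2 x y u -> L2 x y (fun s => c * u s).
Proof. by move=> hu; apply: (@L2_bmul x y `|c|) => // s _. Qed.

Lemma L2N x y u : L2 x y u -> L2 x y (fun s => - u s).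
Proof. by move=> /(L2Z (-1)); apply: eq_L2 => s _; rewrite mulN1r. Qed.

Lemma L2B x y u v : L2 x y u -> L2 x y v -> L2 x y (fun s => u s - v s).
Proof. by move=> hu /L2N; exact: L2D. Qed.

Lemma L2_norm x y u : L2 x y u -> L2 x y (fun s => `|u s|).
Proof.
move=> [mu iu]; split; first exact: measurableT_comp.
by apply: eq_itg iu => s _; rewrite real_normK// num_real.
Qed.

Lemma L2_sum {J : Type} (r : seq J) (P : pred J) (F : J -> R -> R) x y :
  (forall j, P j -> L2 x y (F j)) -> L2 x y (fun s => \sum_(j <- r | P j) F j s).
Proof.
move=> h; elim: r => [|j r IH].
  by apply: eq_L2 (L2_cst x y 0) => s _; rewrite big_nil.
case Pj: (P j).
  by apply: eq_L2 (L2D (h _ Pj) IH) => s _; rewrite big_cons Pj.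
by apply: eq_L2 IH => s _; rewrite big_cons Pj.
Qed.

Lemma aeq_L2 x y u v : measurable_fun `]x, y[ v -> aeq x y u v ->
  L2 x y u -> L2 x y v.
Proof.
move=> mv uv [mu iu]; split => //; apply: aeq_itg iu.
  exact: measurable_funX.
by apply: ae_leb_imp uv => s h sxy; rewrite h.
Qed.

Lemma L2_itg x y u : L2 x y u -> itg x y u.
Proof.
move=> hu; apply: eq_itg (L2_mul hu (L2_cst _ _ 1)) => s _.
exact: mulr1.
Qed.

Definition nrm x y u : R := Num.sqrt (I x y (fun s => u s ^+ 2)).

Lemma nrm_ge0 x y u : 0 <= nrm x y u.
Proof. exact: sqrtr_ge0. Qed.

Lemma nrm_sqr x y u : nrm x y u ^+ 2 = I x y (fun s => u s ^+ 2).
Proof. by rewrite sqr_sqrtr//; exact: I_sqr_ge0. Qed.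

Lemma eq_nrm x y u v : (forall s, s \in `]x, y[ -> u s = v s) ->
  nrm x y u = nrm x y v.
Proof. by move=> h; congr Num.sqrt; apply: eq_I => s sxy; rewrite h. Qed.

Lemma aeq_nrm x y u v : measurable_fun `]x, y[ u -> measurable_fun `]x, y[ v ->
  aeq x y u v -> nrm x y u = nrm x y v.
Proof.
move=> mu mv h; congr Num.sqrt; apply: aeq_I; [exact: measurable_funX..|].
by apply: ae_leb_imp h => s h sxy; rewrite h.
Qed.

(** The quadratic in [c] feeds the discriminant in [cauchy_schwarz] and, later, the variation of the
    functional along a segment. *)
Lemma quad_expand x y c u v : L2 x y u -> L2 x y v ->
  I x y (fun s => (u s + c * v s) ^+ 2) =
  I x y (fun s => u s ^+ 2) + 2 * c * I x y (fun s => u s * v s)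
  + c ^+ 2 * I x y (fun s => v s ^+ 2).
Proof.
move=> hu hv; have h1 := proj2 hu; have h2 := proj2 hv; have h3 := L2_mul hu hv.
rewrite -!IZ// -ID//; last exact: itgZ.
rewrite -ID; [|by apply: itgD => //; exact: itgZ|exact: itgZ].
by apply: eq_I => s _; ring.
Qed.

Lemma cauchy_schwarz x y u v : L2 x y u -> L2 x y v ->
  `|I x y (fun s => u s * v s)| <= nrm x y u * nrm x y v.
Proof.
move=> hu hv; rewrite -ler_sqr ?nnegrE ?mulr_ge0 ?nrm_ge0// exprMn !nrm_sqr.
rewrite real_normK ?num_real//; apply: quadratic_disc => t.
rewrite -quad_expand//; exact: I_sqr_ge0.
Qed.

Lemma nrmD x y u v : L2 x y u -> L2 x y v ->
  nrm x y (fun s => u s + v s) <= nrm x y u + nrm x y v.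
Proof.
move=> hu hv; rewrite -ler_sqr ?nnegrE ?addr_ge0 ?nrm_ge0// nrm_sqr.
rewrite (@eq_I _ _ _ (fun s => (u s + 1 * v s) ^+ 2)) => [|s _]; last by rewrite mul1r.
rewrite quad_expand// expr1n mul1r mulr1.
rewrite -!nrm_sqr; have := cauchy_schwarz hu hv.
by move=> /(le_trans (ler_norm _)); nra.
Qed.

Lemma nrm_sum {J : Type} (r : seq J) (F : J -> R -> R) x y : (forall j, L2 x y (F j)) ->
  nrm x y (fun s => \sum_(j <- r) F j s) <= \sum_(j <- r) nrm x y (F j).
Proof.
move=> h; elim: r => [|j r IH].
  by rewrite big_nil /nrm I_eq0 ?sqrtr0// => s _; rewrite big_nil expr0n.
rewrite big_cons; apply: le_trans (lerD (lexx _) IH).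
rewrite (@eq_nrm _ _ _ (fun s => F j s + \sum_(j <- r) F j s)); last by move=> s _; rewrite big_cons.
by apply: nrmD => //; apply: L2_sum.
Qed.

Lemma nrmZ x y c u : L2 x y u -> nrm x y (fun s => c * u s) = `|c| * nrm x y u.
Proof.
move=> hu; rewrite /nrm -sqrtr_sqr -sqrtrM ?sqr_ge0// -IZ; last by case: hu.
by congr Num.sqrt; apply: eq_I => s _; rewrite exprMn.
Qed.

Lemma nrmN x y u : nrm x y (fun s => - u s) = nrm x y u.
Proof. by congr Num.sqrt; apply: eq_I => s _; rewrite sqrrN. Qed.

Lemma nrm_norm x y u : nrm x y (fun s => `|u s|) = nrm x y u.
Proof. by congr Num.sqrt; apply: eq_I => s _; rewrite real_normK// num_real. Qed.

Lemma nrm_sub x y x' y' u : x' <= x -> x <= y -> y <= y' -> L2 x' y' u ->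
  nrm x y u <= nrm x' y' u.
Proof.
move=> xx xy yy [_ iu]; rewrite ler_sqrt; last exact: I_sqr_ge0.
by apply: I_sub_le => // s _; exact: sqr_ge0.
Qed.

Lemma le_nrm x y u v : L2 x y u -> L2 x y v ->
  (forall s, s \in `]x, y[ -> `|u s| <= v s) -> nrm x y u <= nrm x y v.
Proof.
move=> [_ iu] [_ iv] h; rewrite ler_sqrt; last exact: I_sqr_ge0.
apply: le_I => // s /h; have := normr_ge0 (u s).
by rewrite -(real_normK (num_real (u s))); nra.
Qed.

Lemma nrm_cst x y c : x <= y -> nrm x y (fun=> c) = `|c| * Num.sqrt (y - x).
Proof. by move=> xy; rewrite /nrm I_cst// sqrtrM ?sqr_ge0// sqrtr_sqr. Qed.

Lemma nrm_bmul x y k w u : 0 <= k -> measurable_fun `]x, y[ w ->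
  (forall s, s \in `]x, y[ -> `|w s| <= k) -> L2 x y u ->
  nrm x y (fun s => w s * u s) <= k * nrm x y u.
Proof.
move=> k0 mw wk hu; rewrite -{1}(ger0_norm k0) -(nrm_norm _ _ u) -nrmZ; last exact: L2_norm.
apply: le_nrm.
- exact: L2_bmul wk hu.
- exact/L2Z/L2_norm.
- by move=> s sxy; rewrite normrM ler_wpM2r// wk.
Qed.

Lemma I_le_nrm x y u : x <= y -> L2 x y u ->
  `|I x y u| <= Num.sqrt (y - x) * nrm x y u.
Proof.
move=> xy hu; have := cauchy_schwarz (L2_cst x y 1) hu.
by rewrite nrm_cst// normr1 mul1r (@eq_I _ _ _ u)// => s _; rewrite mul1r.
Qed.

Lemma L2_I_norm x y u : x <= y -> L2 x y u ->
  I x y (fun s => `|u s|) <= Num.sqrt (y - x) * nrm x y u.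
Proof.
move=> xy hu; apply: le_trans (ler_norm _) _.
by rewrite -(nrm_norm _ _ u); apply: I_le_nrm => //; exact: L2_norm.
Qed.

End Interval.

(** * Smooth test functions: a bump, a mollifier and a smoothed step *)

Section Smooth.
Context {R : realType}.
Implicit Types (x y z a c d k : R) (f g : R -> R) (p : {poly R}).

(** Termwise, [y ^ i / i! <= expR y]; at [y = x^-1] this lets the exponential absorb any polynomial
    in [x^-1]. *)
Lemma exp_dominates p : exists2 C : R, 0 <= C &
  forall y, 0 <= y -> `|p.[y]| <= C * expR y.
Proof.
pose C := \sum_(i < size p) `|p`_i| * (i`!)%:R.
exists C => [|y y0]; first by apply: sumr_ge0 => i _; rewrite mulr_ge0.
rewrite horner_coef (le_trans (ler_norm_sum _ _ _))// /C mulr_suml.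
apply: ler_sum => i _; rewrite normrM -mulrA ler_wpM2l// normrX (ger0_norm y0).
case: (nat_of_ord i) => [|n]; first by rewrite expr0 fact0 mul1r -expR0 ler_expR.
have f0 : (0 : R) < (n.+1)`!%:R by rewrite ltr0n fact_gt0.
rewrite -ler_pdivrMl// mulrC; have := expR_ge1Dxn n y0; lra.
Qed.

(* The polynomial factor makes this family stable under differentiation. *)
Definition Fexp p x : R := if 0 < x then p.[x^-1] * expR (- x^-1) else 0.

(** Dominating ['X^2 * p] instead of [p] gains the factor [x ^+ 2], which makes the difference
    quotient at 0 tend to 0. *)
Lemma Fexp_bound p : exists2 C : R, 0 <= C & forall x, `|Fexp p x| <= C * x ^+ 2.
Proof.
have [C C0 hC] := exp_dominates ('X^2 * p); exists C => // x.
rewrite /Fexp; case: ifPn => [x0|_]; last by rewrite normr0 mulr_ge0 ?sqr_ge0.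
have := hC x^-1; rewrite invr_ge0 => /(_ (ltW x0)).
rewrite hornerM hornerXn normrM (ger0_norm (sqr_ge0 _)) => h.
rewrite normrM.
rewrite (ger0_norm (expR_ge0 _)) expRN ler_pdivrMr ?expR_gt0//.
move: h; rewrite exprVn.
by rewrite ler_pdivrMl ?exprn_gt0// => h; apply: le_trans h _; lra.
Qed.

(** With $y = 1/x$, the operator $d/dx = -y^2\,d/dy$ sends $p(y)e^{-y}$ to $y^2(p-p')(y)e^{-y}$.
    Left of 0 the function is locally zero, and at 0 itself the quadratic bound gives derivative
    0. *)
Lemma is_derive_Fexp p x : is_derive x 1 (Fexp p) (Fexp ('X^2 * (p - p^`())) x).
Proof.
have [x0|x0|->] := ltgtP x 0.
- rewrite {2}/Fexp ltNge (ltW x0)/=.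
  apply: (@near_eq_is_derive _ _ _ (cst 0)).
  by near=> z; rewrite /Fexp ifF//; apply/negbTE; rewrite -leNgt; near: z; apply: filterS (lt_nbhsl x0) => z; exact: ltW.
- rewrite {2}/Fexp x0.
  apply: (@near_eq_is_derive _ _ _ ((fun z => p.[z^-1]) * (fun z => expR (- z^-1)))).
    by near=> z; rewrite /Fexp ifT//; near: z; exact: lt_nbhsr.
  have xn0 : x != 0 by rewrite gt_eqF.
  have dV : is_derive x (1 : R) (fun z => z^-1) (- x ^- 2 *: 1) by exact: is_deriveV.
  have d1 := is_derive1_comp (is_derive_poly p x^-1) dV.
  have d2 : is_derive x (1 : R) (fun z => - z^-1) (- (- x ^- 2 *: 1)).
    exact: is_deriveN.
  have d3 : is_derive x (1 : R) (fun z => expR (- z^-1)) (expR (- x^-1) * (- (- x ^- 2 *: 1))).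
    by apply: (@is_derive1_comp _ expR (fun z => - z^-1)).
  apply: is_derive_eq (is_deriveM d1 d3) _.
  rewrite hornerM hornerXn hornerD hornerN /GRing.scale/= !mulr1 exprVn; ring.
- rewrite {2}/Fexp ltxx.
  have [C C0 hC] := Fexp_bound p.
  have F0 : Fexp p 0 = 0 by rewrite /Fexp ltxx.
  have lim0 : h^-1 *: ((Fexp p \o shift 0) (h *: 1) - Fexp p 0) @[h --> 0^'] --> (0 : R).
    apply/cvgr0Pnorm_le => e e0; near=> h.
    have hn0 : h != 0 by near: h; exact: nbhs_dnbhs_neq.
    rewrite /= F0 subr0 addr0 /GRing.scale/= mulr1 normrM normfV.
    rewrite ler_pdivrMl ?normr_gt0//.
    apply: le_trans (hC h) _; rewrite -real_normK ?num_real// expr2 mulrA mulrC ler_wpM2l//.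
    have : `|h| <= e / (C + 1).
      near: h; apply: nbhs_dnbhs; apply/nbhs_normP; exists (e / (C + 1)) => /=.
        by rewrite divr_gt0// ltr_wpDl.
      by move=> z /=; rewrite sub0r normrN => /ltW.
    rewrite ler_pdivlMr; last by rewrite ltr_wpDl.
    have := normr_ge0 h; nra.
  apply: DeriveDef; first by apply/cvg_ex; exists 0.
  exact: cvg_lim lim0.
Unshelve. all: by end_near. Qed.

(* Every member has a derivative that is again a member, hence is smooth. *)
Inductive smooth_alg : (R -> R) -> Prop :=
| Sm_exp p : smooth_alg (Fexp p)
| Sm_cst c : smooth_alg (fun=> c)
| Sm_add f g : smooth_alg f -> smooth_alg g -> smooth_alg (fun x => f x + g x)
| Sm_mul f g : smooth_alg f -> smooth_alg g -> smooth_alg (fun x => f x * g x)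
| Sm_aff c d f : smooth_alg f -> smooth_alg (fun x => f (c * x + d))
| Sm_prim f f' : (forall x, is_derive x 1 f (f' x)) -> smooth_alg f' ->
    smooth_alg f.

Lemma smooth_alg_der f : smooth_alg f ->
  exists2 f', smooth_alg f' & forall x, is_derive x 1 f (f' x).
Proof.
elim=> {f} [p|c|f g sf [f' sf' df] sg [g' sg' dg]
  |f g sf [f' sf' df] sg [g' sg' dg]|c d f sf [f' sf' df]|f f' df sf' _].
- by exists (Fexp ('X^2 * (p - p^`()))); [exact: Sm_exp|exact: is_derive_Fexp].
- by exists (fun=> 0); [exact: Sm_cst|move=> x; exact: is_derive_cst].
- exists (fun x => f' x + g' x); first exact: Sm_add.
  by move=> x; exact: is_deriveD.
- exists (fun x => f x * g' x + g x * f' x).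
    by apply: Sm_add; apply: Sm_mul.
  by move=> x; exact: is_deriveM.
- exists (fun x => f' (c * x + d) * c).
    by apply: Sm_mul; [exact: Sm_aff|exact: Sm_cst].
  move=> x; apply: is_derive1_comp => //.
  have h : is_derive x (1 : R) (fun z : R => c * z + d) (c *: 1 + 0).
    by apply: is_deriveD; apply: is_deriveZ.
  by apply: is_derive_eq h _; rewrite addr0 /GRing.scale/= mulr1.
- by exists f'.
Qed.

Lemma derive1_is_derive f f' : (forall x, is_derive x 1 f (f' x)) -> derive1 f = f'.
Proof. by move=> h; apply/funext => x; rewrite derive1E; case: (h x). Qed.

Lemma smooth_algP f : smooth_alg f ->
  forall (n : nat) (x : R), derivable (derive1n n f) x 1.
Proof.
move=> sf n; elim: n f sf => [|n IH] f sf x.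
  by have [f' _ df] := smooth_alg_der sf; rewrite derive1n0; case: (df x).
have [f' sf' df] := smooth_alg_der sf.
by rewrite derive1Sn (derive1_is_derive df); exact: IH.
Qed.

Lemma is_derive_cont f f' : (forall x, is_derive x 1 f (f' x)) -> continuous f.
Proof.
by move=> h x; apply: differentiable_continuous; apply/derivable1_diffP; case: (h x).
Qed.

Lemma smooth_alg_cont f : smooth_alg f -> continuous f.
Proof. by move=> /smooth_alg_der[f' _ h]; exact: is_derive_cont h. Qed.

Lemma test_function_alg a c d f : smooth_alg f -> 0 < c -> d < a ->
  (forall x, x \notin `[c, d] -> f x = 0) -> test_function a f.
Proof. by move=> sf c0 da h; split; [exact: smooth_algP|exists c, d]. Qed.

Lemma cont_meas (D : set R) f : measurable D -> continuous f -> measurable_fun D f.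
Proof.
move=> mD cf; apply: (@measurable_funS _ _ _ _ setT) => //.
exact: continuous_measurable_fun.
Qed.

Lemma cont_itg a c f : continuous f -> (@leb R).-integrable `[a, c] (EFin \o f).
Proof.
move=> cf; apply: continuous_compact_integrable; first exact: segment_compact.
exact: continuous_subspaceT.
Qed.

Lemma FTC2_I x y f f' : x <= y -> (forall z, is_derive z 1 f (f' z)) ->
  continuous f' -> f y - f x = I x y f'.
Proof.
rewrite le_eqVlt => /orP[/eqP <-|xy] df cf'; first by rewrite subrr I_empty.
have itf : (@lebesgue_measure R).-integrable `[x, y] (EFin \o f').
  exact: cont_itg.
have := @continuous_FTC2 R f' f x y xy.
rewrite (_ : (f y)%:E - (f x)%:E = (f y - f x)%:E)%E//.
move=> h; have {}h : (\int[lebesgue_measure]_(z in `[x, y]) (f' z)%:E = (f y - f x)%:E)%E.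
  apply: h.
  - exact: continuous_subspaceT.
  - have cf := is_derive_cont df.
    split; first by move=> z _; case: (df z).
      by apply: cvg_at_right_filter; exact: cf.
    by apply: cvg_at_left_filter; exact: cf.
  - by move=> z _; rewrite derive1E; case: (df z).
rewrite /I Rintegral_itv_obnd_cbnd; last first.
  by apply: integrableS itf => //; exact: subset_itv_oo_cc.
rewrite Rintegral_itv_bndo_bndc.
  by rewrite /Rintegral h.
by apply: integrableS itf => // s /=; rewrite !in_itv/= => /andP[-> /ltW].
Qed.

(** This is $e^{-1/x}e^{-1/(1-x)}$ on the unit interval; [1 - x] is spelled as an affine map to
    match the constructor [Sm_aff]. *)
Definition bump x : R := Fexp 1 x * Fexp 1 (- 1 * x + 1).

Lemma Fexp1_bnd y : 0 <= Fexp 1 y <= 1.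
Proof.
rewrite /Fexp; case: ifP => [y0|_]; last by rewrite lexx ler01.
rewrite hornerC mul1r expR_ge0/= -expR0 ler_expR oppr_le0 invr_ge0; exact: ltW.
Qed.

Lemma bump_ge0 x : 0 <= bump x.
Proof. by rewrite mulr_ge0// (andP (Fexp1_bnd _)).1. Qed.

Lemma bump_eq0 x : x \notin `]0, 1[ -> bump x = 0.
Proof.
rewrite in_itv/= negb_and -!leNgt /bump /Fexp => /orP[x0|x1].
  by rewrite (ltNge 0 x) x0 mul0r.
by rewrite [X in _ * X]ifF ?mulr0//; apply/negbTE; rewrite -leNgt; lra.
Qed.

Lemma bump_le1 x : bump x <= 1.
Proof.
rewrite /bump; have /andP[a1 a2] := Fexp1_bnd x.
by have /andP[b1 b2] := Fexp1_bnd (-1 * x + 1); nra.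
Qed.

Lemma bump_alg : smooth_alg bump.
Proof. by apply: Sm_mul; [|apply: Sm_aff]; exact: Sm_exp. Qed.

Lemma bump_cont : continuous bump. Proof. exact: smooth_alg_cont bump_alg. Qed.

Lemma bump_itg x y : itg x y bump.
Proof.
apply: (@itg_bdd _ _ _ 1); first by apply: cont_meas bump_cont; exact: measurable_itv.
by move=> s _; rewrite ger0_norm ?bump_ge0// bump_le1.
Qed.

Definition mass : R := I 0 1 bump.

Lemma mass_gt0 : 0 < mass.
Proof.
have b0 : 0 < bump (1/2).
  by rewrite /bump /Fexp !ifT; [rewrite mulr_gt0// hornerC mul1r expR_gt0|lra|lra].
(* By continuity [bump] stays above half of its value at 1/2 on a short interval to the right, of
   length at most 1/4 so as to remain in ]0, 1[. *)
set e := bump (1/2) / 2; have e0 : 0 < e by rewrite /e; lra.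
have /cvgr_dist_lt/(_ _ e0) := @bump_cont (1/2).
move=> /nbhs_normP[d /= d0 hd].
pose d' := Num.min d (1/4); have d'0 : 0 < d' by rewrite /d' lt_min d0/=; lra.
have [dd d4] : d' <= d /\ d' <= 1/4 by split; rewrite /d' ge_min lexx ?orbT.
apply: (@lt_le_trans _ _ (I (1/2) (1/2 + d') (fun=> e))).
  by rewrite I_cst; [rewrite mulr_gt0//; lra|lra].
apply: (@le_trans _ _ (I (1/2) (1/2 + d') bump)).
  apply: le_I; [exact: itg_cst|exact: bump_itg|move=> s /=; rewrite in_itv/= => /andP[s1 s2]].
  have /ltr_normlP[_] : `|bump (1/2) - bump s| < e by apply: hd => /=; rewrite ltr_norml; lra.
  by rewrite /e; have := b0; move: (bump (1/2)) => b; lra.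
apply: I_sub_le; [lra|lra|lra|exact: bump_itg|by move=> s _; exact: bump_ge0].
Qed.

Definition rho x : R := mass^-1 * bump x.
(** Starting the integral at -1 rather than at 0 puts 0 in the interior of the domain, so the
    fundamental theorem applies there too. *)
Definition step x : R := mass^-1 * \int[@leb R]_(s in `[-1, x]) bump s.

Lemma step_I x : -1 <= x -> step x = mass^-1 * I (-1) x bump.
Proof.
move=> x1; congr (_ * _); rewrite /I Rintegral_itv_obnd_cbnd ?Rintegral_itv_bndo_bndc//.
  apply: integrableS (cont_itg (-1) x bump_cont) => //.
  by move=> s /=; rewrite !in_itv/= => /andP[-> /ltW].
by apply: integrableS (cont_itg (-1) x bump_cont) => //; exact: subset_itv_oo_cc.
Qed.

Lemma bump_I0 x y : y <= 0 -> I x y bump = 0.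
Proof.
move=> y0; apply: I_eq0 => s; rewrite in_itv/= => /andP[_ sy]; apply: bump_eq0.
by rewrite in_itv/= negb_and -leNgt (le_trans (ltW sy)).
Qed.

Lemma bump_I1 x y : 1 <= x -> I x y bump = 0.
Proof.
move=> y0; apply: I_eq0 => s; rewrite in_itv/= => /andP[sy _]; apply: bump_eq0.
by rewrite in_itv/= negb_and -!leNgt (le_trans y0 (ltW sy)) orbT.
Qed.

Lemma step0 x : x <= 0 -> step x = 0.
Proof.
move=> x0; have [x1|x1] := leP (-1) x; first by rewrite step_I// bump_I0// mulr0.
by rewrite /step set_itv_ge ?Rintegral_set0 ?mulr0// bnd_simp -ltNge.
Qed.

Lemma step_pos x : 0 <= x -> step x = mass^-1 * I 0 x bump.
Proof.
move=> x0; rewrite step_I; last lra.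
rewrite (@I_split _ (-1) 0 x) ?(@bump_I0 (-1) 0) ?add0r//.
exact: bump_itg.
Qed.

Lemma step1 x : 1 <= x -> step x = 1.
Proof.
move=> x1; rewrite step_pos; last lra.
rewrite (@I_split _ 0 1 x)//; [|exact: bump_itg].
by rewrite (@bump_I1 1 x)// addr0 mulVf// gt_eqF// mass_gt0.
Qed.

Lemma step_bnd x : `|step x| <= 1.
Proof.
have [x0|/ltW x0] := leP x 0; first by rewrite step0// normr0.
have [x1|/ltW x1] := leP 1 x; first by rewrite step1// normr1.
rewrite step_pos// ger0_norm ?mulr_ge0 ?invr_ge0 ?(ltW mass_gt0)//; last first.
  by apply: I_ge0 => s _; exact: bump_ge0.
rewrite ler_pdivrMl ?mass_gt0// mulr1; apply: I_sub_le => //; first exact: bump_itg.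
by move=> s _; exact: bump_ge0.
Qed.

Lemma is_derive_step x : is_derive x 1 step (rho x).
Proof.
have [x0|x0] := ltP x 0.
  have -> : rho x = 0.
    by rewrite /rho bump_eq0 ?mulr0// in_itv/= negb_and -leNgt ltW.
  apply: (@near_eq_is_derive _ _ _ (cst 0)).
  by near=> z; rewrite step0//; near: z; apply: filterS (lt_nbhsl x0) => z; exact: ltW.
have h : x < x + 1 by lra.
pose F y := \int[@leb R]_(s in `[-1, y]) bump s.
have x1 : -1 < x by lra.
have [d1 d2] : derivable F x 1 /\ (derive1 F) x = bump x.
  exact: (@continuous_FTC1_closed R bump (-1) x (x+1) h (cont_itg _ _ bump_cont) x1 (@bump_cont x)).
have dF : is_derive x 1 F (bump x) by apply: (DeriveDef d1); rewrite -derive1E.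
exact: (is_deriveZ mass^-1 dF).
Unshelve. all: by end_near. Qed.

Lemma rho_alg : smooth_alg rho.
Proof. by apply: Sm_mul; [exact: Sm_cst|exact: bump_alg]. Qed.

Lemma step_alg : smooth_alg step.
Proof. exact: Sm_prim is_derive_step rho_alg. Qed.

Lemma rho_bnd : exists2 K : R, 0 <= K & forall x, `|rho x| <= K.
Proof.
exists mass^-1 => [|x]; first by rewrite invr_ge0 ltW// mass_gt0.
rewrite /rho ger0_norm; last first.
  by apply: mulr_ge0; [rewrite invr_ge0 ltW// mass_gt0|exact: bump_ge0].
by rewrite ler_piMr ?bump_le1// invr_ge0 ltW// mass_gt0.
Qed.

Lemma rho_eq0 x : x \notin `]0, 1[ -> rho x = 0.
Proof. by move=> h; rewrite /rho bump_eq0// mulr0. Qed.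

(** For n > 0, [rhon n c] is a one-sided mollifier supported in [c, c + 1/n], and [stepn n c] is its
    primitive, a smoothed Heaviside step at [c]. *)
Definition rhon (n : nat) c x : R := n%:R * rho (n%:R * x + (- (n%:R * c))).
Definition stepn (n : nat) c x : R := step (n%:R * x + (- (n%:R * c))).

Lemma rhon_alg n c : smooth_alg (rhon n c).
Proof. by apply: Sm_mul; [exact: Sm_cst|exact/Sm_aff/rho_alg]. Qed.

Lemma stepn_alg n c : smooth_alg (stepn n c).
Proof. exact/Sm_aff/step_alg. Qed.

Lemma is_derive_stepn n c x : is_derive x 1 (stepn n c) (rhon n c x).
Proof.
have h : is_derive x (1 : R) (fun z : R => n%:R * z + (- (n%:R * c))) (n%:R *: 1 + 0).
  by apply: is_deriveD; apply: is_deriveZ.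
have d := is_derive1_comp (is_derive_step _) h.
by apply: is_derive_eq d _; rewrite addr0 /GRing.scale/= mulr1 mulrC.
Qed.

Lemma rhon_eq0 n c x : (0 < n)%N -> x \notin `]c, c + n%:R^-1[ -> rhon n c x = 0.
Proof.
move=> n0; rewrite /rhon in_itv/= negb_and -!leNgt => h.
have n1 : (0 : R) < n%:R by rewrite ltr0n.
rewrite rho_eq0 ?mulr0// in_itv/= negb_and -!leNgt.
case/orP: h => [xc|cx]; apply/orP; [left|right]; first by nra.
have : n%:R * (c + n%:R^-1) <= n%:R * x by rewrite ler_pM2l.
by rewrite mulrDr divff ?gt_eqF//; lra.
Qed.

Lemma stepn_eq0 n c x : x <= c -> stepn n c x = 0.
Proof. by move=> xc; apply: step0; have : (0:R) <= n%:R by []; nra. Qed.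

Lemma stepn_eq1 n c x : (0 < n)%N -> c + n%:R^-1 <= x -> stepn n c x = 1.
Proof.
move=> n0 h; have n1 : (0 : R) < n%:R by rewrite ltr0n.
apply: step1; have : n%:R * (c + n%:R^-1) <= n%:R * x by rewrite ler_pM2l.
by rewrite mulrDr divff ?gt_eqF//; lra.
Qed.

End Smooth.

(** * Lebesgue points, the fundamental lemma and primitives of weak derivatives *)

Section LebesguePoints.
Context {R : realType}.
Implicit Types (x y z a c d k e r : R) (u v w f g : R -> R).

(** An interval of positive length is not contained in a null set. *)
Lemma ae_ex x y (P : R -> Prop) : x < y -> {ae @leb R, forall s, P s} ->
  exists2 s, s \in `]x, y[ & P s.
Proof.
move=> xy [A [mA A0 hA]]; apply: contrapT => nex.
have sub : `]x, y[ `<=` A.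
  move=> s sxy; apply: hA => /= Ps; apply: nex; exists s => //.
have := @le_measure _ _ _ (@lebesgue_measure R) _ _ _ _ sub.
rewrite !inE => /(_ (measurable_itv _) mA).
move=> hle.
have e1 : lebesgue_measure (`]x, y[%classic : set R) = (y - x)%:E.
  by rewrite lebesgue_measure_itv/= lte_fin xy.
have : ((y - x)%:E <= 0 :> \bar R)%E by rewrite -e1 -A0; exact: hle.
by rewrite lee_fin; lra.
Qed.

(** Translates the averages that define [lebesgue_pt] into [I]; the two bounds on [r] keep the ball
    inside ]0, a[, where the restriction of [w] is [w]. *)
Lemma davg_I a w c r : 0 < r -> r <= c -> r <= a - c -> itg 0 a w ->
  davg (w \_ `]0, a[) c r =
  ((2 * r)^-1 * I (c - r) (c + r) (fun s => `|w s - w c|))%:E.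
Proof.
move=> r0 rc rac iw; rewrite /davg /iavg.
rewrite (lebesgue_measure_ball _ (ltW r0)) ball_itv.
rewrite inver mulrn_eq0/= gt_eqF//= EFinM; congr (_ * _)%E.
  by rewrite mulr_natl.
have ig : itg (c - r) (c + r) (fun s => `|w s - w c|).
  by apply/itg_norm/itgB; [apply: itg_sub iw; lra|exact: itg_cst].
rewrite /I /Rintegral fineK; last first.
  exact: (@integrable_fin_num _ _ _ (@lebesgue_measure R)).
apply: eq_integral => s; rewrite inE/= in_itv/= => /andP[s1 s2].
have hs t : c - r < t -> t < c + r -> (w \_ `]0, a[) t = w t.
  by move=> t1 t2; rewrite patchE ifT// inE/= in_itv/=; lra.
by rewrite (hs s)// (hs c)//; lra.
Qed.

Lemma lebesgue_pt_near a w c : 0 < c -> c < a -> itg 0 a w ->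
  lebesgue_pt (w \_ `]0, a[) c -> forall e, 0 < e -> exists2 d, 0 < d &
  forall r, 0 < r -> r < d -> I (c - r) (c + r) (fun s => `|w s - w c|) <= e * r.
Proof.
move=> c0 ca iw lp e e0.
have /fine_cvgP[_ /cvgr0Pnorm_lt h] := lp.
have e2 : 0 < e / 2 by lra.
have {h} := h _ e2; rewrite /at_right/within/= => /nbhs_normP[d /= d0 hd].
exists (Num.min d (Num.min c (a - c))) => [|r r0].
  by rewrite !lt_min d0 c0/=; lra.
rewrite !lt_min => /andP[rd /andP[rc rac]].
have := hd r; rewrite /= sub0r normrN gtr0_norm// => /(_ rd r0).
rewrite davg_I ?(ltW rc) ?(ltW rac)//= ger0_norm; last first.
  by rewrite mulr_ge0 ?invr_ge0//; [lra|apply: I_ge0 => s _; exact: normr_ge0].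
rewrite ltr_pdivrMl; lra.
Qed.

Lemma natV_lt (d : R) : 0 < d -> exists N : nat, forall n, (N <= n)%N ->
  (0 < n)%N /\ n%:R^-1 < d.
Proof.
move=> d0; have [N _ hN] := nbhs_infty_ger (d^-1 + 1).
exists N.+1 => n Nn; have n0 : (0 < n)%N by exact: leq_trans Nn.
split => //; have h : d^-1 + 1 <= n%:R by apply: hN => /=; exact: ltnW.
have n1 : (0 : R) < n%:R by rewrite ltr0n.
rewrite -[d]invrK ltf_pV2 ?posrE ?invr_gt0//; lra.
Qed.

Lemma rhon_meas n c (D : set R) : measurable D -> measurable_fun D (rhon n c).
Proof. by move=> mD; apply: cont_meas => //; apply: smooth_alg_cont; exact: rhon_alg. Qed.

Lemma stepn_meas n c (D : set R) : measurable D -> measurable_fun D (stepn n c).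
Proof. by move=> mD; apply: cont_meas => //; apply: smooth_alg_cont; exact: stepn_alg. Qed.

Lemma itg_bmul x y k w f : measurable_fun `]x, y[ f ->
  (forall s, s \in `]x, y[ -> `|f s| <= k) -> itg x y w ->
  itg x y (fun s => w s * f s).
Proof.
move=> mf hf iw; apply: le_itg (itgZ k (itg_norm iw)).
  by apply: measurable_funM => //; exact: itg_meas iw.
by move=> s /hf h; rewrite normrM mulrC ler_wpM2r.
Qed.

Lemma rhon_bnd n : exists K : R, forall c x, `|rhon n c x| <= K.
Proof.
have [K K0 hK] := @rho_bnd R; exists (n%:R * K) => c x.
by rewrite /rhon normrM ger0_norm// ler_wpM2l.
Qed.

Lemma itg_rhon x y n c w : itg x y w -> itg x y (fun s => w s * rhon n c s).
Proof.
have [K hK] := rhon_bnd n; move=> iw; apply: (@itg_bmul _ _ K) => //.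
by apply: rhon_meas; exact: measurable_itv.
Qed.

Lemma itg_stepn x y n c w : itg x y w -> itg x y (fun s => w s * stepn n c s).
Proof.
move=> iw; apply: (@itg_bmul _ _ 1) => //.
  by apply: stepn_meas; exact: measurable_itv.
by move=> s _; exact: step_bnd.
Qed.

(** The mollifier has mass 1 and is at most [n K] on an interval of length [r = 1/n]. The error is
    therefore at most [n K] times the integral of [|w - w c|] over ]c - r, c + r[, which is o(r) at
    a Lebesgue point. *)
Lemma approx_id a w c : 0 < c -> c < a -> itg 0 a w ->
  lebesgue_pt (w \_ `]0, a[) c -> forall e, 0 < e -> exists N, forall n,
  (N <= n)%N -> `|I 0 a (fun s => w s * rhon n c s) - w c| <= e.
Proof.
move=> c0 ca iw lp e e0; have [K K0 hK] := @rho_bnd R.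
have eK : 0 < e / (K + 1) by rewrite divr_gt0// ltr_wpDl.
have [d d0 hd] := lebesgue_pt_near c0 ca iw lp eK.
have [N hN] : exists N : nat, forall n, (N <= n)%N ->
    (0 < n)%N /\ n%:R^-1 < Num.min d (Num.min c (a - c)).
  by apply: natV_lt; rewrite !lt_min d0 c0/=; lra.
exists N => n /hN[n0]; rewrite !lt_min => /andP[nd /andP[nc nac]].
set r : R := n%:R^-1 in nd nc nac.
have r0 : 0 < r by rewrite invr_gt0 ltr0n.
have nr : n%:R * r = 1 by rewrite divff// pnatr_eq0 -lt0n.
have cr : continuous (rhon n c) by apply: smooth_alg_cont; exact: rhon_alg.
have i1 : I 0 a (rhon n c) = 1.
  rewrite -(FTC2_I _ (is_derive_stepn n c))//; last by lra.
  by rewrite stepn_eq1// ?stepn_eq0 ?subr0//; [exact: ltW|rewrite -/r; lra].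
have ir x y : itg x y (rhon n c).
  by apply: eq_itg (@itg_rhon x y n c _ (itg_cst x y 1)) => s _; rewrite mul1r.
have -> : I 0 a (fun s => w s * rhon n c s) - w c =
    I 0 a (fun s => (w s - w c) * rhon n c s).
  rewrite -{1}[w c]mulr1 -i1 -IZ// -IB//; [|exact: itg_rhon|exact: itgZ].
  by apply: eq_I => s _; ring.
have iwc x y : 0 <= x -> y <= a -> itg x y (fun s => w s - w c).
  by move=> x0 ya; apply: itgB; [exact: itg_sub iw|exact: itg_cst].
have -> : I 0 a (fun s => (w s - w c) * rhon n c s) =
    I c (c + r) (fun s => (w s - w c) * rhon n c s).
  have ii := itg_rhon n c (iwc 0 a (lexx _) (lexx _)).
  have z x y : x <= y -> (forall s, s \in `]x, y[ -> s \notin `]c, c + r[) ->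
      I x y (fun s => (w s - w c) * rhon n c s) = 0.
    by move=> xy h; apply: I_eq0 => s /h h'; rewrite rhon_eq0// mulr0.
  rewrite (@I_split _ 0 c a)//; [|exact: ltW|exact: ltW].
  rewrite (@I_split _ c (c + r) a); [|lra|lra|by apply: itg_sub ii => //; exact: ltW].
  rewrite z ?(ltW c0)//; last first.
    by move=> s; rewrite !in_itv/= => /andP[_ sc]; rewrite negb_and -!leNgt (ltW sc).
  rewrite add0r (z (c + r)) ?addr0//; first lra.
  by move=> s; rewrite !in_itv/= => /andP[sc _]; rewrite negb_and -!leNgt (ltW sc) orbT.
have cc : c <= c + r by lra.
have iwn x y : 0 <= x -> y <= a -> itg x y (fun s => `|w s - w c|).
  by move=> x0 ya; apply: itg_norm; exact: iwc.
apply: le_trans (@le_I_norm _ _ _ _ (fun s => (n%:R * K) * `|w s - w c|) _ _ _) _.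
- by apply: itg_rhon; apply: iwc; lra.
- by apply: itgZ; apply: iwn; lra.
- move=> s _; rewrite normrM mulrC ler_wpM2r// /rhon normrM ger0_norm//.
  by rewrite ler_wpM2l.
rewrite IZ; last by apply: iwn; lra.
have le1 : I c (c + r) (fun s => `|w s - w c|) <=
    I (c - r) (c + r) (fun s => `|w s - w c|).
  by apply: I_sub_le; [lra|lra|lra|apply: iwn; lra|move=> s _; exact: normr_ge0].
have := hd r r0 nd => le2.
apply: (@le_trans _ _ (n%:R * K * (e / (K + 1) * r))).
  by apply: ler_wpM2l; [rewrite mulr_ge0|exact: le_trans le2].
have -> : n%:R * K * (e / (K + 1) * r) = (n%:R * r) * (e * (K / (K + 1))) by ring.
rewrite nr mul1r ler_piMr ?(ltW e0)// ler_pdivrMr; lra.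
Qed.

(** Dominated convergence with majorant [|w|]: the smoothed steps converge pointwise to the
    indicator of [c < s]. *)
Lemma approx_step a w c : 0 < c -> c < a -> itg 0 a w ->
  forall e, 0 < e -> exists N, forall n, (N <= n)%N ->
  `|I 0 a (fun s => w s * stepn n c s) - I c a w| <= e.
Proof.
move=> c0 ca iw e e0.
have iD n : itg 0 a (fun s => w s * stepn n c s) by exact: itg_stepn.
have mlt : measurable_fun `]0, a[ (fun s : R => (c < s)%R%:R : R).
  have -> : (fun s : R => (c < s)%R%:R : R) = (fun s => \1_(`]c, +oo[%classic : set R) s).
    by apply/funext => s; rewrite indicE; congr (_%:R); congr nat_of_bool;
       apply/idP/idP; rewrite inE/= in_itv/= andbT.
  by apply: measurable_indic; exact: measurable_itv.
have dc := @dominated_convergence _ _ R (@lebesgue_measure R) `]0, a[%classic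
  (measurable_itv _) (fun n s => (w s * stepn n c s)%:E)
  (fun s => (w s * (c < s)%R%:R)%:E) (fun s => `|w s|%:E).
have [|||||_ _] := dc.
  - by move=> n; apply/measurable_EFinP; exact: itg_meas (iD n).
  - by apply/measurable_EFinP; apply: measurable_funM => //; exact: itg_meas iw.
  - apply: aeW => s _; apply: cvg_near_cst.
    have [sc|cs] := leP s c.
      by near=> n; rewrite stepn_eq0.
    have sc0 : 0 < s - c by lra.
    have [N hN] := natV_lt sc0.
    exists N => // n /= /hN[n0 hn].
    by rewrite stepn_eq1//; lra.
  - exact: itg_norm iw.
  - apply: aeW => s n _; rewrite lee_fin normrM ler_piMr//; exact: step_bnd.
rewrite (_ : (\int[lebesgue_measure]_(x in `]0%R, a[) ((w x * (c < x)%R%:R)%:E))%E = (I c a w)%:E); last first.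
  have im : itg 0 a (fun s => w s * (c < s)%R%:R).
    by apply: (@itg_bmul _ _ 1) => // s _; case: (c < s); rewrite ?normr1 ?normr0.
  transitivity ((I 0 a (fun s => w s * (c < s)%R%:R))%:E).
    rewrite /I /Rintegral fineK//.
    exact: (@integrable_fin_num _ _ _ (@lebesgue_measure R)).
  congr (_%:E); rewrite (@I_split _ 0 c a)//; [|exact: ltW|exact: ltW].
  transitivity (0 + I c a w); last by rewrite add0r.
  congr (_ + _).
    by apply: I_eq0 => s; rewrite in_itv/= => /andP[_ sc]; rewrite ltNge (ltW sc) mulr0.
  by apply: eq_I => s; rewrite in_itv/= => /andP[-> _]; rewrite mulr1.
move=> /fine_cvgP[_] /cvgrPdist_le /(_ _ e0)[N _ hN].
exists N => n Nn; rewrite distrC; exact: hN.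
Unshelve. all: by end_near. Qed.

Lemma lebesgue_pt_ae a w : itg 0 a w ->
  {ae @leb R, forall s, lebesgue_pt (w \_ `]0, a[) s}.
Proof.
move=> iw; apply: lebesgue_differentiation; exact: integrable_locally.
Qed.

Lemma test_rhon a c : 0 < c -> c < a -> exists N, forall n, (N <= n)%N ->
  test_function a (rhon n c).
Proof.
move=> c0 ca; have h : 0 < (a - c) / 2 by lra.
have [N hN] := natV_lt h; exists N => n /hN[n0 hn].
apply: (@test_function_alg _ _ c (c + n%:R^-1)) => //; [exact: rhon_alg|lra|].
move=> x; rewrite in_itv/= => hx; apply: rhon_eq0 => //; rewrite in_itv/=.
by apply: contra hx => /andP[/ltW -> /ltW ->].
Qed.

Lemma test_stepn a c d : 0 < c -> c <= d -> d < a -> exists N, forall n,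
  (N <= n)%N -> test_function a (fun x => stepn n c x - stepn n d x).
Proof.
move=> c0 cd da; have h : 0 < (a - d) / 2 by lra.
have [N hN] := natV_lt h; exists N => n /hN[n0 hn].
apply: (@test_function_alg _ _ c (d + n%:R^-1)) => //; [|lra|].
  apply: Sm_add; first exact: stepn_alg.
  rewrite (_ : (fun x => - _) = (fun x => (-1) * stepn n d x)); last first.
    by apply/funext => x; rewrite mulN1r.
  by apply: Sm_mul; [exact: Sm_cst|exact: stepn_alg].
move=> x; rewrite in_itv/= negb_and -!ltNge => /orP[xc|xd].
  by rewrite !stepn_eq0 ?subr0//; lra.
have n1 : (0 : R) < n%:R^-1 by rewrite invr_gt0 ltr0n.
by rewrite !stepn_eq1 ?subrr//; lra.
Qed.

Lemma le_all_eps (A B : R) : (forall e, 0 < e -> `|A - B| <= e) -> A = B.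
Proof.
move=> h; apply/eqP; rewrite -subr_eq0 -normr_le0.
by apply/ler_addgt0Pl => e e0; rewrite addr0; exact: h.
Qed.

(** Test with mollifiers at a common Lebesgue point of [u] and [v]; almost every point is one. *)
Lemma test_fun_uniq a u v : itg 0 a u -> itg 0 a v ->
  (forall phi, test_function a phi ->
     I 0 a (fun x => u x * phi x) = I 0 a (fun x => v x * phi x)) ->
  aeq 0 a u v.
Proof.
move=> iu iv h.
apply: ae_leb_imp2 (lebesgue_pt_ae iu) (lebesgue_pt_ae iv).
move=> c lu lv; rewrite in_itv/= => /andP[c0 ca].
apply: le_all_eps => e e0; have e2 : 0 < e / 2 by lra.
have [N1 h1] := approx_id c0 ca iu lu e2.
have [N2 h2] := approx_id c0 ca iv lv e2.
have [N3 h3] := test_rhon c0 ca.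
pose n := maxn N1 (maxn N2 N3).
have /ler_normlP[a1 a2] := h1 n (leq_maxl _ _).
have /ler_normlP[b1 b2] : `|I 0 a (fun s : R => v s * rhon n c s) - v c| <= e / 2.
  by apply: h2; rewrite /n maxnCA leq_maxl.
have := h _ (h3 n _); rewrite /n maxnA leq_maxr => /(_ isT); rewrite -maxnA -/n => E.
by apply/ler_normlP; split; lra.
Qed.

(** The difference of the smoothed steps at [c] and [d] approximates the indicator of [c, d] and has
    derivative [rhon n c - rhon n d]. Testing with it yields $u(d) - u(c) = \int_c^d v$ at Lebesgue
    points; one fixed [c] then determines the constant. *)
Lemma weak_der1_repr a u v : 0 < a -> itg 0 a u -> itg 0 a v ->
  (forall phi, test_function a phi ->
     I 0 a (fun x => u x * derive1 phi x) = - I 0 a (fun x => v x * phi x)) ->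
  exists k, aeq 0 a u (fun x => k + I 0 x v).
Proof.
move=> a0 iu iv h.
have key c d : 0 < c -> c <= d -> d < a -> lebesgue_pt (u \_ `]0, a[) c ->
    lebesgue_pt (u \_ `]0, a[) d -> u d - u c = I c d v.
  move=> c0 cd da lc ld; apply: le_all_eps => e e0; have e4 : 0 < e / 4 by lra.
  have ca : c < a by lra. have d0 : 0 < d by lra.
  have [N1 h1] := approx_id c0 ca iu lc e4.
  have [N2 h2] := approx_id d0 da iu ld e4.
  have [N3 h3] := approx_step c0 ca iv e4.
  have [N4 h4] := approx_step d0 da iv e4.
  have [N5 h5] := test_stepn c0 cd da.
  pose n := (N1 + N2 + N3 + N4 + N5)%N.
  have /ler_normlP[a1 a2] : `|I 0 a (fun s => u s * rhon n c s) - u c| <= e / 4.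
    by apply: h1; rewrite /n -!addnA leq_addr.
  have /ler_normlP[b1 b2] : `|I 0 a (fun s => u s * rhon n d s) - u d| <= e / 4.
    by apply: h2; rewrite /n -!addnA addnCA leq_addr.
  have /ler_normlP[c1 c2] : `|I 0 a (fun s => v s * stepn n c s) - I c a v| <= e / 4.
    by apply: h3; rewrite /n addnAC -addnA addnAC leq_addl.
  have /ler_normlP[d1 d2] : `|I 0 a (fun s => v s * stepn n d s) - I d a v| <= e / 4.
    by apply: h4; rewrite /n addnAC leq_addl.
  have := h _ (h5 n _); rewrite /n leq_addl => /(_ isT); rewrite -/n.
  have -> : derive1 (fun x => stepn n c x - stepn n d x) = (fun x => rhon n c x - rhon n d x).
    apply: derive1_is_derive => x.
    by apply: is_deriveB; exact: is_derive_stepn.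
  have -> : I 0 a (fun x => u x * (rhon n c x - rhon n d x)) =
      I 0 a (fun s => u s * rhon n c s) - I 0 a (fun s => u s * rhon n d s).
    rewrite -IB; [|exact: itg_rhon..].
    by apply: eq_I => s _; ring.
  have -> : I 0 a (fun x => v x * (stepn n c x - stepn n d x)) =
      I 0 a (fun s => v s * stepn n c s) - I 0 a (fun s => v s * stepn n d s).
    rewrite -IB; [|exact: itg_stepn..].
    by apply: eq_I => s _; ring.
  have := @I_split _ c d a v cd (ltW da) (itg_sub (ltW c0) (lexx _) iv).
  move=> E1 E2; apply/ler_normlP; move: a1 a2 b1 b2 c1 c2 d1 d2 E1 E2 {h h1 h2 h3 h4 h5}.
  generalize (I 0 a (fun s => u s * rhon n c s)) (I 0 a (fun s => u s * rhon n d s))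
    (I 0 a (fun s => v s * stepn n c s)) (I 0 a (fun s => v s * stepn n d s))
    (I c a v) (I d a v) (I c d v) (u c) (u d); clear -e0 => *.
  split; lra.
have [c] := ae_ex a0 (lebesgue_pt_ae iu).
rewrite in_itv/= => /andP[c0 ca] lc.
exists (u c - I 0 c v); apply: ae_leb_imp (lebesgue_pt_ae iu) => d ld.
rewrite in_itv/= => /andP[d0 da].
have [cd|/ltW dc] := leP c d.
  have := key _ _ c0 cd da lc ld.
  have := @I_split _ 0 c d v (ltW c0) cd (itg_sub (lexx _) (ltW da) iv).
  by lra.
have := key _ _ d0 dc ca ld lc.
have := @I_split _ 0 d c v (ltW d0) dc (itg_sub (lexx _) (ltW ca) iv).
by lra.
Qed.

End LebesguePoints.

(** * Absolutely continuous functions with square integrable derivative *)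

Section AbsolutelyContinuous.
Context {R : realType}.
Implicit Types (x y z a c d k e r M : R) (u v w f g p q U V : R -> R).

(** Membership in $H^1(0,a)$, expressed for the continuous representative: the identity holds at
    every point of [0, a], endpoints included, while [v] matters only up to null sets. *)
Definition abs_cont a u v : Prop := L2 0 a v /\
  forall x y, 0 <= x -> x <= y -> y <= a -> u y - u x = I x y v.

Lemma AC_L2 a u v : abs_cont a u v -> L2 0 a v. Proof. by case. Qed.

Lemma AC_hold a u v x y : abs_cont a u v -> 0 <= x -> x <= y -> y <= a ->
  `|u y - u x| <= Num.sqrt (y - x) * nrm 0 a v.
Proof.
move=> [l2 h] x0 xy ya; rewrite h//; apply: le_trans (I_le_nrm xy _) _.
  exact: L2_sub l2.
by rewrite ler_wpM2l ?sqrtr_ge0//; apply: nrm_sub.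
Qed.

(** Retraction of the line onto [0, a]: composing with it turns a function that is continuous on
    [0, a] into one continuous everywhere, to which measurability of continuous functions
    applies. *)
Definition clamp a x : R := Num.max 0 (Num.min a x).

Lemma clamp_in a x : 0 <= a -> 0 <= clamp a x <= a.
Proof. by move=> a0; rewrite /clamp le_max lexx/= ge_max a0 ge_min lexx. Qed.

Lemma clamp_id a x : 0 <= x -> x <= a -> clamp a x = x.
Proof. by move=> x0 xa; rewrite /clamp min_r// max_r. Qed.

Lemma clamp_lip a x y : x <= y -> clamp a x <= clamp a y /\ clamp a y - clamp a x <= y - x.
Proof.
move=> xy; rewrite /clamp; case: (leP a x) => ?; case: (leP a y) => ?;
case: (leP 0 a) => ?; case: (leP 0 x) => ?; case: (leP 0 y) => ?; split; lra.
Qed.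

Lemma AC_clamp_cont a u v : 0 <= a -> abs_cont a u v -> continuous (fun x => u (clamp a x)).
Proof.
move=> a0 h x; apply/cvgrPdist_le => e e0.
set K := nrm 0 a v; have K0 : 0 <= K by exact: nrm_ge0.
have key y z : y <= z -> z - y <= (e / (K + 1)) ^+ 2 ->
    `|u (clamp a z) - u (clamp a y)| <= e.
  move=> yz zy; have [c1 c2] := clamp_lip a yz.
  have /andP[c3 _] := @clamp_in a y a0; have /andP[_ c4] := @clamp_in a z a0.
  apply: le_trans (AC_hold h c3 c1 c4) _; rewrite -/K.
  have le1 : Num.sqrt (clamp a z - clamp a y) <= e / (K + 1).
    rewrite -(ger0_norm (_ : 0 <= e / (K+1))); last by rewrite divr_ge0 ?(ltW e0)//; lra.
    by rewrite -sqrtr_sqr ler_sqrt ?sqr_ge0//; lra.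
  apply: (@le_trans _ _ (e / (K + 1) * K)); first by rewrite ler_wpM2r.
  by rewrite mulrAC ler_pdivrMr; nra.
have d0 : 0 < (e / (K + 1)) ^+ 2 by rewrite exprn_gt0// divr_gt0//; lra.
near=> y; have [xy|/ltW yx] := leP x y.
  rewrite distrC; apply: key => //; near: y; apply/nbhs_normP.
  by exists ((e / (K + 1)) ^+ 2) => //= y /= /ltW /ler_normlP[]; lra.
apply: key => //; near: y; apply/nbhs_normP.
by exists ((e / (K + 1)) ^+ 2) => //= y /= /ltW /ler_normlP[]; lra.
Unshelve. all: by end_near. Qed.

Lemma AC_cont a u v : 0 <= a -> abs_cont a u v -> {within `[0, a], continuous u}.
Proof.
move=> a0 h; have := AC_clamp_cont a0 h => /continuous_subspaceT cc.
apply: (@subspace_eq_continuous R `[0, a]%classic R (fun x => u (clamp a x)) u _ (cc _)) => x.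
by rewrite inE/= in_itv/= => /andP[x0 xa]; rewrite /= clamp_id.
Qed.

Lemma AC_meas a u v x y : abs_cont a u v -> 0 <= x -> y <= a -> measurable_fun `]x, y[ u.
Proof.
move=> h x0 ya; have [xy|yx] := ltP x y; last first.
  by rewrite set_itv_ge ?bnd_simp -?leNgt//; exact: measurable_fun_set0.
have a0 : 0 <= a by lra.
apply: (@eq_measurable_fun _ _ _ _ _ (fun x => u (clamp a x))).
  by move=> s; rewrite inE/= in_itv/= => /andP[s1 s2]; rewrite /= clamp_id//; lra.
by apply: cont_meas; [exact: measurable_itv|exact: AC_clamp_cont h].
Qed.

Lemma AC_bnd a u v : abs_cont a u v -> exists2 K : R, 0 <= K &
  forall x, 0 <= x -> x <= a -> `|u x| <= K.
Proof.
move=> h; exists (`|u 0| + Num.sqrt a * nrm 0 a v) => [|x x0 xa].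
  by rewrite addr_ge0// mulr_ge0 ?nrm_ge0// sqrtr_ge0.
have := AC_hold h (lexx 0) x0 xa; rewrite subr0 => h1.
have h2 : Num.sqrt x * nrm 0 a v <= Num.sqrt a * nrm 0 a v.
  by rewrite ler_wpM2r ?nrm_ge0// ler_sqrt//; lra.
have := ler_normD (u x - u 0) (u 0); rewrite subrK => h3; lra.
Qed.

Lemma AC_L2f a u v : abs_cont a u v -> L2 0 a u.
Proof.
move=> h; have [K K0 hK] := AC_bnd h.
apply: (@L2_bdd _ _ _ K); first exact: AC_meas h _ _.
by move=> s; rewrite in_itv/= => /andP[/ltW s0 /ltW sa]; exact: hK.
Qed.

(* Bisecting [x, y] n times divides the error by 2 ^ (n / 2). *)
Lemma AC_crit a w V U M : L2 0 a V -> itg 0 a U -> 0 <= M ->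
  (forall s, s \in `]0, a[ -> 0 <= U s) ->
  (forall x y, 0 <= x -> x <= y -> y <= a ->
    `|w y - w x - I x y V| <= M * Num.sqrt (y - x) * I x y U) -> abs_cont a w V.
Proof.
move=> lV iU M0 U0 h; split => //.
pose q : R := Num.sqrt (1 / 2).
have q0 : 0 <= q by exact: sqrtr_ge0.
have q1 : q < 1 by rewrite -[ltRHS]sqrtr1 ltr_sqrt; lra.
have key n x y : 0 <= x -> x <= y -> y <= a ->
    `|w y - w x - I x y V| <= M * q ^+ n * Num.sqrt (y - x) * I x y U.
  elim: n x y => [|n IH] x y x0 xy ya; first by rewrite expr0 mulr1; exact: h.
  pose m := (x + y) / 2.
  have xm : x <= m by rewrite /m; lra.
  have my : m <= y by rewrite /m; lra.
  have h1 := IH x m x0 xm (le_trans my ya).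
  have h2 := IH m y (le_trans x0 xm) my ya.
  have iV : itg x y V by apply: itg_sub (L2_itg lV).
  have iU' : itg x y U by apply: itg_sub iU.
  have e1 : w y - w x - I x y V = (w m - w x - I x m V) + (w y - w m - I m y V).
    by rewrite (I_split xm my iV); ring.
  rewrite e1 (I_split xm my iU').
  apply: le_trans (ler_normD _ _) _.
  have s1 : Num.sqrt (m - x) = q * Num.sqrt (y - x).
    by rewrite -sqrtrM; [congr Num.sqrt; rewrite /m; lra|lra].
  have s2 : Num.sqrt (y - m) = q * Num.sqrt (y - x).
    by rewrite -sqrtrM; [congr Num.sqrt; rewrite /m; lra|lra].
  rewrite s1 in h1; rewrite s2 in h2; rewrite exprS.
  move: h1 h2; generalize (I x m U) (I m y U) => A B.
  by move=> h1 h2; apply: le_trans (lerD h1 h2) _; apply: eq_ler; ring.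
move=> x y x0 xy ya; apply: le_all_eps => e e0.
pose K := M * Num.sqrt (y - x) * I x y U.
have K0 : 0 <= K.
  rewrite !mulr_ge0 ?sqrtr_ge0//; apply: I_ge0 => s sxy; apply: U0.
  exact: mem_oo_sub sxy.
have eK : 0 < e / (K + 1) by rewrite divr_gt0//; lra.
have : q ^+ n @[n --> \oo] --> (0 : R) by apply: cvg_expr; rewrite ger0_norm.
move=> /cvgr0Pnorm_le/(_ _ eK)[n _ /(_ n (leqnn n))] /=.
rewrite ger0_norm ?exprn_ge0// => hn.
apply: le_trans (key n x y x0 xy ya) _.
rewrite (_ : M * q ^+ n * _ * _ = q ^+ n * K); last by rewrite /K; ring.
apply: (@le_trans _ _ (e / (K + 1) * K)); first by rewrite ler_wpM2r.
by rewrite mulrAC ler_pdivrMr; nra.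
Qed.

Lemma AC_cst a c : abs_cont a (fun=> c) (fun=> 0).
Proof.
split; first exact: L2_cst.
by move=> x y x0 xy ya; rewrite I_cst// mul0r subrr.
Qed.

Lemma ACD a u1 v1 u2 v2 : abs_cont a u1 v1 -> abs_cont a u2 v2 ->
  abs_cont a (fun x => u1 x + u2 x) (fun x => v1 x + v2 x).
Proof.
move=> [l1 h1] [l2 h2]; split; first exact: L2D.
move=> x y x0 xy ya; rewrite ID; [|exact: itg_sub (L2_itg l1)|exact: itg_sub (L2_itg l2)].
by rewrite -h1// -h2//; ring.
Qed.

Lemma ACZ a k u v : abs_cont a u v -> abs_cont a (fun x => k * u x) (fun x => k * v x).
Proof.
move=> [l1 h1]; split; first exact: L2Z.
move=> x y x0 xy ya; rewrite IZ; last exact: itg_sub (L2_itg l1).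
by rewrite -h1//; ring.
Qed.

Lemma ACN a u v : abs_cont a u v -> abs_cont a (fun x => - u x) (fun x => - v x).
Proof.
move=> [l1 h1]; split; first exact: L2N.
move=> x y x0 xy ya; rewrite IN; last exact: itg_sub (L2_itg l1).
by rewrite -h1//; ring.
Qed.

Lemma ACB a u1 v1 u2 v2 : abs_cont a u1 v1 -> abs_cont a u2 v2 ->
  abs_cont a (fun x => u1 x - u2 x) (fun x => v1 x - v2 x).
Proof. by move=> h1 /ACN; exact: ACD. Qed.

Lemma AC_sum {J : Type} (r : seq J) (F G : J -> R -> R) a :
  (forall j, abs_cont a (F j) (G j)) ->
  abs_cont a (fun s => \sum_(j <- r) F j s) (fun s => \sum_(j <- r) G j s).
Proof.
move=> h; elim: r => [|j r IH].
  have -> : (fun s => \sum_(j <- [::]) F j s) = fun=> 0 by apply/funext => s; rewrite big_nil.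
  have -> : (fun s => \sum_(j <- [::]) G j s) = fun=> 0 by apply/funext => s; rewrite big_nil.
  exact: AC_cst.
have -> : (fun s => \sum_(j <- j :: r) F j s) = fun s => F j s + \sum_(j <- r) F j s.
  by apply/funext => s; rewrite big_cons.
have -> : (fun s => \sum_(j <- j :: r) G j s) = fun s => G j s + \sum_(j <- r) G j s.
  by apply/funext => s; rewrite big_cons.
exact: ACD.
Qed.

Lemma AC_bmul a u v w : abs_cont a u v -> L2 0 a w -> L2 0 a (fun x => u x * w x).
Proof.
move=> h lw; have [K K0 hK] := AC_bnd h.
apply: (@L2_bmul _ _ _ K) => //; first exact: AC_meas h _ _.
by move=> s; rewrite in_itv/= => /andP[/ltW s0 /ltW sa]; exact: hK.
Qed.

Lemma L2_norm_itg a v : L2 0 a v -> itg 0 a (fun s => `|v s|).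
Proof. by move=> h; apply: itg_norm; exact: L2_itg. Qed.

Lemma AC_hold_in a u v x y s t : abs_cont a u v -> 0 <= x -> y <= a ->
  x <= s -> s <= y -> x <= t -> t <= y ->
  `|u s - u t| <= Num.sqrt (y - x) * nrm 0 a v.
Proof.
move=> h x0 ya xs sy xt ty.
have key s' t' : x <= s' -> s' <= t' -> t' <= y ->
    `|u t' - u s'| <= Num.sqrt (y - x) * nrm 0 a v.
  move=> xs' st' ty'; apply: le_trans (@AC_hold _ _ _ s' t' h _ st' _) _; [lra|lra|].
  by rewrite ler_wpM2r ?nrm_ge0// ler_sqrt; lra.
by have [st|/ltW ts] := leP s t; [rewrite distrC|]; apply: key.
Qed.

(** The defect of the product rule on [x, y] is the integral of $(u_2(y)-u_2(s))v_1(s) +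
    (u_1(x)-u_1(s))v_2(s)$. The square-root modulus of continuity bounds it as [AC_crit] demands,
    without a double integral. *)
Lemma ACM a u1 v1 u2 v2 : abs_cont a u1 v1 -> abs_cont a u2 v2 ->
  abs_cont a (fun x => u1 x * u2 x) (fun x => v1 x * u2 x + u1 x * v2 x).
Proof.
move=> h1 h2; have [l1 e1] := h1; have [l2 e2] := h2.
have l12 : L2 0 a (fun x => u1 x * v2 x) by apply: AC_bmul h1 _.
have l21 : L2 0 a (fun x => v1 x * u2 x).
  by apply: eq_L2 (AC_bmul h2 l1) => s _; rewrite mulrC.
have lV := L2D l21 l12.
have n1 := L2_norm_itg l1; have n2 := L2_norm_itg l2.
apply: (@AC_crit _ _ _ (fun s => `|v1 s| + `|v2 s|) (nrm 0 a v1 + nrm 0 a v2)) => //.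
- exact: itgD.
- by rewrite addr_ge0 ?nrm_ge0.
move=> x y x0 xy ya.
have S f : itg 0 a f -> itg x y f by exact: itg_sub.
have i1 := S _ (L2_itg l1); have i2 := S _ (L2_itg l2).
have i12 := S _ (L2_itg l12); have i21 := S _ (L2_itg l21).
set D := Num.sqrt (y - x); set N1 := nrm 0 a v1; set N2 := nrm 0 a v2.
have -> : u1 y * u2 y - u1 x * u2 x - I x y (fun s => v1 s * u2 s + u1 s * v2 s)
    = I x y (fun s => (u2 y * v1 s - v1 s * u2 s) + (u1 x * v2 s - u1 s * v2 s)).
  rewrite !ID//; try (by apply: itgB => //; exact: itgZ);
    try (exact: itgZ); try (exact: itgN).
  by rewrite !IN// !IZ// -e1// -e2//; ring.
apply: le_trans (@le_I_norm _ _ _ _ (fun s => ((N1 + N2) * D) * (`|v1 s| + `|v2 s|)) _ _ _) _.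
- by apply: itgD; apply: itgB => //; exact: itgZ.
- by apply: itgZ; apply: itgD; exact: S.
- move=> s; rewrite in_itv/= => /andP[/ltW xs /ltW sy].
  have -> : u2 y * v1 s - v1 s * u2 s = (u2 y - u2 s) * v1 s by ring.
  have -> : u1 x * v2 s - u1 s * v2 s = (u1 x - u1 s) * v2 s by ring.
  apply: le_trans (ler_normD _ _) _; rewrite !normrM.
  have b1 : `|u2 y - u2 s| <= D * N2 by apply: AC_hold_in h2 _ _ _ _ _ _.
  have b2 : `|u1 x - u1 s| <= D * N1 by apply: AC_hold_in h1 _ _ _ _ _ _.
  have D0 : 0 <= D by exact: sqrtr_ge0.
  have N10 : 0 <= N1 by exact: nrm_ge0.
  have N20 : 0 <= N2 by exact: nrm_ge0.
  have c1 := ler_wpM2r (normr_ge0 (v1 s)) b1.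
  have c2 := ler_wpM2r (normr_ge0 (v2 s)) b2.
  apply: le_trans (lerD c1 c2) _.
  have d1 : 0 <= D * N1 * `|v1 s| by rewrite !mulr_ge0.
  have d2 : 0 <= D * N2 * `|v2 s| by rewrite !mulr_ge0.
  rewrite (_ : (N1 + N2) * D * (`|v1 s| + `|v2 s|) =
    D * N2 * `|v1 s| + D * N1 * `|v2 s| + (D * N1 * `|v1 s| + D * N2 * `|v2 s|)); last by ring.
  by rewrite lerDl addr_ge0.
by rewrite IZ//; apply: S; exact: itgD.
Qed.

Lemma meas_inv_AC a u v x y : abs_cont a u v -> (forall x, 0 <= x -> x <= a -> 1 <= u x) ->
  0 <= x -> y <= a -> measurable_fun `]x, y[ (fun s => (u s)^-1).
Proof.
move=> h u1 x0 ya; have [xy|yx] := ltP x y; last first.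
  by rewrite set_itv_ge ?bnd_simp -?leNgt//; exact: measurable_fun_set0.
have a0 : 0 <= a by lra.
apply: (@eq_measurable_fun _ _ _ _ _ (fun x => (u (clamp a x))^-1)).
  by move=> s; rewrite inE/= in_itv/= => /andP[s1 s2]; rewrite /= clamp_id//; lra.
apply: cont_meas; first exact: measurable_itv.
move=> s; apply: cvgV; last exact: (@AC_clamp_cont _ _ _ a0 h s).
have /andP[c0 ca] := @clamp_in a s a0.
by rewrite gt_eqF//; have := u1 _ c0 ca; lra.
Qed.

Lemma inv_ge1 (c : R) : 1 <= c -> 0 < c^-1 <= 1.
Proof. by move=> c1; have c0 := lt_le_trans ltr01 c1; rewrite invr_gt0 c0 invf_le1. Qed.

(** As for products, [AC_crit] is applied to an explicit defect, the integral of $v(s)\,(u(s)^{-2} -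
    u(x)^{-1}u(y)^{-1})$. It is small because [u] varies little over [x, y] and its inverse is at
    most 1. *)
Lemma ACV a u v : abs_cont a u v -> (forall x, 0 <= x -> x <= a -> 1 <= u x) ->
  abs_cont a (fun x => (u x)^-1) (fun x => - (v x * ((u x)^-1 * (u x)^-1))).
Proof.
move=> h u1; have [l1 e1] := h.
have inv1 x : 0 <= x -> x <= a -> 0 < (u x)^-1 <= 1.
  by move=> x0 xa; apply: inv_ge1; exact: u1.
have p3 (p1 p2 p3 z c : R) : 0 < p1 <= 1 -> 0 < p2 <= 1 -> 0 < p3 <= 1 ->
    `|z| <= c -> `|p1 * p2 * p3 * z| <= c.
  move=> /andP[a1 b1] /andP[a2 b2] /andP[a3 b3]; apply: le_trans; rewrite normrM.
  by rewrite (gtr0_norm (mulr_gt0 (mulr_gt0 a1 a2) a3)) ler_piMl// !mulr_ile1 ?mulr_ge0//; exact: ltW.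
have m1 x y : 0 <= x -> y <= a -> measurable_fun `]x, y[ (fun x => (u x)^-1).
  exact: meas_inv_AC h u1.
have lW : L2 0 a (fun x => v x * ((u x)^-1 * (u x)^-1)).
  apply: eq_L2 (_ : L2 0 a (fun x => ((u x)^-1 * (u x)^-1) * v x)) => [s _|].
    by rewrite mulrC.
  apply: (@L2_bmul _ _ _ 1) => //; first by apply: measurable_funM; exact: m1.
  move=> s; rewrite in_itv/= => /andP[/ltW s0 /ltW sa].
  by have /andP[? ?] := inv1 _ s0 sa; rewrite ger0_norm; nra.
have n1 := L2_norm_itg l1.
apply: (@AC_crit _ _ _ (fun s => `|v s|) (2 * nrm 0 a v)) => //.
- exact: L2N.
- by rewrite mulr_ge0 ?nrm_ge0.
move=> x y x0 xy ya.
have S f : itg 0 a f -> itg x y f by exact: itg_sub.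
have i1 := S _ (L2_itg l1); have iW := S _ (L2_itg lW).
set D := Num.sqrt (y - x); set N1 := nrm 0 a v.
have D0 : 0 <= D by exact: sqrtr_ge0.
have N10 : 0 <= N1 by exact: nrm_ge0.
have xa : x <= a by lra. have y0 : 0 <= y by lra.
have ux := u1 _ x0 xa; have uy := u1 _ y0 ya.
rewrite IN//.
have -> : (u y)^-1 - (u x)^-1 - - I x y (fun s => v s * ((u s)^-1 * (u s)^-1))
    = I x y (fun s => v s * ((u s)^-1 * (u s)^-1) - ((u x)^-1 * (u y)^-1) * v s).
  rewrite IB//; last exact: itgZ.
  rewrite IZ// -e1// opprK.
  have : (u x)^-1 * (u y)^-1 * (u y - u x) = (u x)^-1 - (u y)^-1.
    by field; rewrite !gt_eqF//; lra.
  by move=> ->; ring.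
apply: le_trans (@le_I_norm _ _ _ _ (fun s => ((2 * N1) * D) * `|v s|) _ _ _) _.
- by apply: itgB => //; exact: itgZ.
- by apply: itgZ; exact: S.
- move=> s; rewrite in_itv/= => /andP[/ltW xs /ltW sy].
  have s0 : 0 <= s by lra. have sa : s <= a by lra.
  have us := u1 _ s0 sa.
  have b1 : `|u y - u s| <= D * N1 by apply: AC_hold_in h _ _ _ _ _ _.
  have b2 : `|u x - u s| <= D * N1 by apply: AC_hold_in h _ _ _ _ _ _.
  (* The difference is split at the intermediate product $u(s)^{-1}u(y)^{-1}$, so that each part
     contains one increment of [u]. *)
  have -> : v s * ((u s)^-1 * (u s)^-1) - (u x)^-1 * (u y)^-1 * v s =
     ((u s)^-1 * (u s)^-1 * (u y)^-1 * (u y - u s) + (u x)^-1 * (u y)^-1 * (u s)^-1 * (u x - u s)) * v s.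
    by field; rewrite !gt_eqF//; lra.
  rewrite normrM; apply: ler_wpM2r => //.
  apply: le_trans (ler_normD _ _) _.
  have is_ := inv1 _ s0 sa; have ix := inv1 _ x0 xa; have iy := inv1 _ y0 ya.
  by have := p3 _ _ _ _ _ is_ is_ iy b1; have := p3 _ _ _ _ _ ix iy is_ b2; lra.
by rewrite IZ//; exact: S.
Qed.

(** One constant bounds both the sup norm and the $L^2$ norm of the derivative. The class is stable
    under sums, products and inverses with explicit constants, which is how bounds independent of
    [N] are propagated. *)
Definition bdAC a k u : Prop := exists v,
  [/\ abs_cont a u v, forall x, 0 <= x -> x <= a -> `|u x| <= k & nrm 0 a v <= k].

Lemma bdAC_ge0 a k u : bdAC a k u -> 0 <= k.
Proof. by move=> [v [_ _]]; apply: le_trans; exact: nrm_ge0. Qed.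

Lemma bdAC_le a k d u : k <= d -> bdAC a k u -> bdAC a d u.
Proof.
move=> kd [v [h1 h2 h3]]; exists v; split=> // [x x0 xa|]; apply: le_trans kd => //.
exact: h2.
Qed.

Lemma nrm_AC_mul a u v w k : abs_cont a u v -> L2 0 a w ->
  (forall x, 0 <= x -> x <= a -> `|u x| <= k) -> 0 <= k ->
  nrm 0 a (fun x => u x * w x) <= k * nrm 0 a w.
Proof.
move=> h lw hk k0; apply: nrm_bmul => //; first exact: AC_meas h _ _.
by move=> s; rewrite in_itv/= => /andP[/ltW s0 /ltW sa]; exact: hk.
Qed.

Lemma bdACM a k1 k2 u1 u2 : bdAC a k1 u1 -> bdAC a k2 u2 ->
  bdAC a (2 * k1 * k2) (fun x => u1 x * u2 x).
Proof.
move=> b1 b2; have k10 := bdAC_ge0 b1; have k20 := bdAC_ge0 b2.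
case: b1 => v1 [h1 c1 d1]; case: b2 => v2 [h2 c2 d2].
have l1 := AC_L2 h1; have l2 := AC_L2 h2.
exists (fun x => v1 x * u2 x + u1 x * v2 x); split.
- exact: ACM.
- move=> x x0 xa; rewrite normrM; have := c1 x x0 xa; have := c2 x x0 xa.
  by have := normr_ge0 (u1 x); have := normr_ge0 (u2 x); nra.
have e : forall s, s \in `]0, a[ -> v1 s * u2 s = u2 s * v1 s by move=> s _; rewrite mulrC.
have l21 := AC_bmul h2 l1; have l12 := AC_bmul h1 l2.
have l21' : L2 0 a (fun x => v1 x * u2 x) by apply: eq_L2 l21 => s /e.
apply: le_trans (nrmD l21' l12) _; rewrite (eq_nrm e).
have := nrm_AC_mul h2 l1 c2 k20.
have := nrm_AC_mul h1 l2 c1 k10.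
have := nrm_ge0 0 a v1; have := nrm_ge0 0 a v2; nra.
Qed.

Lemma bdACD a k1 k2 u1 u2 : bdAC a k1 u1 -> bdAC a k2 u2 ->
  bdAC a (k1 + k2) (fun x => u1 x + u2 x).
Proof.
case=> v1 [h1 c1 d1] [v2 [h2 c2 d2]].
exists (fun x => v1 x + v2 x); split; first exact: ACD.
  by move=> x x0 xa; apply: le_trans (ler_normD _ _) _; apply: lerD; [exact: c1|exact: c2].
by apply: le_trans (nrmD (AC_L2 h1) (AC_L2 h2)) _; exact: lerD.
Qed.

Lemma bdACZ a c k u : bdAC a k u -> bdAC a (`|c| * k) (fun x => c * u x).
Proof.
case=> v1 [h1 c1 d1]; exists (fun x => c * v1 x); split; first exact: ACZ.
  by move=> x x0 xa; rewrite normrM ler_wpM2l// c1.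
by rewrite nrmZ ?ler_wpM2l//; exact: AC_L2 h1.
Qed.

Lemma bdAC_sum {J : Type} (r : seq J) (F : J -> R -> R) (k : J -> R) a :
  (forall j, bdAC a (k j) (F j)) ->
  bdAC a (\sum_(j <- r) k j) (fun s => \sum_(j <- r) F j s).
Proof.
move=> h; elim: r => [|j r IH].
  have -> : (fun s => \sum_(j <- [::]) F j s) = fun=> 0 by apply/funext => s; rewrite big_nil.
  rewrite big_nil; exists (fun=> 0); split=> [|x _ _|]; first exact: AC_cst.
    by rewrite normr0.
  have [a0|a0] := leP 0 a; first by rewrite nrm_cst// normr0 mul0r.
  by rewrite /nrm I_empty ?sqrtr0// ltW.
have -> : (fun s => \sum_(j <- j :: r) F j s) = fun s => F j s + \sum_(j <- r) F j s.
  by apply/funext => s; rewrite big_cons.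
by rewrite big_cons; exact: bdACD.
Qed.

Lemma bdACV a k u : bdAC a k u -> (forall x, 0 <= x -> x <= a -> 1 <= u x) ->
  bdAC a (1 + k) (fun x => (u x)^-1).
Proof.
move=> b h; have k0 := bdAC_ge0 b; case: b => v [hu c d].
have inv1 x : 0 <= x -> x <= a -> 0 < (u x)^-1 <= 1.
  by move=> x0 xa; apply: inv_ge1; exact: h.
have hV := ACV hu h.
have inv2 x : 0 <= x -> x <= a -> `|(u x)^-1| <= 1.
  by move=> x0 xa; have /andP[i1 i2] := inv1 x x0 xa; rewrite ger0_norm// ltW.
eexists; split; first exact: hV.
  by move=> x x0 xa; apply: le_trans (inv2 _ x0 xa) _; lra.
rewrite nrmN.
have l1 := AC_bmul hV (AC_L2 hu).
have l2 := AC_bmul hV l1.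
rewrite (@eq_nrm _ _ _ _ (fun x => (u x)^-1 * ((u x)^-1 * v x))); last by move=> s _; ring.
have := nrm_AC_mul hV l1 inv2 ler01.
have := nrm_AC_mul hV (AC_L2 hu) inv2 ler01.
by lra.
Qed.

End AbsolutelyContinuous.

(** * Weak derivatives and representatives of Sobolev functions *)

Section Sobolev.
Context {R : realType}.
Implicit Types (x y z a c d k e r M : R) (u v w f g p q U V phi : R -> R).

Lemma cont_L2 x y f : continuous f -> L2 x y f.
Proof.
move=> cf; split; first by apply: cont_meas => //; exact: measurable_itv.
apply: (@integrableS _ _ _ (@lebesgue_measure R) `[x, y]%classic) => //.
  exact: subset_itv_oo_cc.
apply: (@cont_itg _ _ _ (fun s => f s ^+ 2)) => s.
by apply: cvgM; exact: cf.
Qed.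

Lemma test_is_derive a phi : test_function a phi ->
  forall n x, is_derive x 1 (derive1n n phi) (derive1n n.+1 phi x).
Proof.
move=> [h _] n x; apply: (DeriveDef (h n x)).
by rewrite -derive1E derive1nS.
Qed.

Lemma test_cont a phi n : test_function a phi -> continuous (derive1n n phi).
Proof. by move=> h; apply: is_derive_cont; exact: test_is_derive h n. Qed.

Lemma test_AC a phi n : test_function a phi ->
  abs_cont a (derive1n n phi) (derive1n n.+1 phi).
Proof.
move=> h; split; first by apply: cont_L2; exact: test_cont h.
move=> x y x0 xy ya; apply: FTC2_I => //; first exact: test_is_derive h n.
exact: test_cont h.
Qed.

Lemma test_der a phi : test_function a phi -> test_function a (derive1 phi).
Proof.
move=> h; split; first by move=> n x; rewrite -derive1Sn; apply: (proj1 h).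
have [_ [c [d [c0 da hs]]]] := h; exists c, d; split=> // x xcd.
have op : open (~` `[c, d]%classic : set R).
  by apply: closed_openC; exact: itv_closed.
rewrite derive1E (_ : 'D_1 phi x = 'D_1 (cst 0) x); first exact: derive_cst.
apply: near_eq_derive.
have : nbhs x (~` `[c, d]%classic : set R).
  by apply: open_nbhs_nbhs; split => //= xc; rewrite xc in xcd.
by apply: filterS => y /negP; exact: hs.
Qed.

Lemma test_end a phi n : 0 <= a -> test_function a phi ->
  derive1n n phi 0 = 0 /\ derive1n n phi a = 0.
Proof.
move=> a0; elim: n phi => [|n IH] phi h; last by rewrite derive1Sn; apply: IH; exact: test_der.
have [_ [c [d [c0 da hs]]]] := h; rewrite derive1n0.
by split; apply: hs; rewrite in_itv/= negb_and -!ltNge ?c0 ?da ?orbT.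
Qed.

Lemma itg_test a phi n u : test_function a phi -> itg 0 a u ->
  itg 0 a (fun x => u x * derive1n n phi x).
Proof.
move=> h iu; have hA := test_AC n h; have [K K0 hK] := AC_bnd hA.
apply: (@itg_bmul _ _ _ K) => //; first exact: AC_meas hA _ _.
by move=> s; rewrite in_itv/= => /andP[/ltW s0 /ltW sa]; exact: hK.
Qed.

Lemma weak_uniq a n u v v' : weak_derivative a n u v -> weak_derivative a n u v' ->
  aeq 0 a v v'.
Proof.
move=> [l1 h1] [l2 h2]; apply: test_fun_uniq; [exact: L2_itg l1|exact: L2_itg l2|].
move=> phi hphi; have := h1 _ hphi; rewrite (h2 _ hphi).
have s0 : (-1) ^+ n != 0 :> R by rewrite signr_eq0.
by move/(mulfI s0).
Qed.

(** [get] returns an arbitrary value on an empty set, so the existence of some weak derivative has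
    to be supplied before [wD] means anything. *)
Lemma wD_weak a n u v : weak_derivative a n u v -> weak_derivative a n u (wD a n u).
Proof. by move=> h; exact: (@getPex _ [set v | weak_derivative a n u v] (ex_intro _ v h)). Qed.

Lemma wD_aeq a n u v : weak_derivative a n u v -> aeq 0 a (wD a n u) v.
Proof. by move=> h; exact: weak_uniq (wD_weak h) h. Qed.

Lemma weak0 a u : L2 0 a u -> weak_derivative a 0 u u.
Proof. by move=> h; split => // phi _; rewrite expr0 mul1r derive1n0. Qed.

(** Even at order 0 the derivative is a choice: [wD a 0 u] may differ from [u] on a null set. *)
Lemma wD0_aeq a u : L2 0 a u -> aeq 0 a (wD a 0 u) u.
Proof. by move=> /weak0; exact: wD_aeq. Qed.

Lemma meas_test a phi n : test_function a phi -> measurable_fun `]0, a[ (derive1n n phi).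
Proof. by move=> h; apply: cont_meas (@test_cont _ _ n h); exact: measurable_itv. Qed.

Lemma weak_aeq a n u u' v : measurable_fun `]0, a[ u -> measurable_fun `]0, a[ u' ->
  aeq 0 a u u' -> weak_derivative a n u v -> weak_derivative a n u' v.
Proof.
move=> mu mu' uu [l h]; split => // phi hphi; rewrite -h//.
have mp := meas_test n hphi.
apply: (@aeq_I R 0 a (fun x => u' x * derive1n n phi x) (fun x => u x * derive1n n phi x)).
- exact: measurable_funM.
- exact: measurable_funM.
- by apply: ae_leb_imp uu => s hs /hs ->.
Qed.

Lemma weak_lin a n c u1 v1 u2 v2 : itg 0 a u1 -> itg 0 a u2 ->
  weak_derivative a n u1 v1 -> weak_derivative a n u2 v2 ->
  weak_derivative a n (fun x => c * u1 x + u2 x) (fun x => c * v1 x + v2 x).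
Proof.
move=> i1 i2 [l1 h1] [l2 h2]; split.
  by apply: L2D => //; exact: L2Z.
move=> phi hphi.
have e1 : I 0 a (fun x => u1 x * derive1n n phi x) = (-1) ^+ n * I 0 a (fun x => v1 x * phi x).
  exact: h1.
have e2 : I 0 a (fun x => u2 x * derive1n n phi x) = (-1) ^+ n * I 0 a (fun x => v2 x * phi x).
  exact: h2.
have j1 := itg_test n hphi i1; have j2 := itg_test n hphi i2.
have k1 := itg_test 0 hphi (L2_itg l1).
have k2 := itg_test 0 hphi (L2_itg l2).
change (I 0 a (fun x => (c * u1 x + u2 x) * derive1n n phi x) =
  (-1) ^+ n * I 0 a (fun x => (c * v1 x + v2 x) * phi x)).
transitivity (I 0 a (fun x => c * (u1 x * derive1n n phi x) + u2 x * derive1n n phi x)).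
  by apply: eq_I => s _; ring.
rewrite ID ?IZ//; last exact: itgZ.
rewrite e1 e2.
transitivity ((-1) ^+ n * I 0 a (fun x => c * (v1 x * phi x) + v2 x * phi x)).
  by rewrite ID ?IZ//; [ring|exact: itgZ].
by congr (_ * _); apply: eq_I => s _; ring.
Qed.

Lemma AC_weak1 a u v : 0 <= a -> abs_cont a u v -> weak_derivative a 1 u v.
Proof.
move=> a0 h; split => [|phi hphi]; first exact: AC_L2 h.
have hA := test_AC 0 hphi.
have [_ /(_ 0 a (lexx 0) a0 (lexx a))] := ACM h hA.
have [-> ->] := test_end 0 a0 hphi; rewrite !mulr0 subr0.
rewrite ID; last 2 first.
- exact: L2_mul (AC_L2 h) (AC_L2f hA).
- exact: L2_mul (AC_L2f h) (AC_L2 hA).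
rewrite derive1n0 expr1 /I mulN1r; lra.
Qed.

Lemma AC_weak2 a u v w : 0 <= a -> abs_cont a u v -> abs_cont a v w -> weak_derivative a 2 u w.
Proof.
move=> a0 h1 h2; split => [|phi hphi]; first exact: AC_L2 h2.
have [_ e1] := AC_weak1 a0 h1; have [_ e2] := AC_weak1 a0 h2.
have := e1 _ (test_der hphi); have := e2 _ hphi.
rewrite -derive1Sn derive1n1 => -> ->; ring.
Qed.

(** Every neighbourhood of a point of [0, a] meets ]0, a[ in an interval of positive length, hence
    contains a point where the two functions agree. This upgrades identities almost everywhere, such
    as the constraint, to identities at every point. *)
Lemma cont_aeq_eq a w w' : 0 < a -> {within `[0, a], continuous w} ->
  {within `[0, a], continuous w'} -> aeq 0 a w w' ->
  forall x, 0 <= x -> x <= a -> w x = w' x.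
Proof.
move=> a0 cw cw' ww x x0 xa; apply: le_all_eps => e e0.
have xin : `[0, a]%classic x by rewrite /= in_itv/= x0.
have e2 : 0 < e / 2 by lra.
have /subspace_continuousP/(_ x xin)/cvgrPdist_lt/(_ _ e2) := cw.
move=> /nbhs_normP[d1 /= d10 h1].
have /subspace_continuousP/(_ x xin)/cvgrPdist_lt/(_ _ e2) := cw'.
move=> /nbhs_normP[d2 /= d20 h2].
pose d := Num.min d1 d2; have d0 : 0 < d by rewrite lt_min d10.
pose l := Num.max 0 (x - d); pose r := Num.min a (x + d).
have lr : l < r by rewrite /l /r lt_min !gt_max; apply/andP; split; apply/andP; split; lra.
have [s sin hs] := ae_ex lr ww.
move: sin; rewrite in_itv/= /l /r gt_max lt_min => /andP[/andP[s0 sd] /andP[sa sd']].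
have ss : `|x - s| < d by apply/ltr_normlP; split; lra.
have sin : `[0, a]%classic s by rewrite /= in_itv/=; lra.
have a1 := h1 s (lt_le_trans ss (_ : d <= d1)).
have a2 := h2 s (lt_le_trans ss (_ : d <= d2)).
have {a1} := a1 _ sin; have {a2} := a2 _ sin.
rewrite !ge_min !lexx orbT => /(_ isT) b2 /(_ isT) b1.
have E : w s = w' s by apply: hs; rewrite in_itv/= s0.
have {}b1 : `|w x - w s| < e / 2 := b1; have {}b2 : `|w' x - w' s| < e / 2 := b2.
rewrite E in b1.
have -> : w x - w' x = (w x - w' s) - (w' x - w' s) by ring.
by apply: le_trans (ler_normB _ _) _; lra.
Qed.

(** [end_value] quantifies over continuous representatives; as these coincide on [0, a], it can be
    computed from the absolutely continuous one. *)
Lemma end_valueP a u w p c : 0 < a -> aeq 0 a u w -> abs_cont a w p ->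
  end_value a u c <-> w a = c.
Proof.
move=> a0 uw hw; have cw := AC_cont (ltW a0) hw; split.
  move=> [w' [cw' uw' <-]]; apply: (@cont_aeq_eq a) => //; [|exact: ltW].
  by apply: aeq_trans uw'; exact: aeq_sym.
by move=> wc; exists w; split.
Qed.

(* w is the absolutely continuous representative of u, and p = w'. *)
Definition rep1 a u w p : Prop :=
  [/\ measurable_fun `]0, a[ u, aeq 0 a u w & abs_cont a w p].

Definition rep2 a u w p q : Prop := rep1 a u w p /\ abs_cont a p q.

Lemma rep1_L2 a u w p : rep1 a u w p -> L2 0 a u.
Proof. by move=> [mu uw h]; apply: aeq_L2 (AC_L2f h) => //; exact: aeq_sym. Qed.

Lemma rep1_weak a u w p : 0 <= a -> rep1 a u w p -> weak_derivative a 1 u p.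
Proof.
move=> a0 [mu uw h]; apply: weak_aeq (AC_weak1 a0 h) => //.
  exact: AC_meas h _ _.
exact: aeq_sym.
Qed.

Lemma rep2_weak a u w p q : 0 <= a -> rep2 a u w p q -> weak_derivative a 2 u q.
Proof.
move=> a0 [[mu uw h] h2]; apply: weak_aeq (AC_weak2 a0 h h2) => //.
  exact: AC_meas h _ _.
exact: aeq_sym.
Qed.

Lemma rep1_sob a u w p : 0 <= a -> rep1 a u w p -> sobolev 1 a u.
Proof.
move=> a0 h; have l := rep1_L2 h; split => // -[|[|//]] _.
  by exists u; exact: weak0.
by exists p; exact: rep1_weak h.
Qed.

Lemma rep2_sob a u w p q : 0 <= a -> rep2 a u w p q -> sobolev 2 a u.
Proof.
move=> a0 h; have l := rep1_L2 (proj1 h); split => // -[|[|[|//]]] _.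
- by exists u; exact: weak0.
- by exists p; exact: rep1_weak (proj1 h).
- by exists q; exact: rep2_weak h.
Qed.

Lemma rep1_wD0 a u w p : rep1 a u w p -> aeq 0 a (wD a 0 u) w.
Proof.
move=> h; apply: aeq_trans (wD0_aeq (rep1_L2 h)) _; by case: h.
Qed.

Lemma rep1_wD1 a u w p : 0 <= a -> rep1 a u w p -> aeq 0 a (wD a 1 u) p.
Proof. by move=> a0 h; apply: wD_aeq; exact: rep1_weak h. Qed.

Lemma rep2_wD2 a u w p q : 0 <= a -> rep2 a u w p q -> aeq 0 a (wD a 2 u) q.
Proof. by move=> a0 h; apply: wD_aeq; exact: rep2_weak h. Qed.

Lemma sob_L2 m a u : sobolev m a u -> L2 0 a u. Proof. by case. Qed.

Lemma sob_wD m n a u : sobolev m a u -> (n <= m)%N -> weak_derivative a n u (wD a n u).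
Proof. by move=> [_ h] /h[v]; exact: wD_weak. Qed.

Lemma weak1_AC a u v : 0 < a -> L2 0 a u -> weak_derivative a 1 u v ->
  exists2 w, aeq 0 a u w & abs_cont a w v.
Proof.
move=> a0 lu [lv h].
have [|k hk] := weak_der1_repr a0 (L2_itg lu) (L2_itg lv).
  by move=> phi hphi; have := h _ hphi; rewrite derive1n1 expr1 mulN1r.
exists (fun x => k + I 0 x v) => //; split => // x y x0 xy ya.
have iv : itg 0 y v by apply: itg_sub (L2_itg lv).
by rewrite (I_split x0 xy iv); ring.
Qed.

Lemma AC_aeq a w p p' : measurable_fun `]0, a[ p' -> aeq 0 a p p' -> abs_cont a w p -> abs_cont a w p'.
Proof.
move=> mp pp [l h]; split; first exact: aeq_L2 pp l.
move=> x y x0 xy ya; rewrite h//; apply: aeq_I; last exact: aeq_sub pp.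
  exact: meas_sub (proj1 l).
exact: meas_sub mp.
Qed.

Lemma sob1_rep a u : 0 < a -> sobolev 1 a u -> exists w, rep1 a u w (wD a 1 u).
Proof.
move=> a0 h; have l := sob_L2 h.
have [w uw hw] := weak1_AC a0 l (@sob_wD _ 1 _ _ h isT).
by exists w; split => //; case: l.
Qed.

(** Testing with the derivative of [phi] identifies [wD a 2 u] as the weak derivative of [wD a 1 u],
    so the first-order representation applies twice. The derivative of [w] is then replaced by its
    continuous version [p]. *)
Lemma sob2_rep a u : 0 < a -> sobolev 2 a u -> exists w p, rep2 a u w p (wD a 2 u).
Proof.
move=> a0 h; have l := sob_L2 h.
have h1 := @sob_wD _ 1 _ _ h isT; have h2 := @sob_wD _ 2 _ _ h isT.
have [w uw hw] := weak1_AC a0 l h1.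
have w1 : weak_derivative a 1 (wD a 1 u) (wD a 2 u).
  split; first by case: h2.
  move=> phi hphi; have := (proj2 h2) _ hphi; have := (proj2 h1) _ (test_der hphi).
  by rewrite -derive1Sn expr2 expr1 => -> E; lra.
have [p wp hp] := weak1_AC a0 (proj1 h1) w1.
exists w, p; split => //; split => //; first by case: l.
apply: AC_aeq wp hw; exact: AC_meas hp _ _.
Qed.

Lemma rep1_lin a c u1 w1 p1 u2 w2 p2 : rep1 a u1 w1 p1 -> rep1 a u2 w2 p2 ->
  rep1 a (fun x => c * u1 x + u2 x) (fun x => c * w1 x + w2 x) (fun x => c * p1 x + p2 x).
Proof.
move=> [m1 e1 h1] [m2 e2 h2]; split.
- by apply: measurable_funD => //; exact: measurable_funM.
- by apply: ae_leb_imp2 e1 e2 => s h h' sa; rewrite h// h'.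
- by apply: ACD => //; exact: ACZ.
Qed.

Lemma rep2_lin a c u1 w1 p1 q1 u2 w2 p2 q2 : rep2 a u1 w1 p1 q1 -> rep2 a u2 w2 p2 q2 ->
  rep2 a (fun x => c * u1 x + u2 x) (fun x => c * w1 x + w2 x) (fun x => c * p1 x + p2 x)
    (fun x => c * q1 x + q2 x).
Proof.
move=> [h1 g1] [h2 g2]; split; first exact: rep1_lin.
by apply: ACD => //; exact: ACZ.
Qed.

Lemma wD_meas m n a u : sobolev m a u -> (n <= m)%N -> L2 0 a (wD a n u).
Proof. by move=> h nm; case: (sob_wD h nm). Qed.

Lemma sob_lin m a c u1 u2 : sobolev m a u1 -> sobolev m a u2 ->
  sobolev m a (fun x => c * u1 x + u2 x).
Proof.
move=> h1 h2; have l1 := sob_L2 h1; have l2 := sob_L2 h2; split.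
  by apply: L2D => //; exact: L2Z.
move=> n nm; eexists; apply: weak_lin; [exact: L2_itg l1|exact: L2_itg l2| |].
  exact: sob_wD h1 nm.
exact: sob_wD h2 nm.
Qed.

Lemma wD_lin m n a c u1 u2 : (n <= m)%N -> sobolev m a u1 -> sobolev m a u2 ->
  aeq 0 a (wD a n (fun x => c * u1 x + u2 x)) (fun x => c * wD a n u1 x + wD a n u2 x).
Proof.
move=> nm h1 h2; apply: wD_aeq; apply: weak_lin; [exact: L2_itg (sob_L2 h1)
  |exact: L2_itg (sob_L2 h2)|exact: sob_wD h1 nm|exact: sob_wD h2 nm].
Qed.

End Sobolev.

Local Notation second_diff p q v i s :=
  (coordf v i s - 2 * coordf q i s + coordf p i s).

(** * The discrete energy estimate *)

Section Energy.
Context {R : realType}.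
Implicit Types (x y z a c d k e L tau omega b : R) (u w g : R -> R).
Implicit Types (p q F r v phi : R -> 'rV[R]_3) (eg : 'rV[R]_3).

Lemma L2_ipE a p q : (forall i, L2 0 a (coordf p i)) -> (forall i, L2 0 a (coordf q i)) ->
  L2_ip a p q = \sum_i I 0 a (fun s => coordf p i s * coordf q i s).
Proof.
move=> hp hq; rewrite -I_sum//.
by move=> i _; exact: L2_mul.
Qed.

(** [W], [P], [Q] stand for the curve, its tangent and its second derivative. As [W] and [P] have
    values at every point, the end conditions of [calV] become equations. *)
Definition repV a eg r (W P Q : 'I_3 -> R -> R) : Prop := forall i,
  [/\ rep2 a (coordf r i) (W i) (P i) (Q i), W i a = 0 & P i a = - eg ord0 i].

Lemma calV_rep a eg r : 0 < a -> calV a eg r -> exists W P, repV a eg r W P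
  (fun i => wD a 2 (coordf r i)).
Proof.
move=> a0 h.
have : forall i, exists WP : (R -> R) * (R -> R),
   [/\ rep2 a (coordf r i) WP.1 WP.2 (wD a 2 (coordf r i)), WP.1 a = 0 & WP.2 a = - eg ord0 i].
  move=> i; have [s2 e0 e1] := h i; have [w [p hr]] := sob2_rep a0 s2.
  exists (w, p); split => //=.
    have [[_ _ hA] _] := hr.
    exact: (proj1 (end_valueP _ a0 (rep1_wD0 (proj1 hr)) hA) e0).
  exact: (proj1 (end_valueP _ a0 (rep1_wD1 (ltW a0) (proj1 hr)) (proj2 hr)) e1).
move=> /choice[WP hWP]; exists (fun i => (WP i).1), (fun i => (WP i).2); exact: hWP.
Qed.

Lemma rep_calV a eg r W P Q : 0 < a -> repV a eg r W P Q -> calV a eg r.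
Proof.
move=> a0 h i; have [hr h0 h1] := h i; split.
- exact: rep2_sob (ltW a0) hr.
- have [[_ _ hA] _] := hr.
  exact: (proj2 (end_valueP _ a0 (rep1_wD0 (proj1 hr)) hA) h0).
- exact: (proj2 (end_valueP _ a0 (rep1_wD1 (ltW a0) (proj1 hr)) (proj2 hr)) h1).
Qed.

Lemma calV_sob a eg r i : calV a eg r -> sobolev 2 a (coordf r i).
Proof. by move=> h; have [] := h i. Qed.

Lemma calV_L2 a eg r i : calV a eg r -> L2 0 a (coordf r i).
Proof. by move=> /(calV_sob i)/sob_L2. Qed.

Lemma calV_L2'' a eg r i : calV a eg r -> L2 0 a (wD a 2 (coordf r i)).
Proof. by move=> /(calV_sob i) h; exact: wD_meas h _. Qed.

Definition move_to (theta : R) (q r : R -> 'rV[R]_3) : R -> 'rV[R]_3 :=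
  fun s => theta *: q s + (1 - theta) *: r s.

Lemma coord_move theta q r i :
  coordf (move_to theta q r) i = fun s => theta * coordf q i s + (1 - theta) * coordf r i s.
Proof. by apply/funext => s; rewrite /coordf !mxE. Qed.

(** Linearity of weak derivatives is stated in the shape [c * u1 + u2]; two uses of it cover a
    convex combination once it is written like this. *)
Lemma lin_form (theta : R) (u v : R -> R) :
  (fun s => theta * u s + (1 - theta) * v s) =
  (fun s => theta * u s + ((- theta) * v s + v s)).
Proof. by apply/funext => s; ring. Qed.

Lemma repV_move a eg theta q r Wq Pq Qq Wr Pr Qr :
  repV a eg q Wq Pq Qq -> repV a eg r Wr Pr Qr ->
  repV a eg (move_to theta q r)
    (fun i s => theta * Wq i s + ((- theta) * Wr i s + Wr i s))
    (fun i s => theta * Pq i s + ((- theta) * Pr i s + Pr i s))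
    (fun i s => theta * Qq i s + ((- theta) * Qr i s + Qr i s)).
Proof.
move=> hq hr i; have [q2 q0 q1] := hq i; have [r2 r0 r1] := hr i; split.
- by rewrite coord_move lin_form; apply: rep2_lin => //; exact: rep2_lin.
- by rewrite q0 r0; ring.
- by rewrite q1 r1; ring.
Qed.

Lemma vD1_sub a eg q r Wq Pq Qq Wr Pr Qr i : 0 < a ->
  repV a eg q Wq Pq Qq -> repV a eg r Wr Pr Qr ->
  aeq 0 a (fun s => vD a 1 (fun x => r x - q x) s ord0 i) (fun s => Pr i s - Pq i s).
Proof.
move=> a0 hq hr; have [q2 _ _] := hq i; have [r2 _ _] := hr i.
have -> : (fun s => vD a 1 (fun x => r x - q x) s ord0 i) =
    wD a 1 (fun s => (-1) * coordf q i s + coordf r i s).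
  apply/funext => s; rewrite mxE; congr (wD a 1 _ s); apply/funext => t.
  by rewrite /coordf !mxE; ring.
apply: aeq_trans (rep1_wD1 (ltW a0) (rep1_lin (-1) (proj1 q2) (proj1 r2))) _.
by apply: aeqW => s _; ring.
Qed.

Lemma vD1_rep a eg q Wq Pq Qq i : 0 < a -> repV a eg q Wq Pq Qq ->
  aeq 0 a (fun s => vD a 1 q s ord0 i) (Pq i).
Proof.
move=> a0 hq; have [q2 _ _] := hq i.
have -> : (fun s => vD a 1 q s ord0 i) = wD a 1 (coordf q i).
  by apply/funext => s; rewrite mxE.
exact: rep1_wD1 (ltW a0) (proj1 q2).
Qed.

Lemma ae_all3 (P : 'I_3 -> R -> Prop) : (forall i, {ae @leb R, forall s, P i s}) ->
  {ae @leb R, forall s, forall i, P i s}.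
Proof. by apply: filter_forall; exact: (ae_filter_ringOfSetsType (@lebesgue_measure R)). Qed.

Lemma e_constr_rep a eg q r Wq Pq Qq Wr Pr Qr : 0 < a ->
  repV a eg q Wq Pq Qq -> repV a eg r Wr Pr Qr ->
  aeq 0 a (e_constr a q r) (fun s => 2 * \sum_i (Pr i s - Pq i s) * Pq i s).
Proof.
move=> a0 hq hr.
have h1 := ae_all3 (fun i => vD1_sub i a0 hq hr).
have h2 := ae_all3 (fun i => vD1_rep i a0 hq).
apply: ae_leb_imp2 h1 h2 => s h1 h2 sa; rewrite /e_constr /dotp; congr (_ * _).
by apply: eq_bigr => i _; rewrite h1// h2.
Qed.

(** The scalar product of the representatives is absolutely continuous, so vanishing almost
    everywhere means vanishing on all of [0, a]. *)
Lemma constr_rep a eg q r Wq Pq Qq Wr Pr Qr : 0 < a ->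
  repV a eg q Wq Pq Qq -> repV a eg r Wr Pr Qr ->
  (calK a eg q r <-> forall s, 0 <= s -> s <= a -> \sum_i (Pr i s - Pq i s) * Pq i s = 0).
Proof.
move=> a0 hq hr; have he := e_constr_rep a0 hq hr; split.
  move=> [_ hk].
  have hA : abs_cont a (fun s => \sum_i (Pr i s - Pq i s) * Pq i s)
     (fun s => \sum_i ((Qr i s - Qq i s) * Pq i s + (Pr i s - Pq i s) * Qq i s)).
    apply: (@AC_sum _ _ _ (fun i s => (Pr i s - Pq i s) * Pq i s)
     (fun i s => ((Qr i s - Qq i s) * Pq i s + (Pr i s - Pq i s) * Qq i s))) => i.
    have [[_ q2] _ _] := hq i; have [[_ r2] _ _] := hr i.
    by apply: ACM => //; exact: ACB.
  apply: (@cont_aeq_eq _ a _ (fun=> 0)) => //; first exact: AC_cont (ltW a0) hA.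
    exact: AC_cont (ltW a0) (AC_cst a 0).
  apply: ae_leb_imp2 he hk => s h1 h2 sa; have := h1 sa; rewrite h2//; lra.
move=> h; split; first exact: rep_calV hr.
apply: ae_leb_imp he => s hs sin; rewrite hs//.
by move: sin; rewrite in_itv/= => /andP[s0 sa]; rewrite h ?mulr0// ltW.
Qed.

(** The constraint is affine in the unknown and trivially satisfied by [q] itself, so moving [r]
    towards [q] only multiplies its left-hand side by [1 - theta]. *)
Lemma calK_move a eg q r theta : 0 < a -> calV a eg q -> calK a eg q r ->
  calK a eg q (move_to theta q r).
Proof.
move=> a0 hq hK; have [hr _] := hK.
have [Wq [Pq rq]] := calV_rep a0 hq; have [Wr [Pr rr]] := calV_rep a0 hr.
have hc := proj1 (constr_rep a0 rq rr) hK.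
apply/(constr_rep a0 rq (repV_move theta rq rr)).
move=> s s0 sa; transitivity ((1 - theta) * (\sum_i (Pr i s - Pq i s) * Pq i s)).
  by rewrite mulr_sumr; apply: eq_bigr => i _; ring.
by rewrite hc// mulr0.
Qed.

Lemma small_quad (B C : R) : (forall t, 0 < t -> t <= 1 -> 0 <= t * B + t ^+ 2 * C) -> 0 <= B.
Proof.
move=> h; rewrite leNgt; apply/negP => B0.
have C0 : 0 < `|C| + 1 by have := normr_ge0 C; lra.
(* With this [t] the quadratic term is at most half of [- t * B], so the whole expression is
   negative. *)
pose t := Num.min 1 (- B / (2 * (`|C| + 1))).
have t0 : 0 < t by rewrite lt_min ltr01/= divr_gt0//; lra.
have t1 : t <= 1 by rewrite ge_min lexx.
have tB : t * (2 * (`|C| + 1)) <= - B.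
  by rewrite -ler_pdivlMr; [rewrite ge_min lexx orbT|lra].
have := h t t0 t1; have := ler_norm C.
move=> hC; have : t * C <= t * `|C| by rewrite ler_wpM2l// ltW.
nra.
Qed.

Lemma L2_second_diff a p q v i : L2 0 a (coordf p i) -> L2 0 a (coordf q i) ->
  L2 0 a (coordf v i) -> L2 0 a (fun s => second_diff p q v i s).
Proof. by move=> lp lq lv; apply: L2D => //; apply: L2B => //; exact: L2Z. Qed.

(** The factor [tau * (tau ^+ 2)^-1] is [1/tau] left unsimplified, since the identity is stated for
    an arbitrary [tau]. *)
Lemma JE a omega b tau p q F v : (forall i, L2 0 a (coordf p i)) ->
  (forall i, L2 0 a (coordf q i)) -> (forall i, L2 0 a (coordf F i)) ->
  (forall i, L2 0 a (coordf v i)) -> (forall i, L2 0 a (wD a 2 (coordf v i))) ->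
  J a omega b tau p q F v =
  omega * ((tau * (tau ^+ 2)^-1) ^+ 2 *
     \sum_i I 0 a (fun s => (second_diff p q v i s) ^+ 2))
  + b * \sum_i I 0 a (fun s => wD a 2 (coordf v i) s ^+ 2)
  - 2 * \sum_i I 0 a (fun s => coordf F i s * coordf v i s).
Proof.
move=> hp hq hF hv hv2; rewrite /J.
have hD i : coordf (fun s => tau *: D2 tau p q v s) i =
    fun s => (tau * (tau ^+ 2)^-1) * second_diff p q v i s.
  by apply/funext => s; rewrite /coordf /D2 !mxE; ring.
have ha i : L2 0 a (fun s => second_diff p q v i s).
  exact: L2_second_diff.
have hv2' i : coordf (vD a 2 v) i = wD a 2 (coordf v i).
  by apply/funext => s; rewrite /coordf !mxE.
rewrite !L2_ipE//; try by move=> i; rewrite ?hD ?hv2'//; exact: L2Z.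
congr (_ * _ + b * _ - _).
  rewrite mulr_sumr; apply: eq_bigr => i _; rewrite -IZ; last by case: (ha i).
  by apply: eq_I => s _; rewrite hD; ring.
by apply: eq_bigr => i _; apply: eq_I => s _; rewrite hv2' expr2.
Qed.

#[local] Opaque I wD.

Lemma sum_quad (f g h k : 'I_3 -> R) t : (forall i, f i = g i + 2 * t * h i + t ^+ 2 * k i) ->
  \sum_i f i = \sum_i g i + 2 * t * \sum_i h i + t ^+ 2 * \sum_i k i.
Proof. by move=> e; rewrite (eq_bigr _ (fun i _ => e i)) !big_split/= -!mulr_sumr. Qed.

Lemma sum_lin (f g h : 'I_3 -> R) t : (forall i, f i = g i + t * h i) ->
  \sum_i f i = \sum_i g i + t * \sum_i h i.
Proof. by move=> e; rewrite (eq_bigr _ (fun i _ => e i)) !big_split/= -!mulr_sumr. Qed.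

Lemma variation_alg (w b c2 t a0 a1 a2 b0 b1 b2 f0 f1 m0 m1 m2 : R) :
  m0 = a0 + 2 * t * a1 + t ^+ 2 * a2 -> m1 = b0 + 2 * t * b1 + t ^+ 2 * b2 ->
  m2 = f0 + t * f1 ->
  w * (c2 * a0) + b * b0 - 2 * f0 <= w * (c2 * m0) + b * m1 - 2 * m2 ->
  0 <= t * (2 * (w * (c2 * a1) + b * b1 - f1)) + t ^+ 2 * (w * (c2 * a2) + b * b2).
Proof. by move=> -> -> -> h; lra. Qed.

Lemma energy_alg (w b c2 a0 a1 a2 b0 b1 b2 f : R) : 0 <= w -> 0 <= b -> 0 <= c2 ->
  2 * a0 <= a1 - a2 -> 2 * b0 <= b1 - b2 -> 0 <= w * (c2 * a0) + b * b0 - f ->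
  w * (c2 * a2) + b * b2 <= w * (c2 * a1) + b * b1 + 2 * - f.
Proof.
move=> w0 b0' c0 h1 h2 h3.
have := ler_wpM2l (mulr_ge0 w0 c0) h1; have := ler_wpM2l b0' h2; lra.
Qed.

(** [J] is quadratic along the segment from [v] to [q], which stays admissible; minimality at [v]
    makes the linear coefficient nonnegative. This one-sided inequality in the direction [q - v] is
    all that the energy estimate uses. *)
Lemma variation a eg omega b tau p q F v : 0 < a ->
  calV a eg p -> calV a eg q -> (forall i, L2 0 a (coordf F i)) ->
  is_minimizer (calK a eg q) (J a omega b tau p q F) v ->
  forall c, c = tau * (tau ^+ 2)^-1 ->
  0 <= omega * (c ^+ 2 * \sum_i I 0 a (fun s =>
         second_diff p q v i s * (coordf q i s - coordf v i s)))
    + b * (\sum_i I 0 a (fun s => wD a 2 (coordf v i) s *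
         (wD a 2 (coordf q i) s - wD a 2 (coordf v i) s)))
    - \sum_i I 0 a (fun s => coordf F i s * (coordf q i s - coordf v i s)).
Proof.
move=> a0 hp hq hF [hK hmin] c cE; have [hv _] := hK.
have lp i := calV_L2 i hp; have lq i := calV_L2 i hq.
have lv i := calV_L2 i hv; have lq2 i := calV_L2'' i hq.
have lv2 i := calV_L2'' i hv.
have la i : L2 0 a (fun s => second_diff p q v i s).
  exact: L2_second_diff.
have ld i : L2 0 a (fun s => coordf q i s - coordf v i s) by exact: L2B.
have ld2 i : L2 0 a (fun s => wD a 2 (coordf q i) s - wD a 2 (coordf v i) s) by exact: L2B.
suff : 0 <= 2 * (omega * (c ^+ 2 * \sum_i I 0 a (fun s =>
         second_diff p q v i s * (coordf q i s - coordf v i s)))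
    + b * (\sum_i I 0 a (fun s => wD a 2 (coordf v i) s *
         (wD a 2 (coordf q i) s - wD a 2 (coordf v i) s)))
    - \sum_i I 0 a (fun s => coordf F i s * (coordf q i s - coordf v i s))) by lra.
apply: (@small_quad _ (omega * (c ^+ 2 * \sum_i I 0 a (fun s => (coordf q i s - coordf v i s) ^+ 2))
   + b * \sum_i I 0 a (fun s => (wD a 2 (coordf q i) s - wD a 2 (coordf v i) s) ^+ 2))) => t t0 t1.
have hm := calK_move t a0 hq hK; have [hmv _] := hm.
have lm i := calV_L2 i hmv; have lm2 i := calV_L2'' i hmv.
have := hmin _ hm; rewrite (@JE a)// (@JE a)// -cE.
have E1 i : I 0 a (fun s => (second_diff p q (move_to t q v) i s) ^+ 2)
   = I 0 a (fun s => (second_diff p q v i s) ^+ 2)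
   + 2 * t * I 0 a (fun s => second_diff p q v i s * (coordf q i s - coordf v i s))
   + t ^+ 2 * I 0 a (fun s => (coordf q i s - coordf v i s) ^+ 2).
  rewrite -quad_expand//; apply: eq_I => s _; rewrite coord_move; congr (_ ^+ 2); ring.
have E2 i : I 0 a (fun s => wD a 2 (coordf (move_to t q v) i) s ^+ 2)
   = I 0 a (fun s => wD a 2 (coordf v i) s ^+ 2)
   + 2 * t * I 0 a (fun s => wD a 2 (coordf v i) s * (wD a 2 (coordf q i) s - wD a 2 (coordf v i) s))
   + t ^+ 2 * I 0 a (fun s => (wD a 2 (coordf q i) s - wD a 2 (coordf v i) s) ^+ 2).
  (* The chosen second derivatives are linear only almost everywhere, so the integrands are compared
     up to null sets. *)
  rewrite -quad_expand//; apply: aeq_I.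
  - by apply: measurable_funX; case: (lm2 i).
  - by apply: measurable_funX; case: (L2D (lv2 i) (L2Z t (ld2 i))).
  have sq := calV_sob i hq; have sv := calV_sob i hv.
  have h1 := @wD_lin _ 2 2 a t _ _ isT sq (@sob_lin _ 2 a (- t) _ _ sv sv).
  have h2 := @wD_lin _ 2 2 a (- t) _ _ isT sv sv.
  apply: ae_leb_imp2 h1 h2 => s h1 h2 sa; rewrite coord_move lin_form h1// h2//.
  by congr (_ ^+ 2); ring.
have E3 i : I 0 a (fun s => coordf F i s * coordf (move_to t q v) i s)
   = I 0 a (fun s => coordf F i s * coordf v i s)
   + t * I 0 a (fun s => coordf F i s * (coordf q i s - coordf v i s)).
  rewrite -IZ; last exact: L2_mul.
  rewrite -ID; [|exact: L2_mul|by apply: itgZ; exact: L2_mul].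
  by apply: eq_I => s _; rewrite coord_move; ring.
have S1 := sum_quad E1; have S2 := sum_quad E2.
have S3 := sum_lin E3.
exact: variation_alg S1 S2 S3.
Qed.

(** $2u(w-u) = w^2 - u^2 - (u-w)^2$; the dropped square is the numerical dissipation of the implicit
    step. *)
Lemma cross_le a u w : L2 0 a u -> L2 0 a w ->
  2 * I 0 a (fun s => u s * (w s - u s)) <= I 0 a (fun s => w s ^+ 2) - I 0 a (fun s => u s ^+ 2).
Proof.
move=> lu lw; have l := L2_mul lu (L2B lw lu); have iu := proj2 lu; have iw := proj2 lw.
rewrite -IZ// -IB//; apply: le_I; [exact: itgZ|exact: itgB|move=> s _].
by have := sqr_ge0 (u s - w s); rewrite sqrrB; lra.
Qed.

(** Kinetic energy of the velocity [(q - p) / tau] plus bending energy of [q], both without the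
    factor 1/2, as in [J]. *)
Definition energy a omega b tau p q : R :=
  omega * ((tau * (tau ^+ 2)^-1) ^+ 2 * \sum_i I 0 a (fun s => (coordf q i s - coordf p i s) ^+ 2))
  + b * \sum_i I 0 a (fun s => wD a 2 (coordf q i) s ^+ 2).

Lemma energy_step a eg omega b tau p q F v : 0 < a -> 0 <= omega -> 0 <= b ->
  calV a eg p -> calV a eg q -> (forall i, L2 0 a (coordf F i)) ->
  is_minimizer (calK a eg q) (J a omega b tau p q F) v ->
  energy a omega b tau q v <= energy a omega b tau p q
   + 2 * \sum_i I 0 a (fun s => coordf F i s * (coordf v i s - coordf q i s)).
Proof.
move=> a0 w0 b0 hp hq hF hmin; have := variation a0 hp hq hF hmin erefl.
have [[hv _] _] := hmin; rewrite /energy; set c := tau * (tau ^+ 2)^-1.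
have lp i := calV_L2 i hp; have lq i := calV_L2 i hq.
have lv i := calV_L2 i hv; have lq2 i := calV_L2'' i hq.
have lv2 i := calV_L2'' i hv.
have le1 : 2 * \sum_i I 0 a (fun s => second_diff p q v i s * (coordf q i s - coordf v i s))
  <= \sum_i I 0 a (fun s => (coordf q i s - coordf p i s) ^+ 2) - \sum_i I 0 a (fun s => (coordf v i s - coordf q i s) ^+ 2).
  rewrite mulr_sumr -sumrB; apply: ler_sum => i _.
  (* The second difference is [(v - q) - (q - p)]: [cross_le] is applied to the new and the old
     increment. *)
  apply: le_trans (cross_le (L2B (lv i) (lq i)) (L2B (lq i) (lp i))).
  by rewrite ler_pM2l//; apply: eq_ler; apply: eq_I => s _; ring.
have le2 : 2 * \sum_i I 0 a (fun s => wD a 2 (coordf v i) s * (wD a 2 (coordf q i) s - wD a 2 (coordf v i) s))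
  <= \sum_i I 0 a (fun s => wD a 2 (coordf q i) s ^+ 2) - \sum_i I 0 a (fun s => wD a 2 (coordf v i) s ^+ 2).
  by rewrite mulr_sumr -sumrB; apply: ler_sum => i _; apply: cross_le.
have -> : \sum_i I 0 a (fun s => coordf F i s * (coordf v i s - coordf q i s)) =
   - \sum_i I 0 a (fun s => coordf F i s * (coordf q i s - coordf v i s)).
  rewrite -sumrN; apply: eq_bigr => i _; rewrite -IN; last by apply: L2_mul => //; exact: L2B.
  by apply: eq_I => s _; ring.
by move=> h; apply: energy_alg h; rewrite // sqr_ge0.
Qed.

(** If $\sqrt x > \sqrt y + m$, multiplying by $\sqrt x$ gives $x > y + m\sqrt x$. Passing to square
    roots makes the force add a fixed amount per step instead of a factor. *)
Lemma sqrt_growth (x y m : R) : 0 <= x -> 0 <= y -> 0 <= m ->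
  x <= y + m * Num.sqrt x -> Num.sqrt x <= Num.sqrt y + m.
Proof.
move=> x0 y0 m0; have := sqrtr_ge0 x; have := sqrtr_ge0 y.
have := sqr_sqrtr x0; have := sqr_sqrtr y0; move: (Num.sqrt x) (Num.sqrt y) => s t ey ex t0 s0.
by rewrite -ex -ey => h; rewrite leNgt; apply/negP => lt; nra.
Qed.

Lemma energy_ge0 a omega b tau p q : 0 <= omega -> 0 <= b -> 0 <= energy a omega b tau p q.
Proof.
move=> w0 b0; apply: addr_ge0; apply: mulr_ge0 => //.
  apply: mulr_ge0; first exact: sqr_ge0.
  by apply: sumr_ge0 => i _; exact: I_sqr_ge0.
by apply: sumr_ge0 => i _; exact: I_sqr_ge0.
Qed.

Lemma energy_diff a omega b tau p q i : 0 < omega -> 0 < b -> 0 < tau ->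
  nrm 0 a (fun s => coordf q i s - coordf p i s) <=
  tau * (Num.sqrt (energy a omega b tau p q) / Num.sqrt omega).
Proof.
move=> w0 b0 t0; have E0 := energy_ge0 a tau p q (ltW w0) (ltW b0).
rewrite -sqrtrV; last exact: ltW.
rewrite -sqrtrM// -{1}(gtr0_norm t0) -sqrtr_sqr -sqrtrM ?sqr_ge0// ler_sqrt; last first.
  by rewrite mulr_ge0 ?sqr_ge0// divr_ge0// ltW.
rewrite mulrA ler_pdivlMr// /energy.
have nb : 0 <= b * \sum_i I 0 a (fun s => wD a 2 (coordf q i) s ^+ 2).
  apply: mulr_ge0; first exact: ltW.
  by apply: sumr_ge0 => j _; exact: I_sqr_ge0.
rewrite mulrDr -[leLHS]addr0; apply: lerD; last by apply: mulr_ge0 => //; exact: sqr_ge0.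
rewrite (_ : tau ^+ 2 * _ = omega * \sum_i I 0 a (fun s => (coordf q i s - coordf p i s) ^+ 2)); last first.
  by field; rewrite gt_eqF.
rewrite mulrC ler_pM2l// (bigD1 i)//= lerDl.
by apply: sumr_ge0 => j _; exact: I_sqr_ge0.
Qed.

Lemma energy_second a omega b tau p q i : 0 < omega -> 0 < b ->
  nrm 0 a (wD a 2 (coordf q i)) <= Num.sqrt (energy a omega b tau p q) / Num.sqrt b.
Proof.
move=> w0 b0; have E0 := energy_ge0 a tau p q (ltW w0) (ltW b0).
rewrite -sqrtrV; last exact: ltW.
rewrite -sqrtrM// ler_sqrt; last by rewrite divr_ge0// ltW.
rewrite ler_pdivlMr// /energy mulrC -[leLHS]add0r lerD//.
  rewrite mulr_ge0 ?(ltW w0)// mulr_ge0 ?sqr_ge0//.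
  by apply: sumr_ge0 => j _; exact: I_sqr_ge0.
rewrite ler_pM2l// (bigD1 i)//= lerDl.
by apply: sumr_ge0 => j _; exact: I_sqr_ge0.
Qed.

#[local] Opaque energy.

(** The work of the force is at most [Fb] times the increment, itself at most [tau] times the root
    of the new energy up to a constant; [sqrt_growth] absorbs that root. The 6 is the 2 of the
    energy inequality times 3 coordinates. *)
Lemma energy_growth a eg omega b tau p q F v (Fb : R) : 0 < a -> 0 < omega -> 0 < b ->
  0 < tau -> calV a eg p -> calV a eg q -> (forall i, L2 0 a (coordf F i)) ->
  (forall i, nrm 0 a (coordf F i) <= Fb) ->
  is_minimizer (calK a eg q) (J a omega b tau p q F) v ->
  Num.sqrt (energy a omega b tau q v) <=
  Num.sqrt (energy a omega b tau p q) + tau * (6 * Fb / Num.sqrt omega).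
Proof.
move=> a0 w0 b0 t0 hp hq lF hF hmin.
have [[hv _] _] := hmin.
have Fb0 : 0 <= Fb by apply: le_trans (hF ord0); exact: nrm_ge0.
have sw : 0 < Num.sqrt omega by rewrite sqrtr_gt0.
have E1 := energy_ge0 a tau q v (ltW w0) (ltW b0).
have E0 := energy_ge0 a tau p q (ltW w0) (ltW b0).
apply: sqrt_growth => //.
  by apply: mulr_ge0; [exact: ltW|apply: divr_ge0; [apply: mulr_ge0|exact: ltW]].
apply: le_trans (energy_step a0 (ltW w0) (ltW b0) hp hq lF hmin) _.
rewrite lerD2l.
have h i : `|I 0 a (fun s => coordf F i s * (coordf v i s - coordf q i s))| <=
   Fb * (tau * (Num.sqrt (energy a omega b tau q v) / Num.sqrt omega)).
  have ld : L2 0 a (fun s => coordf v i s - coordf q i s).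
    by apply: L2B; [exact: calV_L2 hv|exact: calV_L2 hq].
  apply: le_trans (cauchy_schwarz (lF i) ld) _.
  by apply: ler_pM; rewrite ?nrm_ge0//; exact: energy_diff.
rewrite (_ : tau * (6 * Fb / Num.sqrt omega) * _ =
  2 * (3 * (Fb * (tau * (Num.sqrt (energy a omega b tau q v) / Num.sqrt omega))))); last by field; rewrite gt_eqF.
rewrite ler_pM2l//; apply: le_trans (ler_norm _) _; exact: sum3_bound h.
Qed.

End Energy.

(** * The field of the multiplier and its change between time steps *)

Section Multiplier.
Context {R : realType}.
Implicit Types (x y z s a b c d k e E K tau omega : R) (u w g G : R -> R).
Implicit Types (p q F r v phi : R -> 'rV[R]_3) (eg : 'rV[R]_3).
Implicit Types (P Q W : 'I_3 -> R -> R).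

(* With P = q', [dirX P] is the field q' / (2 |q'|^2) of (e')^{-1}. *)
Definition sqn P s : R := \sum_i P i s * P i s.
Definition dirX P (i : 'I_3) s : R := P i s * (sqn P s)^-1 * 2^-1.

(** A lower bound rather than an equality: the constraint is linearized at the previous curve, so
    the speed may grow from step to step. *)
Definition unit_speed a P : Prop := forall s, 0 <= s -> s <= a -> 1 <= sqn P s.

(** The tangent is pinned at [a] and its derivative is bounded by [E], hence [k] controls it on
    [0, a]. The calculus of [bdAC] then treats the sum of three squares ([kn]), its inverse and the
    product; [K] depends on [a] and [E] only. *)
Lemma dirX_bound a E : 0 <= a -> 0 <= E -> exists2 K : R, 1 <= K & forall P Q,
  (forall i, abs_cont a (P i) (Q i)) -> (forall i, `|P i a| <= 1) ->
  (forall i, nrm 0 a (Q i) <= E) -> unit_speed a P ->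
  forall i, bdAC a K (dirX P i) /\ bdAC a K (fun s => (sqn P s)^-1).
Proof.
move=> a0 E0; pose k := 1 + Num.sqrt a * E + E.
pose kn := \sum_(i < 3) (2 * k * k).
have sa := sqrtr_ge0 a.
have saE : 0 <= Num.sqrt a * E by exact: mulr_ge0.
have k0 : 0 <= k by rewrite /k; lra.
have kn0 : 0 <= kn by apply: sumr_ge0 => i _; rewrite !mulr_ge0.
exists (1 + kn + `|2^-1| * (2 * k * (1 + kn))).
  have : 0 <= `|2^-1| * (2 * k * (1 + kn)) by rewrite !mulr_ge0//; lra.
  by lra.
move=> P Q hA hPa hQ hn i.
have bP j : bdAC a k (P j).
  exists (Q j); split => //; last by rewrite /k; have := hQ j; lra.
  move=> x x0 xa; have := AC_hold (hA j) x0 xa (lexx a).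
  have := ler_normD (P j a) (P j x - P j a); rewrite subrKC [`|_ - P j a|]distrC.
  have h1 : Num.sqrt (a - x) * nrm 0 a (Q j) <= Num.sqrt a * E.
    by apply: ler_pM; rewrite ?sqrtr_ge0 ?nrm_ge0// ler_sqrt//; lra.
  have := hPa j; rewrite /k; lra.
have bn : bdAC a kn (sqn P) by apply: bdAC_sum => j; exact: bdACM.
have bV : bdAC a (1 + kn) (fun s => (sqn P s)^-1) by exact: bdACV.
split.
  rewrite (_ : dirX P i = (fun x => 2^-1 * (P i x * (sqn P x)^-1))); last first.
    by apply/funext => s; rewrite /dirX; ring.
  apply: bdAC_le (bdACZ 2^-1 (bdACM (bP i) bV)); lra.
apply: bdAC_le bV; have : 0 <= `|2^-1| * (2 * k * (1 + kn)) by rewrite !mulr_ge0//; lra.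
by lra.
Qed.

Lemma dirX_AC a P Q : (forall i, abs_cont a (P i) (Q i)) -> unit_speed a P ->
  exists X', forall i, abs_cont a (dirX P i) (X' i).
Proof.
move=> hA hn.
have hs : abs_cont a (sqn P) (fun s => \sum_i (Q i s * P i s + P i s * Q i s)).
  by apply: (@AC_sum _ _ _ (fun i s => P i s * P i s)) => i; exact: ACM.
have hV := ACV hs hn.
have : forall i, exists X', abs_cont a (dirX P i) X'.
  move=> i; have h := ACZ 2^-1 (ACM (hA i) hV).
  eexists; move: h; rewrite (_ : (fun x => 2^-1 * (P i x * _)) = dirX P i); first by move=> h; exact: h.
  by apply/funext => s; rewrite /dirX; ring.
by move=> /choice[X' hX']; exists X'.
Qed.

(** $(e')^{-1}[g]$ written with representatives, [G] of g and [P] of the tangent; it vanishes at [a]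
    and has derivative [G * dirX P i]. *)
Definition PhiI a G P (i : 'I_3) s : R := - I s a (fun x => G x * dirX P i x).

(** Inversion is discontinuous at 0, a value that the chosen tangent may take on a null set; the
    real power with exponent -1 is measurable and agrees with inversion on nonnegative values. *)
Lemma inv_meas (D : set R) (f : R -> R) : (forall x, 0 <= f x) -> measurable_fun D f ->
  measurable_fun D (fun x => (f x)^-1).
Proof.
move=> f0 mf; rewrite (_ : (fun x => _) = (fun x => (f x) `^ (-1))); last first.
  by apply/funext => x; rewrite powR_inv1.
exact: (measurableT_comp (measurable_powR _) mf).
Qed.

(** The integrands agree only almost everywhere, but the integrals then agree for every [s]. *)
Lemma e_inv_PhiI a eg q W P Q g G g' s i : 0 < a -> repV a eg q W P Q ->
  unit_speed a P -> rep1 a g G g' -> 0 <= s ->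
  e'_inv a q g s ord0 i = PhiI a G P i s.
Proof.
move=> a0 hq hn [mg gG hG] s0.
have hA j : abs_cont a (P j) (Q j) by have [[]] := hq j.
have [X' hX] := dirX_AC hA hn.
rewrite mxE /PhiI; congr (- _).
change (I s a (fun x => g x * vD a 1 q x ord0 i / (2 * enorm (vD a 1 q x) ^+ 2)) =
  I s a (fun x => G x * dirX P i x)).
have mv j : measurable_fun `]0, a[ (fun x => vD a 1 q x ord0 j).
  have [hr _ _] := hq j.
  have := @wD_meas _ _ 1 _ _ (rep1_sob (ltW a0) (proj1 hr)) isT => -[m _].
  by rewrite (_ : (fun x => _) = wD a 1 (coordf q j))//; apply/funext => x; rewrite mxE.
have hall := ae_all3 (fun j => vD1_rep j a0 hq).
have en x : enorm (vD a 1 q x) ^+ 2 = dotp (vD a 1 q x) (vD a 1 q x).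
  rewrite sqr_sqrtr// /dotp; apply: sumr_ge0 => j _; exact: sqr_ge0.
apply: aeq_I; last first.
- apply: (@aeq_sub _ _ _ 0 a) => //.
  apply: ae_leb_imp2 gG hall => x h1 h2 xa; rewrite h1// en /dotp.
  rewrite (eq_bigr (fun j => P j x * P j x)); last by move=> j _; rewrite h2.
  by rewrite h2// /dirX /sqn invfM; ring.
- apply: (@meas_sub _ _ _ 0 a) => //.
  by apply: measurable_funM; [exact: AC_meas hG _ _|exact: AC_meas (hX i) _ _].
apply: (@meas_sub _ _ _ 0 a) => //; apply: measurable_funM.
  exact: measurable_funM.
apply: inv_meas => [x|]; first by rewrite mulr_ge0// sqr_ge0.
apply: measurable_funM => //.
rewrite (_ : (fun x => _) = (fun x => \sum_j vD a 1 q x ord0 j * vD a 1 q x ord0 j)); last first.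
  by apply/funext => x; rewrite en.
by apply: measurable_sum => j; exact: measurable_funM.
Qed.

Lemma PhiI_AC a G P i u : 0 <= a -> abs_cont a (fun x => G x * dirX P i x) u ->
  abs_cont a (PhiI a G P i) (fun x => G x * dirX P i x).
Proof.
move=> a0 h; have l := AC_L2f h; split => // x y x0 xy ya.
have i1 : itg x a (fun x => G x * dirX P i x) by apply: itg_sub (L2_itg l).
by rewrite /PhiI (I_split xy ya i1); ring.
Qed.

Lemma PhiI_rep a eg q W P Q g G g' X' i : 0 < a -> repV a eg q W P Q ->
  unit_speed a P -> rep1 a g G g' -> (forall i, abs_cont a (dirX P i) (X' i)) ->
  rep2 a (coordf (e'_inv a q g) i) (PhiI a G P i) (fun x => G x * dirX P i x)
    (fun x => g' x * dirX P i x + G x * X' i x).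
Proof.
move=> a0 hq hn hg hX; have [mg gG hG] := hg.
have h := ACM hG (hX i).
have hP := PhiI_AC (ltW a0) h; split => //.
have ee s : s \in `]0, a[ -> coordf (e'_inv a q g) i s = PhiI a G P i s.
  by rewrite in_itv/= => /andP[s0 _]; rewrite /coordf (e_inv_PhiI _ a0 hq hn hg (ltW s0)).
split => //; last exact: aeqW.
apply: (@eq_measurable_fun _ _ _ _ _ (PhiI a G P i)); last exact: AC_meas hP _ _.
by move=> s; rewrite inE/= => /ee ->.
Qed.

#[local] Opaque I wD.

(** Every choice hidden in the test field is replaced by a formula; in particular its second
    derivative is $g'X + GX'$ with $X$ = [dirX P]. The step [tau] survives in the inertial term
    alone. *)
Lemma J'_formula a eg omega b tau p q F v W P Q g G g' X' : 0 < a ->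
  calV a eg p -> repV a eg q W P Q -> calV a eg v -> (forall i, L2 0 a (coordf F i)) ->
  unit_speed a P -> rep1 a g G g' -> (forall i, abs_cont a (dirX P i) (X' i)) ->
  J' a omega b tau p q F v (e'_inv a q g) =
  2 * (omega * ((tau ^+ 2)^-1 * \sum_i I 0 a (fun s =>
          second_diff p q v i s * PhiI a G P i s))
     + b * \sum_i I 0 a (fun s => wD a 2 (coordf v i) s *
          (g' s * dirX P i s + G s * X' i s))
     - \sum_i I 0 a (fun s => coordf F i s * PhiI a G P i s)).
Proof.
move=> a0 hp hq hv hF hn hg hX.
have hr i := PhiI_rep i a0 hq hn hg hX.
have lp i := calV_L2 i hp; have lv i := calV_L2 i hv.
have lq i := calV_L2 i (rep_calV a0 hq).
have lv2 i := calV_L2'' i hv.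
have lphi i := rep1_L2 (proj1 (hr i)).
have lPhi i : L2 0 a (PhiI a G P i) by have [[_ _ /AC_L2f]] := hr i.
have ae0 i : aeq 0 a (coordf (e'_inv a q g) i) (PhiI a G P i) by have [[]] := hr i.
have ae2 i := rep2_wD2 (ltW a0) (hr i).
have lphi2 i : L2 0 a (wD a 2 (coordf (e'_inv a q g) i)).
  by apply: wD_meas (rep2_sob (ltW a0) (hr i)) _.
have lH i : L2 0 a (fun s => g' s * dirX P i s + G s * X' i s).
  by have [_ /AC_L2] := hr i.
have la i : L2 0 a (fun s => second_diff p q v i s).
  exact: L2_second_diff.
have hD i : coordf (D2 tau p q v) i =
    fun s => (tau ^+ 2)^-1 * second_diff p q v i s.
  by apply/funext => s; rewrite /coordf /D2 !mxE; ring.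
have hv2 r i : coordf (vD a 2 r) i = wD a 2 (coordf r i).
  by apply/funext => s; rewrite /coordf !mxE.
have aeM (u1 u2 u3 : R -> R) : L2 0 a u1 -> L2 0 a u2 -> L2 0 a u3 -> aeq 0 a u2 u3 ->
    I 0 a (fun s => u1 s * u2 s) = I 0 a (fun s => u1 s * u3 s).
  move=> l1 l2 l3 h; apply: aeq_I.
  - exact: itg_meas (L2_mul l1 l2).
  - exact: itg_meas (L2_mul l1 l3).
  - by apply: ae_leb_imp h => s h sa; rewrite h.
rewrite /J'; congr (2 * (omega * _ + b * _ - _)).
- rewrite L2_ipE//; last by move=> i; rewrite hD; exact: L2Z.
  rewrite mulr_sumr; apply: eq_bigr => i _.
  rewrite (aeM _ _ _ _ (lphi i) (lPhi i) (ae0 i)); last by rewrite hD; exact: L2Z.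
  rewrite -IZ; last exact: L2_mul.
  by apply: eq_I => s _; rewrite hD; ring.
- rewrite L2_ipE; [|by move=> i; rewrite hv2..].
  apply: eq_bigr => i _; rewrite !hv2.
  exact: aeM (lphi2 i) (lH i) (ae2 i).
- rewrite L2_ipE//; apply: eq_bigr => i _.
  exact: aeM (lphi i) (lPhi i) (ae0 i).
Qed.

(** As [G] vanishes at [a], its sup norm is at most $\sqrt a$ times the norm of its derivative; the
    summand 1 accounts for the derivative itself. *)
Lemma G_bd a G g' (gam : R) : 0 <= a -> abs_cont a G g' -> G a = 0 ->
  nrm 0 a g' <= gam -> bdAC a ((1 + Num.sqrt a) * gam) G.
Proof.
move=> a0 h Ga hg; have g0 : 0 <= gam by apply: le_trans hg; exact: nrm_ge0.
have sa := sqrtr_ge0 a.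
exists g'; split => //; last by nra.
move=> x x0 xa; have := AC_hold h x0 xa (lexx a); rewrite Ga sub0r normrN.
move=> /le_trans; apply; apply: (@le_trans _ _ (Num.sqrt a * gam)); last by nra.
by apply: ler_pM; rewrite ?sqrtr_ge0 ?nrm_ge0// ler_sqrt//; lra.
Qed.

Lemma PhiI_bnd a k G P i s : bdAC a k (fun x => G x * dirX P i x) -> 0 <= s -> s <= a ->
  `|PhiI a G P i s| <= a * k.
Proof.
move=> h s0 sa; have k0 := bdAC_ge0 h; case: h => v [hA hb _].
rewrite normrN; apply: (@le_trans _ _ (k * (a - s))).
  apply: norm_I_le => //; first exact: AC_meas hA _ _.
  by move=> t; rewrite in_itv/= => /andP[st ta]; apply: hb; lra.
by rewrite mulrC; nra.
Qed.

Lemma nrm_le_bnd a k u : 0 <= a -> L2 0 a u -> (forall s, 0 <= s -> s <= a -> `|u s| <= k) ->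
  nrm 0 a u <= k * Num.sqrt a.
Proof.
move=> a0 lu h; have k0 : 0 <= k by apply: le_trans (h 0 _ _).
rewrite -{1}(ger0_norm k0) -[a in Num.sqrt a]subr0 -nrm_cst//.
apply: le_nrm => //; first exact: L2_cst.
by move=> s; rewrite in_itv/= => /andP[s0 sa]; apply: h; exact: ltW.
Qed.

(* By the constraint, |P|^2 - |P0|^2 = (P - P0) . P, which makes the difference
   linear in P - P0. *)
Lemma dirX_diff a P P0 i s : 0 <= s -> s <= a -> unit_speed a P -> unit_speed a P0 ->
  \sum_j (P j s - P0 j s) * P0 j s = 0 ->
  dirX P i s - dirX P0 i s =
  (sqn P s)^-1 * 2^-1 * (P i s - P0 i s)
   - 2 * dirX P0 i s * \sum_j dirX P j s * (P j s - P0 j s).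
Proof.
move=> s0 sa h h0 hc.
have n1 : sqn P s != 0 by rewrite gt_eqF// (lt_le_trans ltr01)// h.
have n0 : sqn P0 s != 0 by rewrite gt_eqF// (lt_le_trans ltr01)// h0.
have e1 : \sum_j dirX P j s * (P j s - P0 j s) =
   (sqn P s)^-1 * 2^-1 * (sqn P s - sqn P0 s).
  have -> : sqn P s - sqn P0 s = \sum_j (P j s - P0 j s) * P j s.
    have -> : \sum_j (P j s - P0 j s) * P j s =
       \sum_j ((P j s - P0 j s) * P0 j s + (P j s * P j s - P0 j s * P0 j s
          - 2 * ((P j s - P0 j s) * P0 j s))).
      by apply: eq_bigr => j _; ring.
    by rewrite !big_split/= hc !add0r !sumrN -mulr_sumr hc mulr0 subr0.
  by rewrite mulr_sumr; apply: eq_bigr => j _; rewrite /dirX; ring.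
rewrite e1 /dirX; move: (sqn P s) (sqn P0 s) n1 n0 => A B A0 B0.
by field; rewrite A0 B0.
Qed.

(* Integration by parts: only the size of D enters, not that of D'. *)
Lemma parts_bnd a k B D D' s : 0 <= a -> bdAC a k B -> abs_cont a D D' -> D a = 0 ->
  0 <= s -> s <= a ->
  `|I s a (fun x => B x * D' x)| <= k * (`|D s| + nrm 0 a D).
Proof.
move=> a0 hB hD Da s0 sa; have k0 := bdAC_ge0 hB; case: hB => B' [hA hb hn].
have [_ e] := ACM hA hD.
have l1 : L2 0 a (fun x => B' x * D x).
  by apply: eq_L2 (AC_bmul hD (AC_L2 hA)) => t _; rewrite mulrC.
have l2 := AC_bmul hA (AC_L2 hD).
have := e s a s0 sa (lexx a); rewrite Da mulr0 ID; last 2 first.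
- exact: itg_sub (L2_itg l1).
- exact: itg_sub (L2_itg l2).
set I1 := I s a (fun x => B' x * D x); set I2 := I s a _ => E.
have -> : I2 = - (B s * D s) - I1 by lra.
apply: le_trans (ler_normB _ _) _; rewrite normrN mulrDr; apply: lerD.
  by rewrite normrM ler_wpM2r// hb.
apply: le_trans (cauchy_schwarz _ _) _.
- exact: L2_sub (AC_L2 hA).
- exact: L2_sub (AC_L2f hD).
apply: ler_pM; rewrite ?nrm_ge0//.
- by apply: le_trans hn; apply: nrm_sub => //; exact: AC_L2 hA.
- by apply: nrm_sub => //; exact: AC_L2f hD.
Qed.

(** Of the two powers of [tau], one comes from the increment [d] and one from the change of the
    field. By [dirX_diff] the latter is linear in [P - P0], the derivative of [D = W - W0], so
    [parts_bnd] leaves only [D], again of size [E * tau]. The 96 is 3 coordinates, times 4 terms in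
    each, times the 8 in [k]. *)
Lemma Phi_diff a K E (gam tau : R) P P0 Q Q0 W W0 (d : 'I_3 -> R -> R) G g' :
  0 <= a -> 0 <= gam -> 0 <= tau -> 1 <= K -> 0 <= E ->
  (forall i, abs_cont a (W i) (P i)) -> (forall i, abs_cont a (W0 i) (P0 i)) ->
  (forall i, W i a = 0) -> (forall i, W0 i a = 0) ->
  (forall i, bdAC a K (dirX P i)) -> bdAC a K (fun s => (sqn P s)^-1) ->
  (forall i, bdAC a K (dirX P0 i)) ->
  unit_speed a P -> unit_speed a P0 ->
  (forall s, 0 <= s -> s <= a -> \sum_j (P j s - P0 j s) * P0 j s = 0) ->
  (forall i, L2 0 a (d i)) ->
  (forall i, aeq 0 a (d i) (fun s => W i s - W0 i s)) ->
  (forall i, nrm 0 a (d i) <= E * tau) ->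
  abs_cont a G g' -> bdAC a ((1 + Num.sqrt a) * gam) G ->
  `|\sum_i I 0 a (fun s => d i s * PhiI a G P i s) - \sum_i I 0 a (fun s => d i s * PhiI a G P0 i s)|
   <= (96 * (1 + Num.sqrt a) ^+ 2 * K ^+ 2 * E ^+ 2) * tau ^+ 2 * gam.
Proof.
move=> a0 g0 t0 K1 E0 hW hW0 Wa W0a bX bM bX0 un un0 hc ld hd nd hG bG.
set sa := 1 + Num.sqrt a in bG *.
have sa1 : 1 <= sa by rewrite /sa lerDl sqrtr_ge0.
have K0 : 0 <= K by lra.
pose D j s := W j s - W0 j s.
have hD j : abs_cont a (D j) (fun s => P j s - P0 j s) by exact: ACB.
have Da j : D j a = 0 by rewrite /D Wa W0a subrr.
have lD j := AC_L2f (hD j).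
have nD j : nrm 0 a (D j) <= E * tau.
  by apply: le_trans (nd j); rewrite (aeq_nrm (proj1 (ld j)) (proj1 (lD j)) (hd j)).
pose B1 := fun s => G s * (2^-1 * (sqn P s)^-1).
pose B2 i j := fun s => G s * (2 * (dirX P0 i s * dirX P j s)).
(* In [B2] the two products cost a factor 2 each and the scalar 2 a third one; [B1] fits under the
   same constant because [1 <= K]. *)
pose k := 8 * sa * gam * K ^+ 2.
have sg0 : 0 <= sa * gam by apply: mulr_ge0 => //; lra.
have hk1 : sa * gam * K <= sa * gam * K ^+ 2.
  by apply: ler_wpM2l => //; rewrite expr2; nra.
have hk2 := mulr_ge0 sg0 (sqr_ge0 K).
have bB1 : bdAC a k B1.
  apply: bdAC_le (bdACM bG (bdACZ 2^-1 bM)).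
  rewrite ger0_norm; last lra.
  by rewrite /k; move: hk1 hk2; clear; lra.
have bB2 i j : bdAC a k (B2 i j).
  apply: bdAC_le (bdACM bG (bdACZ 2 (bdACM (bX0 i) (bX j)))).
  rewrite ger0_norm; last lra.
  by rewrite /k; move: hk1 hk2; clear; lra.
have k0 := bdAC_ge0 bB1.
have lGX P' i : bdAC a K (dirX P' i) -> L2 0 a (fun x => G x * dirX P' i x).
  by case=> v [hv _ _]; exact: AC_L2f (ACM hG hv).
have lB1 i : L2 0 a (fun x => B1 x * (P i x - P0 i x)).
  by case: bB1 => v [hv _ _]; exact: AC_bmul hv (AC_L2 (hD i)).
have lB2 i j : L2 0 a (fun x => B2 i j x * (P j x - P0 j x)).
  by case: (bB2 i j) => v [hv _ _]; exact: AC_bmul hv (AC_L2 (hD j)).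
have pt i s : 0 <= s -> s <= a -> `|PhiI a G P i s - PhiI a G P0 i s| <=
    k * (`|D i s| + E * tau) + \sum_j k * (`|D j s| + E * tau).
  move=> s0 sa'.
  have S u : L2 0 a u -> itg s a u by move=> l; apply: itg_sub (L2_itg l).
  have e : PhiI a G P i s - PhiI a G P0 i s =
     - I s a (fun x => B1 x * (P i x - P0 i x))
     + \sum_j I s a (fun x => B2 i j x * (P j x - P0 j x)).
    rewrite /PhiI.
    have -> : - I s a (fun x => G x * dirX P i x) - - I s a (fun x => G x * dirX P0 i x)
      = - (I s a (fun x => G x * dirX P i x) - I s a (fun x => G x * dirX P0 i x)) by ring.
    rewrite -IB; [|by apply: S; exact: lGX..].
    rewrite -I_sum; last by move=> j _; exact: S.
    rewrite -IN; last by apply: itgB; apply: S; exact: lGX.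
    rewrite -IN; last exact: S.
    rewrite -ID; [|by apply: itgN; exact: S|by apply: itg_sum => j _; exact: S].
    apply: eq_I => x; rewrite in_itv/= => /andP[sx xa].
    have x0 : 0 <= x by lra.
    rewrite -mulrBr (@dirX_diff a)//; [|exact: ltW|exact: hc x0 (ltW xa)].
    rewrite [in RHS](eq_bigr (fun j => (G x * 2 * dirX P0 i x) * (dirX P j x * (P j x - P0 j x)))); last first.
      by move=> j _; rewrite /B2; ring.
    by rewrite -mulr_sumr /B1; ring.
  rewrite e; apply: le_trans (ler_normD _ _) _; rewrite normrN; apply: lerD.
    apply: le_trans (parts_bnd a0 bB1 (hD i) (Da i) s0 sa') _.
    by rewrite ler_wpM2l// lerD2l.
  apply: le_trans (ler_norm_sum _ _ _) _; apply: ler_sum => j _.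
  apply: le_trans (parts_bnd a0 (bB2 i j) (hD j) (Da j) s0 sa') _.
  by rewrite ler_wpM2l// lerD2l.
have lPhi P' i : bdAC a K (dirX P' i) -> L2 0 a (PhiI a G P' i).
  by case=> v [hv _ _]; exact: AC_L2f (PhiI_AC a0 (ACM hG hv)).
have lk j : L2 0 a (fun s => k * (`|D j s| + E * tau)).
  by apply: L2Z; apply: L2D; [exact: L2_norm|exact: L2_cst].
have nk j : nrm 0 a (fun s => k * (`|D j s| + E * tau)) <= k * (E * tau * sa).
  have l1 := L2_norm (lD j); have l2 := L2_cst 0 a (E * tau).
  rewrite nrmZ; last exact: L2D.
  rewrite (ger0_norm k0) ler_wpM2l//; apply: le_trans (nrmD l1 l2) _.
  rewrite nrm_norm nrm_cst// subr0 (ger0_norm (mulr_ge0 E0 t0)) mulrDr mulr1.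
  by rewrite lerD2r.
rewrite -sumrB.
have one i : `|I 0 a (fun s => d i s * PhiI a G P i s) - I 0 a (fun s => d i s * PhiI a G P0 i s)|
   <= (E * tau) * (4 * (k * (E * tau * sa))).
  have lP := lPhi _ _ (bX i); have lP0 := lPhi _ _ (bX0 i).
  rewrite -IB; [|exact: L2_mul..].
  rewrite (@eq_I _ _ _ _ (fun s => d i s * (PhiI a G P i s - PhiI a G P0 i s))); last by move=> s _; ring.
  have lPP := L2B lP lP0.
  apply: le_trans (cauchy_schwarz (ld i) lPP) _.
  apply: ler_pM; rewrite ?nrm_ge0//.
  have ls : L2 0 a (fun s => \sum_j k * (`|D j s| + E * tau)) by exact: L2_sum.
  apply: (@le_trans _ _ (nrm 0 a (fun s => k * (`|D i s| + E * tau) + \sum_j k * (`|D j s| + E * tau)))).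
    apply: le_nrm => //; first exact: L2D.
    by move=> s; rewrite in_itv/= => /andP[s0 s1]; apply: pt; exact: ltW.
  apply: le_trans (nrmD (lk i) ls) _.
  have n3 : nrm 0 a (fun s => \sum_(j < 3) k * (`|D j s| + E * tau)) <= 3 * (k * (E * tau * sa)).
    apply: le_trans (nrm_sum _ _) _ => //; apply: le_trans (ler_sum _ (fun j _ => nk j)) _.
    by rewrite sumr_const card_ord mulr_natl.
  have := nk i; move: n3; move: (nrm 0 a _) (nrm 0 a _) => n1 n2; clear; lra.
apply: le_trans (sum3_bound one) _; rewrite /k; apply: eq_ler; ring.
Qed.

End Multiplier.

(** * Summation by parts in time *)

Section Abel.
Context {R : realType}.

(** The difference acts on the first index of [x] only. Shifting it onto the other factors costs the
    variation of the weight times a diagonal value of [x], and the change of [x] in its second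
    index; the initial boundary term is [x 1 1 = 0]. [V] majorizes the variation of [c], so that the
    first cost telescopes. *)
Lemma abel_bound (c V : nat -> R) (x : nat -> nat -> R) (H A B : R) (j : nat) :
  x 1%N 1%N = 0 -> 0 <= H -> 0 <= A ->
  (forall k, (k <= j)%N -> `|c k.+2| <= H) ->
  (forall k, (k < j)%N -> `|c k.+3 - c k.+2| <= V k.+3 - V k.+2) ->
  (forall k, (k <= j)%N -> `|x k.+2 k.+1| <= A) ->
  (forall k, (k < j)%N -> `|x k.+2 k.+2| <= A) ->
  (forall k, (k < j)%N -> `|x k.+2 k.+2 - x k.+2 k.+1| <= B) ->
  `|\sum_(0 <= k < j.+1) c k.+2 * (x k.+2 k.+1 - x k.+1 k.+1)|
    <= H * A + A * (V j.+2 - V 2%N) + j%:R * (H * B).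
Proof.
move=> x11 H0 A0 hc hV hx hxx hB.
have key m : (m <= j)%N -> `|\sum_(0 <= k < m.+1) c k.+2 * (x k.+2 k.+1 - x k.+1 k.+1)
   - c m.+2 * x m.+2 m.+1| <= A * (V m.+2 - V 2%N) + m%:R * (H * B).
  elim: m => [_|m IH mj].
    by rewrite big_nat1 x11 subr0 subrr subrr mulr0 mul0r addr0 normr0.
  have := IH (ltnW mj); rewrite [\sum_(0 <= k < m.+2) _]big_nat_recr//=.
  set S := \sum_(0 <= k < m.+1) _ => h.
  have -> : S + c m.+3 * (x m.+3 m.+2 - x m.+2 m.+2) - c m.+3 * x m.+3 m.+2 =
    (S - c m.+2 * x m.+2 m.+1) - c m.+2 * (x m.+2 m.+2 - x m.+2 m.+1)
    - (c m.+3 - c m.+2) * x m.+2 m.+2 by ring.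
  apply: le_trans (ler_normB _ _) _; apply: le_trans (lerD (ler_normB _ _) (lexx _)) _.
  have b1 : `|c m.+2 * (x m.+2 m.+2 - x m.+2 m.+1)| <= H * B.
    by rewrite normrM ler_pM// ?hc ?hB// ltnW.
  have b2 : `|(c m.+3 - c m.+2) * x m.+2 m.+2| <= A * (V m.+3 - V m.+2).
    by rewrite normrM mulrC; apply: ler_pM => //; [exact: hxx|exact: hV].
  apply: le_trans (lerD (lerD h b1) b2) _.
  by rewrite -[m.+1%:R]natr1; apply: eq_ler; ring.
have := key j (leqnn j); set S := \sum_(_ <= _ < _) _ => h.
have -> : S = (S - c j.+2 * x j.+2 j.+1) + c j.+2 * x j.+2 j.+1 by ring.
apply: le_trans (ler_normD _ _) _.
have b : `|c j.+2 * x j.+2 j.+1| <= H * A by rewrite normrM ler_pM// ?hc ?hx.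
by move: (lerD h b); clear; lra.
Qed.

End Abel.

(** * Time cells and the weights produced by the hat functions *)

Section TimeWeights.
Context {R : realType}.
Implicit Types (T t tau eta : R) (h H q : R -> R) (N k : nat).

#[local] Opaque I.

Lemma tau_gt0 T N : 0 < T -> (0 < N)%N -> 0 < tau_ T N.
Proof. by move=> T0 N0; rewrite divr_gt0// ltr0n. Qed.

Lemma t_ge0 T N k : 0 < T -> (0 < N)%N -> 0 <= t_ T N k.
Proof. by move=> T0 N0; rewrite mulr_ge0// ltW// tau_gt0. Qed.

Lemma t_S T N k : t_ T N k.+1 = t_ T N k + tau_ T N.
Proof. by rewrite /t_ -natr1; ring. Qed.

Lemma t_le T N k : 0 < T -> (0 < N)%N -> (k <= N)%N -> t_ T N k <= T.
Proof.
move=> T0 N0 kN; rewrite /t_ /tau_ mulrCA ler_piMr ?(ltW T0)//.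
by rewrite ler_pdivrMr ?ltr0n// mul1r ler_nat.
Qed.

Lemma cell_pos T N k : 0 < T -> (0 < N)%N -> (0 < k <= N)%N ->
  [/\ 0 <= t_ T N k.-1, t_ T N k.-1 <= t_ T N k, t_ T N k <= T &
     t_ T N k = t_ T N k.-1 + tau_ T N].
Proof.
move=> T0 N0; case: k => // k /andP[_ kN]; split; [exact: t_ge0| |exact: t_le|exact: t_S].
by rewrite /= t_S lerDl ltW// tau_gt0.
Qed.

Definition ramp T N k t : R := (t - t_ T N k.-1) / tau_ T N.

Definition cell T N k (q : R -> R) : R := I (t_ T N k.-1) (t_ T N k) q.

Lemma ramp_in T N k t : 0 < T -> (0 < N)%N -> (0 < k)%N ->
  t \in `]t_ T N k.-1, t_ T N k[ -> 0 <= ramp T N k t <= 1.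
Proof.
move=> T0 N0; case: k => // k _; have t0 := tau_gt0 T0 N0.
rewrite in_itv/= t_S => /andP[a b]; rewrite /ramp/= divr_ge0 ?(ltW t0)//=; last by lra.
by rewrite ler_pdivrMr// mul1r; lra.
Qed.

Lemma ramp_cont T N k : continuous (ramp T N k).
Proof.
by move=> t; apply: cvgM; [apply: cvgB; [exact: cvg_id|exact: cvg_cst]|exact: cvg_cst].
Qed.

Lemma ramp_meas T N k (x y : R) : measurable_fun `]x, y[ (ramp T N k).
Proof. by apply: cont_meas (@ramp_cont T N k); exact: measurable_itv. Qed.

Lemma ramp_mass T N k : 0 < T -> (0 < N)%N -> (0 < k)%N ->
  cell T N k (ramp T N k) = tau_ T N / 2.
Proof.
move=> T0 N0; case: k => // k _; have t0 := tau_gt0 T0 N0.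
pose f := fun t => (2 * tau_ T N)^-1 * ((t - t_ T N k) * (t - t_ T N k)).
have df t : is_derive t 1 f (ramp T N k.+1 t).
  have d1 : is_derive t (1 : R) (fun t => t - t_ T N k) (1 - 0).
    by apply: is_deriveB.
  have d2 := is_deriveM d1 d1; have d3 := is_deriveZ (2 * tau_ T N)^-1 d2.
  apply: is_derive_eq d3 _; rewrite /ramp/= /GRing.scale/=; field.
  by rewrite gt_eqF.
rewrite /cell/= -(@FTC2_I _ _ _ f _ _ df); last 2 first.
- by rewrite t_S lerDl ltW.
- exact: ramp_cont.
by rewrite /f t_S subrr mulr0 mulr0 subr0; field; rewrite gt_eqF.
Qed.

(** Covers both halves of a hat function, [ramp] and [1 - ramp], so that each estimate is proved
    once. *)
Definition cell_weight T N k (q : R -> R) : Prop :=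
  measurable_fun `](t_ T N k.-1), (t_ T N k)[ q /\
  forall t, t \in `](t_ T N k.-1), (t_ T N k)[ -> 0 <= q t <= 1.

Lemma ramp_weight T N k : 0 < T -> (0 < N)%N -> (0 < k)%N -> cell_weight T N k (ramp T N k).
Proof. by move=> T0 N0 k0; split => [|t]; [exact: ramp_meas|exact: ramp_in]. Qed.

Lemma co_ramp_weight T N k : 0 < T -> (0 < N)%N -> (0 < k)%N ->
  cell_weight T N k (fun t => 1 - ramp T N k t).
Proof.
move=> T0 N0 k0; split => [|t /(ramp_in T0 N0 k0)/andP[a c]].
  by apply: measurable_funB => //; exact: ramp_meas.
by rewrite subr_ge0 c gerBl a.
Qed.

(** The right-hand side is kept as a difference of integrals from 0, so that sums over cells
    telescope. *)
Lemma abs_var T H h' x y : abs_cont T H h' -> 0 <= x -> x <= y -> y <= T ->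
  `|H y - H x| <= I 0 y (fun s => `|h' s|) - I 0 x (fun s => `|h' s|).
Proof.
move=> [l e] x0 xy yT; rewrite e//.
have il := itg_norm (L2_itg l).
rewrite (@I_split _ 0 x y)//; last exact: itg_sub il.
rewrite addrAC subrr add0r; apply: norm_I.
exact: itg_sub (L2_itg l).
Qed.

(** Each weight is [mass * tau_ T N * H (t_ T N k)] up to [tau_ T N] times the variation of [H] on
    its cell. All cells have the same mass, so consecutive weights differ by two such errors and one
    variation of [H]. With $V$ = [Vh], twice $V_{k+1}-V_k$ plus $V_k-V_{k-1}$ is the increment of
    $2V_k+V_{k-1}$. *)
Lemma weight_bounds T N (q : nat -> R -> R) H h' (eta mass : R) :
  0 < T -> (0 < N)%N -> abs_cont T H h' -> H T = 0 -> nrm 0 T h' <= eta ->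
  0 <= mass -> mass <= 1 ->
  (forall k, (0 < k <= N)%N -> cell_weight T N k (q k)) ->
  (forall k, (0 < k <= N)%N -> cell T N k (q k) = mass * tau_ T N) ->
  let c := fun k => cell T N k (fun t => q k t * H t) in
  let Vh := fun k => I 0 (t_ T N k) (fun s => `|h' s|) in
  (forall k, (0 < k <= N)%N -> `|c k| <= tau_ T N * (Num.sqrt T * eta)) /\
  (forall k, (0 < k)%N -> (k < N)%N -> `|c k.+1 - c k| <=
     tau_ T N * (2 * Vh k.+1 + Vh k) - tau_ T N * (2 * Vh k + Vh k.-1)).
Proof.
move=> T0 N0 hA HT hn m0 m1 hw hm c Vh; have t0 := tau_gt0 T0 N0.
have mq k hk := proj1 (hw k hk); have hq k hk := proj2 (hw k hk).
have bH s : 0 <= s -> s <= T -> `|H s| <= Num.sqrt T * eta.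
  move=> s0 sT; have := AC_hold hA s0 sT (lexx T); rewrite HT sub0r normrN.
  move=> /le_trans; apply; apply: ler_pM; rewrite ?sqrtr_ge0 ?nrm_ge0// ler_sqrt; [lra|exact: ltW].
have mc k : (0 < k <= N)%N -> measurable_fun `](t_ T N k.-1), (t_ T N k)[ (fun t => q k t * H t).
  move=> hk; have [p1 p2 p3 _] := cell_pos T0 N0 hk.
  by apply: measurable_funM; [exact: mq|exact: AC_meas hA _ _].
split.
  move=> k hk; have [p1 p2 p3 p4] := cell_pos T0 N0 hk.
  have -> : tau_ T N * (Num.sqrt T * eta) = (Num.sqrt T * eta) * (t_ T N k - t_ T N k.-1).
    by rewrite p4 addrAC subrr add0r mulrC.
  apply: norm_I_le => //; first exact: mc.
  move=> s sin; have /andP[q0 q1] := hq _ hk _ sin.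
  move: sin; rewrite in_itv/= => /andP[s0 s1].
  rewrite normrM (ger0_norm q0) -[leRHS]mul1r ler_pM//; apply: bH; lra.
have il := itg_norm (L2_itg (AC_L2 hA)).
have err k : (0 < k <= N)%N -> `|c k - mass * tau_ T N * H (t_ T N k)| <= tau_ T N * (Vh k - Vh k.-1).
  move=> hk; have [p1 p2 p3 p4] := cell_pos T0 N0 hk.
  have iq : itg (t_ T N k.-1) (t_ T N k) (q k).
    apply: (@itg_bdd _ _ _ 1); first exact: mq.
    by move=> s sin; have /andP[q0 q1] := hq _ hk _ sin; rewrite ger0_norm.
  have iqH : itg (t_ T N k.-1) (t_ T N k) (fun t => q k t * H t).
    apply: (@itg_bdd _ _ _ (Num.sqrt T * eta)); first exact: mc.
    move=> s sin; have /andP[q0 q1] := hq _ hk _ sin.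
    move: sin; rewrite in_itv/= => /andP[s0 s1].
    rewrite normrM (ger0_norm q0) -[leRHS]mul1r ler_pM//; apply: bH; lra.
  have -> : c k - mass * tau_ T N * H (t_ T N k) =
     I (t_ T N k.-1) (t_ T N k) (fun t => q k t * H t - H (t_ T N k) * q k t).
    have hmk : I (t_ T N k.-1) (t_ T N k) (fun t => q k t) = mass * tau_ T N := hm _ hk.
    rewrite IB//; last exact: itgZ.
    by rewrite IZ// hmk [c k]/cell; ring.
  have -> : tau_ T N * (Vh k - Vh k.-1) = (Vh k - Vh k.-1) * (t_ T N k - t_ T N k.-1).
    have e' : t_ T N k - t_ T N k.-1 = tau_ T N by rewrite p4; ring.
    by rewrite e' mulrC.
  apply: norm_I_le => //.
    by apply: measurable_funB; [exact: mc|apply: measurable_funM => //; exact: mq].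
  move=> s sin; have /andP[q0 q1] := hq _ hk _ sin.
  move: sin; rewrite in_itv/= => /andP[s0 s1].
  have -> : q k s * H s - H (t_ T N k) * q k s = q k s * (H s - H (t_ T N k)) by ring.
  rewrite normrM (ger0_norm q0) -[leRHS]mul1r ler_pM// distrC.
  apply: le_trans (abs_var hA _ (ltW s1) p3) _; first lra.
  rewrite lerD2l lerN2 /Vh (@I_split _ 0 (t_ T N k.-1) s); [|by []|exact: ltW|by apply: itg_sub il => //; lra].
  by rewrite lerDl; apply: I_ge0 => x _.
move=> k k0 kN.
have hk : (0 < k <= N)%N by rewrite k0 ltnW.
have hk1 : (0 < k.+1 <= N)%N by [].
have e1 := err _ hk; have e2 := err _ hk1.
have [p1 p2 p3 p4] := cell_pos T0 N0 hk; have [r1 r2 r3 r4] := cell_pos T0 N0 hk1.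
have e3 : `|H (t_ T N k.+1) - H (t_ T N k)| <= Vh k.+1 - Vh k.
  by apply: abs_var hA _ _ _.
have e4 : `|mass * tau_ T N * (H (t_ T N k.+1) - H (t_ T N k))| <= tau_ T N * (Vh k.+1 - Vh k).
  rewrite normrM (ger0_norm (mulr_ge0 m0 (ltW t0))); apply: ler_pM => //.
    exact: mulr_ge0 m0 (ltW t0).
  exact: ler_piMl (ltW t0) m1.
have -> : c k.+1 - c k = (c k.+1 - mass * tau_ T N * H (t_ T N k.+1))
  - (c k - mass * tau_ T N * H (t_ T N k))
  + mass * tau_ T N * (H (t_ T N k.+1) - H (t_ T N k)) by ring.
apply: le_trans (ler_normD _ _) _; apply: le_trans (lerD (ler_normB _ _) (lexx _)) _.
apply: le_trans (lerD (lerD e2 e1) e4) _.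
by rewrite /=; apply: eq_ler; ring.
Qed.

Lemma var_total T N h' : 0 < T -> L2 0 T h' -> forall k, (0 < N)%N -> (k <= N)%N ->
  0 <= I 0 (t_ T N k) (fun s => `|h' s|) <= Num.sqrt T * nrm 0 T h'.
Proof.
move=> T0 l k N0 kN; apply/andP; split; first by apply: I_ge0 => s _.
have := L2_I_norm (ltW T0) l; rewrite subr0; apply: le_trans.
by apply: I_sub_le => //; [exact: t_ge0|exact: t_le|exact/itg_norm/L2_itg].
Qed.

Local Notation interpolant T N A B k t :=
  ((t \in `]t_ T N k.-1, t_ T N k])%:R * (ramp T N k t * (A k - B k) + B k)).

(** Inside its cell the interpolant is [A k * ramp + B k * (1 - ramp)] and elsewhere the indicator
    removes it, so time enters only through two numbers per cell. [A] and [B] are kept independent;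
    they become $\lambda_k$ and $\lambda_{k-1}$. *)
Lemma pairing_split T N (A B : nat -> R) h : 0 < T -> (0 < N)%N -> itg 0 T h ->
  I 0 T (fun t => (\sum_(1 <= k < N.+1) interpolant T N A B k t) * h t) =
  \sum_(1 <= k < N.+1) (A k * cell T N k (fun t => ramp T N k t * h t) +
     B k * cell T N k (fun t => (1 - ramp T N k t) * h t)).
Proof.
move=> T0 N0 ih; have t0 := tau_gt0 T0 N0.
transitivity (I 0 T (fun t => \sum_(1 <= k < N.+1) interpolant T N A B k t * h t)).
  by apply: eq_I => t _; rewrite mulr_suml.
rewrite [RHS]big_seq.
(* Outside its cell the ramp leaves [0, 1]; a crude bound on ]0, T[ is enough for integrability. *)
have bd k : exists2 K, 0 <= K & forall t, t \in `]0, T[ ->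
    `|interpolant T N A B k t| <= K.
  exists (((T + `|t_ T N k.-1|) / tau_ T N) * `|A k - B k| + `|B k|) => [|t].
    by rewrite addr_ge0// mulr_ge0// divr_ge0 ?(ltW t0)// addr_ge0// ltW.
  rewrite in_itv/= => /andP[tt0 tT].
  rewrite normrM; apply: (@le_trans _ _ (1 * `|ramp T N k t * (A k - B k) + B k|)).
    by apply: ler_wpM2r => //; case: (_ \in _); rewrite ?normr1 ?normr0.
  rewrite mul1r; apply: le_trans (ler_normD _ _) _; rewrite lerD2r normrM ler_wpM2r//.
  rewrite /ramp normrM normfV (gtr0_norm t0) ler_pM2r ?invr_gt0//.
  by apply: le_trans (ler_normB _ _) _; rewrite lerD2r gtr0_norm// ltW.
have mm k : measurable_fun `]0, T[ (fun t => interpolant T N A B k t : R).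
  apply: measurable_funM.
    rewrite (_ : (fun t => _) = (fun t => \1_(`]t_ T N k.-1, t_ T N k]%classic : set R) t)); last first.
      by apply/funext => t; rewrite indicE; congr (_%:R); congr nat_of_bool;
        apply/idP/idP; rewrite inE.
    by apply: measurable_indic; exact: measurable_itv.
  by apply: measurable_funD => //; apply: measurable_funM => //; exact: ramp_meas.
have ik k : itg 0 T (fun t => interpolant T N A B k t * h t).
  have [K K0 hK] := bd k.
  apply: eq_itg (@itg_bmul _ _ _ K _ _ (mm k) hK ih) => t _; exact: mulrC.
transitivity (\sum_(k <- index_iota 1 N.+1 | k \in index_iota 1 N.+1)
   I 0 T (fun t => interpolant T N A B k t * h t)).
  rewrite -I_sum; last by move=> k _; exact: ik.
  by apply: eq_I => t _; rewrite [LHS]big_seq.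
apply: eq_bigr => k; rewrite mem_index_iota => hk; have [p1 p2 p3 p4] := cell_pos T0 N0 hk; have /andP[k0 _] := hk.
rewrite (@I_split _ 0 (t_ T N k.-1) T)//; last exact: le_trans p3.
rewrite (@I_split _ (t_ T N k.-1) (t_ T N k) T)//; last by apply: itg_sub (ik k).
rewrite (I_eq0 (x := 0)); last first.
  by move=> t; rewrite !in_itv/= => /andP[_ tt]; rewrite ltNge (ltW tt)/= !mul0r.
rewrite (I_eq0 (x := t_ T N k)); last first.
  by move=> t; rewrite !in_itv/= => /andP[tt _]; rewrite [t <= _]leNgt tt andbF !mul0r.
rewrite add0r addr0.
have ihk : itg (t_ T N k.-1) (t_ T N k) h by apply: itg_sub ih.
have i1 : itg (t_ T N k.-1) (t_ T N k) (fun t => ramp T N k t * h t).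
  apply: eq_itg (@itg_bmul _ _ _ 1 _ _ (@ramp_meas _ _ _ _ _) _ ihk) => [t _|t tin]; first exact: mulrC.
  by have /andP[q0 q1] := ramp_in T0 N0 k0 tin; rewrite ger0_norm.
have i2 : itg (t_ T N k.-1) (t_ T N k) (fun t => (1 - ramp T N k t) * h t).
  by apply: eq_itg (itgB ihk i1) => t _; ring.
rewrite /cell -!IZ// -ID; [|exact: itgZ|exact: itgZ].
apply: eq_I => t; rewrite !in_itv/= => /andP[a1 a2].
by rewrite a1 (ltW a2) mul1r; ring.
Qed.

End TimeWeights.

(** * Gram matrices, tensor products and functionals on the completion *)

Section Tensor.
Context {R : realType}.
Implicit Types (a c L T M : R) (g h w : R -> R) (m n k : nat).
Implicit Types (u v : formal_tensor R).

Lemma sobolev_ipE m a g h :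
  sobolev_ip m a g h = \sum_(n < m.+1) I 0 a (fun x => wD a n g x * wD a n h x).
Proof. by []. Qed.

#[local] Opaque I wD sobolev_ip.

Lemma weak_zero n a : weak_derivative a n (fun=> 0) (fun=> 0).
Proof.
split=> [|phi _]; first exact: L2_cst.
change (I 0 a (fun x => 0 * derive1n n phi x) = (-1) ^+ n * I 0 a (fun x => 0 * phi x)).
by rewrite !I_eq0 ?mulr0// => x _; rewrite mul0r.
Qed.

Lemma sob0 m a : sobolev m a (fun=> 0).
Proof. by split => [|n _]; [exact: L2_cst|exists (fun=> 0); exact: weak_zero]. Qed.

Section LinComb.
Context {X : eqType}.
Implicit Types (F : X -> R -> R) (s r : seq X).

(** Indexed by a sequence over an [eqType], because formal tensors are sequences of pairs of
    functions and the Sobolev hypotheses are known only for their members. *)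
Definition lincomb F (al : X -> R) s : R -> R := fun x => \sum_(j <- s) al j * F j x.

Lemma lincomb_cons F al j s :
  lincomb F al (j :: s) = fun x => al j * F j x + lincomb F al s x.
Proof. by apply/funext => x; rewrite /lincomb big_cons. Qed.

Lemma lincomb_nil F al : lincomb F al [::] = fun=> 0.
Proof. by apply/funext => x; rewrite /lincomb big_nil. Qed.

Lemma sob_lincomb m a F al s : (forall j, j \in s -> sobolev m a (F j)) ->
  sobolev m a (lincomb F al s).
Proof.
elim: s => [|j s IH] h; first by rewrite lincomb_nil; exact: sob0.
rewrite lincomb_cons; apply: sob_lin; first by apply: h; rewrite mem_head.
by apply: IH => i si; apply: h; rewrite inE si orbT.
Qed.

Lemma wD_lincomb m n a F al s : (n <= m)%N -> (forall j, j \in s -> sobolev m a (F j)) ->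
  aeq 0 a (wD a n (lincomb F al s)) (lincomb (fun j => wD a n (F j)) al s).
Proof.
move=> nm; elim: s => [|j s IH] h.
  by rewrite !lincomb_nil; apply/wD_aeq/weak_zero.
have hs i : i \in s -> sobolev m a (F i) by move=> si; apply: h; rewrite inE si orbT.
rewrite !lincomb_cons.
have := @wD_lin _ m n a (al j) _ _ nm (h j (mem_head _ _)) (@sob_lincomb m a F al s hs).
by move=> e; apply: ae_leb_imp2 e (IH hs) => x e1 e2 xa; rewrite e1// e2.
Qed.

Lemma L2_lincomb a F al s : (forall j, j \in s -> L2 0 a (F j)) -> L2 0 a (lincomb F al s).
Proof.
move=> h; apply: eq_L2 (_ : L2 0 a (fun x => \sum_(j <- s | j \in s) al j * F j x)) => [x _|].
  by rewrite /lincomb big_seq.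
by apply: L2_sum => j sj; apply: L2Z; exact: h.
Qed.

Lemma I_lincomb2 a F H al be s r : (forall j, j \in s -> L2 0 a (F j)) ->
  (forall j, j \in r -> L2 0 a (H j)) ->
  I 0 a (fun x => lincomb F al s x * lincomb H be r x) =
  \sum_(i <- s) \sum_(j <- r) al i * be j * I 0 a (fun x => F i x * H j x).
Proof.
move=> hF hH; rewrite big_seq.
transitivity (I 0 a (fun x => \sum_(i <- s | i \in s) \sum_(j <- r | j \in r)
   al i * be j * (F i x * H j x))).
  apply: eq_I => x _; rewrite /lincomb mulr_suml big_seq; apply: eq_bigr => i _.
  by rewrite mulr_sumr big_seq; apply: eq_bigr => j _; ring.
rewrite I_sum; last first.
  by move=> i si; apply: itg_sum => j rj; apply: itgZ; apply: L2_mul; [exact: hF|exact: hH].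
apply: eq_bigr => i si; rewrite I_sum; last first.
  by move=> j rj; apply: itgZ; apply: L2_mul; [exact: hF|exact: hH].
rewrite [RHS]big_seq; apply: eq_bigr => j rj; rewrite IZ//.
by apply: L2_mul; [exact: hF|exact: hH].
Qed.

Lemma ip_lincomb2 m a F H al be s r : (forall j, j \in s -> sobolev m a (F j)) ->
  (forall j, j \in r -> sobolev m a (H j)) ->
  sobolev_ip m a (lincomb F al s) (lincomb H be r) =
  \sum_(i <- s) \sum_(j <- r) al i * be j * sobolev_ip m a (F i) (H j).
Proof.
move=> hF hH; rewrite sobolev_ipE.
transitivity (\sum_(n < m.+1) \sum_(i <- s) \sum_(j <- r)
   al i * be j * I 0 a (fun x => wD a n (F i) x * wD a n (H j) x)).
  apply: eq_bigr => n _; have nm : (n <= m)%N by rewrite -ltnS.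
  have lF j : j \in s -> L2 0 a (wD a n (F j)) by move=> /hF h; exact: wD_meas h nm.
  have lH j : j \in r -> L2 0 a (wD a n (H j)) by move=> /hH h; exact: wD_meas h nm.
  rewrite -(@I_lincomb2 a (fun j => wD a n (F j)) (fun j => wD a n (H j)))//.
  have l1 := wD_meas (@sob_lincomb m a F al s hF) nm.
  have l2 := wD_meas (@sob_lincomb m a H be r hH) nm.
  apply: aeq_I.
  - exact: itg_meas (L2_mul l1 l2).
  - exact: itg_meas (L2_mul (L2_lincomb _ lF) (L2_lincomb _ lH)).
  - apply: ae_leb_imp2 (@wD_lincomb m n a F al s nm hF) (@wD_lincomb m n a H be r nm hH).
    by move=> x e1 e2 xa; rewrite e1// e2.
rewrite exchange_big; apply: eq_bigr => i _; rewrite exchange_big; apply: eq_bigr => j _.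
by rewrite -mulr_sumr sobolev_ipE.
Qed.

Lemma ip_ge0 m a g : 0 <= sobolev_ip m a g g.
Proof.
rewrite sobolev_ipE; apply: sumr_ge0 => n _; apply: I_ge0 => s _.
by rewrite -expr2 sqr_ge0.
Qed.

(** Under the integral the Gram entries are products $D^nF_i(x)\,D^nF_j(x)$, so the positivity of
    [Mx] applies at each [x] with coefficients [al i] $= D^nF_i(x)$; nothing has to be
    diagonalized. *)
Lemma gram_contract m a F (Mx : X -> X -> R) s : (forall j, j \in s -> sobolev m a (F j)) ->
  (forall al : X -> R, 0 <= \sum_(i <- s) \sum_(j <- s) al i * al j * Mx i j) ->
  0 <= \sum_(i <- s) \sum_(j <- s) sobolev_ip m a (F i) (F j) * Mx i j.
Proof.
move=> hF hM.
have -> : \sum_(i <- s) \sum_(j <- s) sobolev_ip m a (F i) (F j) * Mx i j =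
   \sum_(n < m.+1) I 0 a (fun x => \sum_(i <- s) \sum_(j <- s) wD a n (F i) x * wD a n (F j) x * Mx i j).
  transitivity (\sum_(n < m.+1) \sum_(i <- s) \sum_(j <- s)
     I 0 a (fun x => wD a n (F i) x * wD a n (F j) x) * Mx i j).
    rewrite [RHS]exchange_big; apply: eq_bigr => i _; rewrite [RHS]exchange_big; apply: eq_bigr => j _.
    by rewrite sobolev_ipE mulr_suml.
  apply: eq_bigr => n _; have nm : (n <= m)%N by rewrite -ltnS.
  have lF j : j \in s -> L2 0 a (wD a n (F j)) by move=> /hF h; exact: wD_meas h nm.
  transitivity (I 0 a (fun x => \sum_(i <- s | i \in s) \sum_(j <- s | j \in s)
      Mx i j * (wD a n (F i) x * wD a n (F j) x))); last first.
    apply: eq_I => x _; rewrite -big_seq; apply: eq_bigr => i _; rewrite -big_seq.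
    by apply: eq_bigr => j _; rewrite mulrC.
  have it i j : i \in s -> j \in s -> itg 0 a (fun x => Mx i j * (wD a n (F i) x * wD a n (F j) x)).
    by move=> si sj; apply: itgZ; apply: L2_mul; exact: lF.
  rewrite I_sum; last by move=> i si; apply: itg_sum => j sj; exact: it.
  rewrite big_seq; apply: eq_bigr => i si; rewrite I_sum; last by move=> j sj; exact: it.
  rewrite big_seq; apply: eq_bigr => j sj; rewrite mulrC IZ//.
  by apply: L2_mul; exact: lF.
apply: sumr_ge0 => n _; apply: I_ge0 => x _; exact: hM.
Qed.

End LinComb.

Lemma is_tensor_cat mL mT L T u v : is_tensor mL mT L T u -> is_tensor mL mT L T v ->
  is_tensor mL mT L T (u ++ v).
Proof. by move=> hu hv x; rewrite mem_cat => /orP[/hu|/hv]. Qed.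

Lemma rep1_end0 a g : 0 < a -> sobolev0 1 a g ->
  exists w, [/\ rep1 a g w (wD a 1 g) & w a = 0].
Proof.
move=> a0 [sg he]; have [w hw] := sob1_rep a0 sg.
exists w; split => //; have [_ _ hA] := hw.
exact: (proj1 (end_valueP _ a0 (rep1_wD0 hw) hA) (he 0%N isT)).
Qed.

Lemma sobolev0_lin m a c g h : 0 < a -> (m <= 1)%N -> sobolev0 m a g -> sobolev0 m a h ->
  sobolev0 m a (fun x => c * g x + h x).
Proof.
move=> a0 m1 hg hh; split; first exact: sob_lin (proj1 hg) (proj1 hh).
move=> n; case: m m1 hg hh => [|[|//]] // _ hg hh; case: n => // _.
have [w [hw w0]] := rep1_end0 a0 hg; have [w' [hw' w0']] := rep1_end0 a0 hh.
have hl := rep1_lin c hw hw'; have [_ _ hA] := hl.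
apply: (proj2 (end_valueP _ a0 (rep1_wD0 hl) hA)).
by rewrite w0 w0'; ring.
Qed.

Lemma sobolev0_0 m a : 0 < a -> (m <= 1)%N -> sobolev0 m a (fun=> 0).
Proof.
move=> a0 m1; split; first exact: sob0.
move=> n; case: m m1 => [|[|//]] // _; case: n => // _.
have hl : rep1 a (fun=> 0) (fun=> 0) (fun=> 0).
  by split => //; [exact: aeqW|exact: AC_cst].
have [_ _ hA] := hl.
exact: (proj2 (end_valueP _ a0 (rep1_wD0 hl) hA)).
Qed.

Lemma sobolev0_lin0 (k : (R -> R) -> R) m a : 0 < a -> (m <= 1)%N ->
  (forall c g h, sobolev0 m a g -> sobolev0 m a h -> k (fun x => c * g x + h x) = c * k g + k h) ->
  k (fun=> 0) = 0.
Proof.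
move=> a0 mm hk; have s0 := sobolev0_0 a0 mm; have := hk 1 _ _ s0 s0.
rewrite (_ : (fun x => 1 * 0 + 0) = (fun=> 0)); last by apply/funext => x; rewrite mulr0 addr0.
by rewrite mul1r => e; lra.
Qed.

Lemma sobolev0_scale m a c g : 0 < a -> (m <= 1)%N -> sobolev0 m a g ->
  sobolev0 m a (fun x => c * g x).
Proof.
move=> a0 m1 hg; have := sobolev0_lin c a0 m1 hg (@sobolev0_0 m a a0 m1).
by rewrite (_ : (fun x => _ + 0) = (fun x => c * g x))//; apply/funext => x; rewrite addr0.
Qed.

Lemma sobolev0_lincomb (X : eqType) m a (F : X -> R -> R) al (s : seq X) : 0 < a -> (m <= 1)%N ->
  (forall j, j \in s -> sobolev0 m a (F j)) -> sobolev0 m a (lincomb F al s).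
Proof.
move=> a0 m1; elim: s => [|j s IH] h; first by rewrite lincomb_nil; exact: sobolev0_0.
rewrite lincomb_cons; apply: sobolev0_lin => //; first by apply: h; rewrite mem_head.
by apply: IH => i si; apply: h; rewrite inE si orbT.
Qed.

Lemma is_tensor_scale mL mT L T c u : 0 < L -> (mL <= 1)%N -> is_tensor mL mT L T u ->
  is_tensor mL mT L T (tensor_scale c u).
Proof.
move=> L0 m1 h x /mapP[y yu ->] /=; have [h1 h2] := h _ yu; split => //.
exact: sobolev0_scale.
Qed.

Lemma ip_scale m a c g h : sobolev m a g -> sobolev m a h ->
  sobolev_ip m a (fun x => c * g x) h = c * sobolev_ip m a g h.
Proof.
move=> hg hh.
have e (k : R) w : lincomb (fun=> w) (fun=> k) [:: tt] = (fun x => k * w x).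
  by apply/funext => x; rewrite lincomb_cons lincomb_nil addr0.
have := @ip_lincomb2 unit m a (fun=> g) (fun=> h) (fun=> c) (fun=> 1) [:: tt] [:: tt]
  (fun _ _ => hg) (fun _ _ => hh).
rewrite !e !big_cons !big_nil !addr0 mulr1 => <-.
by congr (sobolev_ip _ _ _ _); apply/funext => x; rewrite mul1r.
Qed.

Lemma ip_sym m a g h : sobolev_ip m a g h = sobolev_ip m a h g.
Proof. by rewrite !sobolev_ipE; apply: eq_bigr => n _; apply: eq_I => s _; rewrite mulrC. Qed.

Lemma tensor_ip_sym mL mT L T u v : tensor_ip mL mT L T u v = tensor_ip mL mT L T v u.
Proof.
rewrite /tensor_ip exchange_big; apply: eq_bigr => x _; apply: eq_bigr => y _.
exact: (f_equal2 *%R (ip_sym mL L y.1 x.1) (ip_sym mT T y.2 x.2)).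
Qed.

Lemma tensor_ip_cat mL mT L T u v (w : formal_tensor R) : tensor_ip mL mT L T (u ++ v) w =
  tensor_ip mL mT L T u w + tensor_ip mL mT L T v w.
Proof. by rewrite /tensor_ip big_cat. Qed.

Lemma tensor_ip_scale mL mT L T c u v : is_tensor mL mT L T u -> is_tensor mL mT L T v ->
  tensor_ip mL mT L T (tensor_scale c u) v = c * tensor_ip mL mT L T u v.
Proof.
move=> hu hv; rewrite /tensor_ip big_map mulr_sumr big_seq [RHS]big_seq.
apply: eq_bigr => x xu; rewrite mulr_sumr big_seq [RHS]big_seq; apply: eq_bigr => y yv /=.
rewrite ip_scale ?mulrA//; first by have [[]] := hu _ xu.
by have [[]] := hv _ yv.
Qed.

Lemma tensor_ip_ge0 mL mT L T u : is_tensor mL mT L T u -> 0 <= tensor_ip mL mT L T u u.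
Proof.
move=> hu; apply: (@gram_contract _ mL L (fun x : (R -> R) * (R -> R) => x.1)
  (fun x y => sobolev_ip mT T x.2 y.2)).
  by move=> x /hu[[]].
move=> al; rewrite -(@ip_lincomb2 _ mT T (fun x : (R -> R) * (R -> R) => x.2) (fun x => x.2)).
- exact: ip_ge0.
- by move=> x /hu[_ []].
- by move=> x /hu[_ []].
Qed.

(** The sum is [l gs], where [gs] combines the first factors with coefficients [mu x.2]. Its squared
    norm is the contraction of a Gram matrix with $\mu\otimes\mu$, and boundedness of [mu] says
    exactly that $C^2\langle\cdot,\cdot\rangle - \mu\otimes\mu$ is nonnegative. *)
Lemma rank_one_bound mL mT L T (l mu : (R -> R) -> R) (A C : R) u :
  0 < L -> 0 < T -> (mL <= 1)%N -> (mT <= 1)%N -> 0 <= A -> 0 <= C ->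
  (forall c g h, sobolev0 mL L g -> sobolev0 mL L h -> l (fun x => c * g x + h x) = c * l g + l h) ->
  (forall g, sobolev0 mL L g -> `|l g| <= A * sobolev_norm mL L g) ->
  (forall c g h, sobolev0 mT T g -> sobolev0 mT T h -> mu (fun x => c * g x + h x) = c * mu g + mu h) ->
  (forall g, sobolev0 mT T g -> `|mu g| <= C * sobolev_norm mT T g) ->
  is_tensor mL mT L T u ->
  `|\sum_(x <- u) l x.1 * mu x.2| <= A * C * tensor_norm mL mT L T u.
Proof.
move=> L0 T0 m1 m2 A0 C0 lL lb mL' mb hu.
have lc (k : (R -> R) -> R) m a (F : (R -> R) * (R -> R) -> R -> R) al s : 0 < a -> (m <= 1)%N ->
    (forall c g h, sobolev0 m a g -> sobolev0 m a h -> k (fun x => c * g x + h x) = c * k g + k h) ->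
    (forall j, j \in s -> sobolev0 m a (F j)) ->
    k (lincomb F al s) = \sum_(j <- s) al j * k (F j).
  move=> a0 mm hk; elim: s => [|j s IH] h.
    by rewrite lincomb_nil big_nil (sobolev0_lin0 a0 mm hk).
  rewrite lincomb_cons big_cons hk ?IH//.
  - by move=> i si; apply: h; rewrite inE si orbT.
  - by apply: h; rewrite mem_head.
  - by apply: sobolev0_lincomb => // i si; apply: h; rewrite inE si orbT.
have h1 x : x \in u -> sobolev0 mL L x.1 by move=> /hu[].
have h2 x : x \in u -> sobolev0 mT T x.2 by move=> /hu[].
pose gs := lincomb (fun x : (R -> R) * (R -> R) => x.1) (fun x => mu x.2) u.
have sgs : sobolev0 mL L gs by exact: sobolev0_lincomb.
have -> : \sum_(x <- u) l x.1 * mu x.2 = l gs.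
  rewrite (lc l mL L)//; by apply: eq_bigr => x _; rewrite mulrC.
apply: le_trans (lb _ sgs) _; rewrite -mulrA ler_wpM2l//.
rewrite -[C](ger0_norm C0) -sqrtr_sqr /tensor_norm -sqrtrM ?sqr_ge0// ler_sqrt; last first.
  by rewrite mulr_ge0 ?sqr_ge0// tensor_ip_ge0.
rewrite /gs ip_lincomb2; [|by move=> x /h1[]|by move=> x /h1[]].
rewrite -subr_ge0 /tensor_ip mulr_sumr -sumrB.
rewrite (eq_bigr (fun x => \sum_(y <- u) sobolev_ip mL L x.1 y.1 *
   (C ^+ 2 * sobolev_ip mT T x.2 y.2 - mu x.2 * mu y.2))); last first.
  by move=> x _; rewrite mulr_sumr -sumrB; apply: eq_bigr => y _; ring.
apply: (@gram_contract _ mL L (fun x : (R -> R) * (R -> R) => x.1)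
  (fun x y => C ^+ 2 * sobolev_ip mT T x.2 y.2 - mu x.2 * mu y.2)).
  by move=> x /h1[].
move=> al.
have [hs [shs e e2]] : exists hs, [/\ sobolev0 mT T hs, mu hs = \sum_(j <- u) al j * mu j.2 &
    sobolev_ip mT T hs hs = \sum_(i <- u) \sum_(j <- u) al i * al j * sobolev_ip mT T i.2 j.2].
  exists (lincomb (fun x : (R -> R) * (R -> R) => x.2) al u); split.
  - exact: sobolev0_lincomb.
  - exact: (lc mu mT T).
  - by apply: ip_lincomb2 => x /h2[].
have -> : \sum_(i <- u) \sum_(j <- u) al i * al j *
    (C ^+ 2 * sobolev_ip mT T i.2 j.2 - mu i.2 * mu j.2) =
    C ^+ 2 * sobolev_ip mT T hs hs - mu hs ^+ 2.
  transitivity (C ^+ 2 * (\sum_(i <- u) \sum_(j <- u) al i * al j * sobolev_ip mT T i.2 j.2)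
     - (\sum_(j <- u) al j * mu j.2) * (\sum_(j <- u) al j * mu j.2)); last first.
    by rewrite -e2 -e.
  rewrite mulr_suml mulr_sumr -sumrB; apply: eq_bigr => x _; rewrite mulr_sumr mulr_sumr -sumrB.
  by apply: eq_bigr => y _; ring.
have := mb _ shs; rewrite /sobolev_norm => hb.
have ip0 := ip_ge0 mT T hs.
rewrite subr_ge0 -(sqr_sqrtr ip0) -exprMn -real_normK ?num_real//.
by rewrite ler_sqr// nnegrE mulr_ge0// sqrtr_ge0.
Qed.

(** Follows from Cauchy-Schwarz for the tensor form, which comes from its nonnegativity along
    [u + c v]. It makes the norms along a Cauchy sequence converge, so that [completion_norm] is a
    genuine limit. *)
Lemma tensor_norm_dist mL mT L T u v : 0 < L -> (mL <= 1)%N ->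
  is_tensor mL mT L T u -> is_tensor mL mT L T v ->
  `|tensor_norm mL mT L T u - tensor_norm mL mT L T v| <=
  tensor_norm mL mT L T (u ++ tensor_scale (-1) v).
Proof.
move=> L0 m1 hu hv.
have E c : tensor_ip mL mT L T (u ++ tensor_scale c v) (u ++ tensor_scale c v) =
   tensor_ip mL mT L T u u + 2 * c * tensor_ip mL mT L T u v + c ^+ 2 * tensor_ip mL mT L T v v.
  have hs := @is_tensor_scale _ _ _ _ c _ L0 m1 hv.
  rewrite tensor_ip_cat tensor_ip_sym tensor_ip_cat tensor_ip_scale//.
  rewrite [tensor_ip _ _ _ _ (tensor_scale c v) _]tensor_ip_sym tensor_ip_cat.
  rewrite [tensor_ip _ _ _ _ u (tensor_scale c v)]tensor_ip_sym !tensor_ip_scale//.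
  rewrite [tensor_ip _ _ _ _ v (tensor_scale c v)]tensor_ip_sym tensor_ip_scale//.
  by rewrite [tensor_ip _ _ _ _ v u]tensor_ip_sym; ring.
have A0 := tensor_ip_ge0 hu; have C0 := tensor_ip_ge0 hv.
have cs : tensor_ip mL mT L T u v ^+ 2 <= tensor_ip mL mT L T u u * tensor_ip mL mT L T v v.
  apply: quadratic_disc => t; rewrite -E; apply: tensor_ip_ge0; apply: is_tensor_cat => //.
  exact: is_tensor_scale.
rewrite /tensor_norm E -sqrtr_sqr ler_sqrt; last first.
  rewrite -E; apply: tensor_ip_ge0; apply: is_tensor_cat => //; exact: is_tensor_scale.
have csr : tensor_ip mL mT L T u v <= Num.sqrt (tensor_ip mL mT L T u u) * Num.sqrt (tensor_ip mL mT L T v v).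
  apply: le_trans (ler_norm _) _; rewrite -sqrtr_sqr -sqrtrM// ler_sqrt//.
  exact: mulr_ge0.
rewrite sqrrB !sqr_sqrtr//.
move: csr; set B := tensor_ip _ _ _ _ u v; set X := Num.sqrt _ * _; clear; move=> h.
by rewrite mulr2n; lra.
Qed.

(** [limn] is a genuine limit when the sums converge, as they do along Cauchy sequences for a
    bounded [B]; the dual constrains a functional only there. *)
Definition extension (B : (R -> R) -> (R -> R) -> R) (u : nat -> formal_tensor R) : R :=
  limn (fun n => \sum_(x <- u n) B x.1 x.2).

(** Extension by continuity: the bound makes the values along a Cauchy sequence Cauchy. Additivity
    is concatenation of formal sums, and homogeneity is asked in the first factor because
    [tensor_scale] acts there. *)
Lemma in_tensor_dual_bounded mL mT L T (B : (R -> R) -> (R -> R) -> R) M : 0 < L ->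
  (mL <= 1)%N ->
  (forall c g h, sobolev0 mL L g -> sobolev0 mT T h -> B (fun s => c * g s) h = c * B g h) ->
  (forall u, is_tensor mL mT L T u -> `|\sum_(x <- u) B x.1 x.2| <= M * tensor_norm mL mT L T u) ->
  in_tensor_dual mL mT L T B.
Proof.
move=> L0 m1 hs hb; exists (extension B).
pose La u := \sum_(x <- u) B x.1 x.2.
have La_cat u v : La (u ++ v) = La u + La v by rewrite /La big_cat.
have La_scale c u : is_tensor mL mT L T u -> La (tensor_scale c u) = c * La u.
  move=> hu; rewrite /La big_map mulr_sumr big_seq [RHS]big_seq; apply: eq_bigr => x /hu[h1 h2].
  exact: hs.
have M0 (u : nat -> formal_tensor R) : tensor_completion mL mT L T u -> forall e, 0 < e -> exists n0 : nat, forall p q : nat,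
    (n0 <= p)%N -> (n0 <= q)%N -> `|La (u p) - La (u q)| <= e.
  move=> [ht hc] e e0; have M1 : 0 < `|M| + 1 by have := normr_ge0 M; lra.
  have [n0 hn] := hc (e / (`|M| + 1)) (divr_gt0 e0 M1).
  exists n0 => p q hp hq; have := hn p q hp hq => hd.
  have -> : La (u p) - La (u q) = La (u p ++ tensor_scale (-1) (u q)).
    by rewrite La_cat La_scale// mulN1r.
  have ht' : is_tensor mL mT L T (u p ++ tensor_scale (-1) (u q)).
    by apply: is_tensor_cat => //; exact: is_tensor_scale.
  apply: le_trans (hb _ ht') _.
  apply: (@le_trans _ _ ((`|M| + 1) * tensor_norm mL mT L T (u p ++ tensor_scale (-1) (u q)))).
    by apply: ler_wpM2r; [exact: sqrtr_ge0|have := ler_norm M; lra].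
  by rewrite mulrC -ler_pdivlMr// ltW.
have cvgC (w : nat -> R) : (forall e : R, 0 < e -> exists n0 : nat, forall p q : nat,
    (n0 <= p)%N -> (n0 <= q)%N -> `|w p - w q| <= e) -> cvgn w.
  move=> hw; apply: cauchy_cvg; apply: cauchy_exP => e e0.
  have e2 : 0 < e / 2 by lra.
  have [n0 hn] := hw _ e2.
  exists (w n0), n0 => // p /= hp; rewrite /ball/=.
  by apply: le_lt_trans (hn n0 p (leqnn _) hp) _; lra.
have cL (u : nat -> formal_tensor R) : tensor_completion mL mT L T u -> cvgn (fun n => La (u n)).
  by move=> hu; apply: cvgC; exact: M0.
have cN (u : nat -> formal_tensor R) : tensor_completion mL mT L T u -> cvgn (fun n => tensor_norm mL mT L T (u n)).
  move=> [ht hc]; apply: cvgC => e e0; have [n0 hn] := hc _ e0; exists n0 => p q hp hq.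
  by apply: le_trans (tensor_norm_dist L0 m1 (ht p) (ht q)) (ltW (hn _ _ hp hq)).
split; last first.
  move=> g h hg hh; rewrite /extension (_ : (fun n => _) = (fun=> B g h)) ?lim_cst//.
  by apply/funext => n; rewrite /elementary_tensor big_seq1.
split.
- move=> u v hu hv; rewrite /extension (_ : (fun n => _) = (fun n => La (u n) + La (v n))).
    exact: limD (cL _ hu) (cL _ hv).
  by apply/funext => n; exact: La_cat.
- move=> c u hu; rewrite /extension (_ : (fun n => _) = (fun n => c * La (u n))); last first.
    by apply/funext => n; apply: La_scale; case: hu.
  apply: cvg_lim => //; apply: cvgMr; exact: cL.
- exists `|M| => u hu; rewrite /extension /completion_norm.
  have c1 : `|La (u n)| @[n --> \oo] --> `|limn (fun n => La (u n))|.
    by apply: cvg_norm; exact: cL.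
  have c2 : `|M| * tensor_norm mL mT L T (u n) @[n --> \oo] -->
      `|M| * limn (fun n => tensor_norm mL mT L T (u n)).
    by apply: cvgMr; exact: cN.
  apply: ler_cvg_to c1 c2 _; apply: nearW => n.
  apply: le_trans (hb _ (proj1 hu n)) _.
  by apply: ler_wpM2r; [exact: sqrtr_ge0|exact: ler_norm].
Qed.

End Tensor.

(** * Weighted sums of multipliers *)

Section TimeSums.
Context {R : realType}.
Implicit Types (T omega tau eta gam : R) (h H q : R -> R) (N k j : nat).

#[local] Opaque I wD sobolev_ip.

(** The 4 counts the boundary term once and the variation of the weights three times. Every term
    carries the [t ^+ 2] that cancels the negative power; the last one keeps [jR * t], an elapsed
    time. *)
Lemma weighted_alg (t w A0 B0 gam eta jR dV : R) : 0 < t -> 0 <= w -> 0 <= A0 -> 0 <= gam ->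
  dV <= 3 * (t * eta) ->
  2 * w * (t ^+ 2)^-1 * (t * eta * (A0 * t * gam) + A0 * t * gam * dV + jR * (t * eta * (B0 * t ^+ 2 * gam)))
  <= 2 * w * (4 * A0 + (jR * t) * B0) * gam * eta.
Proof.
move=> t0 w0 A0' g0 hV.
have -> : 2 * w * (4 * A0 + (jR * t) * B0) * gam * eta =
  2 * w * (t ^+ 2)^-1 * (t * eta * (A0 * t * gam) + A0 * t * gam * (3 * (t * eta)) +
    jR * (t * eta * (B0 * t ^+ 2 * gam))).
  by field; rewrite gt_eqF.
apply: ler_wpM2l; first by rewrite mulr_ge0 ?invr_ge0 ?sqr_ge0// mulr_ge0.
rewrite lerD2r lerD2l; apply: ler_wpM2l => //.
by rewrite mulr_ge0// mulr_ge0// ltW.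
Qed.

(** Abel summation treats the inertial part, and the remainder [rho] is summed directly. The number
    of steps enters only multiplied by [tau], and that product is at most [T]. *)
Lemma weighted_sum T omega (A0 B0 R0 : R) gam eta N (lam rho c V : nat -> R) (x : nat -> nat -> R) j :
  let tau := tau_ T N in
  0 < T -> (0 < N)%N -> 0 <= omega -> 0 <= A0 -> 0 <= B0 -> 0 <= R0 -> 0 <= gam -> 0 <= eta ->
  x 1%N 1%N = 0 ->
  (forall k, (k.+2 <= N)%N -> lam k.+2 = - (2 * omega * (tau ^+ 2)^-1 * (x k.+2 k.+1 - x k.+1 k.+1)) + rho k) ->
  (forall k, (k.+2 <= N)%N -> `|rho k| <= R0 * gam) ->
  (forall i k, (0 < i)%N -> (i <= N)%N -> (k <= N)%N -> `|x i k| <= A0 * tau * gam) ->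
  (forall k, (k.+2 <= N)%N -> `|x k.+2 k.+2 - x k.+2 k.+1| <= B0 * tau ^+ 2 * gam) ->
  (j.+2 <= N)%N ->
  (forall k, (k <= j)%N -> `|c k.+2| <= tau * eta) ->
  (forall k, (k < j)%N -> `|c k.+3 - c k.+2| <= V k.+3 - V k.+2) ->
  V j.+2 - V 2%N <= 3 * (tau * eta) ->
  `|\sum_(0 <= k < j.+1) lam k.+2 * c k.+2| <=
    (2 * omega * (4 * A0 + T * B0) + T * R0) * gam * eta.
Proof.
move=> tau T0 N0 w0 A00 B00 R00 g0 e0 x11 hl hr hx hxx jN hc hV hVt.
have t0 : 0 < tau := tau_gt0 T0 N0.
have te0 : 0 <= tau * eta by rewrite mulr_ge0// ltW.
have jt m : (m <= N)%N -> m%:R * tau <= T.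
  by move=> mN; exact: t_le.
have hk k : (k <= j)%N -> (k.+2 <= N)%N by move=> kj; apply: leq_trans jN.
have ab := @abel_bound R c V x (tau * eta) (A0 * tau * gam) (B0 * tau ^+ 2 * gam) j x11 te0.
have {}ab : `|\sum_(0 <= k < j.+1) c k.+2 * (x k.+2 k.+1 - x k.+1 k.+1)| <=
    tau * eta * (A0 * tau * gam) + A0 * tau * gam * (V j.+2 - V 2%N) + j%:R * (tau * eta * (B0 * tau ^+ 2 * gam)).
  apply: ab => //.
  - by rewrite mulr_ge0// mulr_ge0// ltW.
  - by move=> k kj; apply: hx => //; [exact: hk|exact/ltnW/hk].
  - by move=> k kj; apply: hx => //; exact: hk (ltnW kj).
  - by move=> k kj; apply: hxx; exact: hk (ltnW kj).
have -> : \sum_(0 <= k < j.+1) lam k.+2 * c k.+2 =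
   - (2 * omega * (tau ^+ 2)^-1 * \sum_(0 <= k < j.+1) c k.+2 * (x k.+2 k.+1 - x k.+1 k.+1))
   + \sum_(0 <= k < j.+1) rho k * c k.+2.
  rewrite mulr_sumr -sumrN -big_split/= big_nat [RHS]big_nat; apply: eq_bigr => k /andP[_ kj].
  by rewrite hl ?hk//; ring.
apply: le_trans (ler_normD _ _) _; rewrite normrN normrM ger0_norm; last first.
  by rewrite mulr_ge0 ?invr_ge0 ?sqr_ge0// mulr_ge0.
have h1 : `|\sum_(0 <= k < j.+1) rho k * c k.+2| <= T * R0 * gam * eta.
  apply: le_trans (ler_norm_sum _ _ _) _.
  apply: (@le_trans _ _ (\sum_(0 <= k < j.+1) (R0 * gam * (tau * eta)))).
    rewrite !big_nat; apply: ler_sum => k /andP[_ kj]; rewrite normrM ler_pM//; last exact: hc.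
    by apply: hr; exact: hk.
  rewrite sumr_const_nat subn0 -[leLHS]mulr_natl.
  have -> : j.+1%:R * (R0 * gam * (tau * eta)) = (j.+1%:R * tau) * (R0 * gam * eta) by ring.
  have -> : T * R0 * gam * eta = T * (R0 * gam * eta) by ring.
  by apply: ler_wpM2r; [rewrite !mulr_ge0|apply: jt; exact: ltnW].
have p0 : 0 <= 2 * omega * (tau ^+ 2)^-1 by rewrite mulr_ge0 ?invr_ge0 ?sqr_ge0// mulr_ge0.
apply: le_trans (lerD (ler_wpM2l p0 ab) h1) _.
apply: le_trans (lerD (weighted_alg B0 _ t0 w0 A00 g0 hVt) (lexx _)) _.
have -> : (2 * omega * (4 * A0 + T * B0) + T * R0) * gam * eta =
  2 * omega * (4 * A0 + T * B0) * gam * eta + T * R0 * gam * eta by ring.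
rewrite lerD2r; apply: ler_wpM2r => //; apply: ler_wpM2r => //; apply: ler_wpM2l; first by rewrite mulr_ge0.
by rewrite lerD2l; apply: ler_wpM2r => //; apply: jt; apply: leq_trans jN; exact: leqW.
Qed.

Definition alpha T N k h : R := cell T N k (fun t => ramp T N k t * h t).
Definition beta T N k h : R := cell T N k (fun t => (1 - ramp T N k t) * h t).

Lemma co_ramp_mass T N k : 0 < T -> (0 < N)%N -> (0 < k <= N)%N ->
  cell T N k (fun t => 1 - ramp T N k t) = tau_ T N / 2.
Proof.
move=> T0 N0 hk; have [p1 p2 p3 _] := cell_pos T0 N0 hk; have /andP[k0 kN] := hk.
have ir : itg (t_ T N k.-1) (t_ T N k) (ramp T N k).
  apply: (@itg_bdd _ _ _ 1); first exact: ramp_meas.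
  by move=> t /(ramp_in T0 N0 k0)/andP[a c]; rewrite ger0_norm.
have hm : I (t_ T N k.-1) (t_ T N k) (fun t => ramp T N k t) = tau_ T N / 2 by apply: ramp_mass.
rewrite /cell IB//; last exact: itg_cst.
rewrite I_cst// hm; move: k0; case: (k) => // m _; by rewrite t_S /=; field.
Qed.

Lemma cell_ext T N k q h H : 0 < T -> (0 < N)%N -> (0 < k <= N)%N ->
  cell_weight T N k q ->
  L2 0 T h -> L2 0 T H -> aeq 0 T h H ->
  cell T N k (fun t => q t * h t) = cell T N k (fun t => q t * H t).
Proof.
move=> T0 N0 hk [mq _] lh lH e; have [p1 p2 p3 _] := cell_pos T0 N0 hk.
have sub s : s \in `]t_ T N k.-1, t_ T N k[ -> s \in `]0, T[.
  by rewrite !in_itv/= => /andP[a c]; rewrite (le_lt_trans p1 a) (lt_le_trans c p3).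
have ms (u : R -> R) : L2 0 T u -> measurable_fun `](t_ T N k.-1), (t_ T N k)[ u.
  move=> [m _]; apply: measurable_funS m; first exact: measurable_itv.
  by move=> s /=; exact: sub.
apply: aeq_I.
- by apply: measurable_funM => //; exact: ms.
- by apply: measurable_funM => //; exact: ms.
- by apply: ae_leb_imp e => s es /sub si; rewrite es.
Qed.

Lemma cell_itg T N k q h : 0 < T -> (0 < N)%N -> (0 < k <= N)%N ->
  cell_weight T N k q ->
  L2 0 T h -> itg (t_ T N k.-1) (t_ T N k) (fun t => q t * h t).
Proof.
move=> T0 N0 hk [mq hq] lh; have [p1 p2 p3 _] := cell_pos T0 N0 hk.
have ih : itg (t_ T N k.-1) (t_ T N k) h by apply: itg_sub (L2_itg lh).
apply: eq_itg (@itg_bmul _ _ _ 1 _ _ mq _ ih) => [t _|t /hq/andP[a c]]; first exact: mulrC.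
by rewrite ger0_norm.
Qed.

Lemma cell_lin T N k q (c : R) h H : 0 < T -> (0 < N)%N -> (0 < k <= N)%N ->
  cell_weight T N k q ->
  L2 0 T h -> L2 0 T H ->
  cell T N k (fun t => q t * (c * h t + H t)) =
  c * cell T N k (fun t => q t * h t) + cell T N k (fun t => q t * H t).
Proof.
move=> T0 N0 hk hq lh lH; rewrite /cell.
have ih := cell_itg T0 N0 hk hq lh; have iH := cell_itg T0 N0 hk hq lH.
by rewrite -IZ// -ID//; [apply: eq_I => t _; ring|exact: itgZ].
Qed.

Lemma cell_bound T N k q h : 0 < T -> (0 < N)%N -> (0 < k <= N)%N ->
  cell_weight T N k q ->
  L2 0 T h -> `|cell T N k (fun t => q t * h t)| <= Num.sqrt T * nrm 0 T h.
Proof.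
move=> T0 N0 hk hq lh; have [p1 p2 p3 _] := cell_pos T0 N0 hk.
have iq := cell_itg T0 N0 hk hq lh.
have il := itg_norm (L2_itg lh).
apply: le_trans (norm_I iq) _.
have := L2_I_norm (ltW T0) lh; rewrite subr0; apply: le_trans.
apply: (@le_trans _ _ (I (t_ T N k.-1) (t_ T N k) (fun s => `|h s|))).
  apply: le_I; [exact: itg_norm|by apply: itg_sub il|].
  by move=> s /(proj2 hq)/andP[a c]; rewrite normrM ger0_norm// ler_piMl.
by apply: I_sub_le.
Qed.

Lemma sobolev_norm0 T h : L2 0 T h -> sobolev 0 T h -> nrm 0 T h = sobolev_norm 0 T h.
Proof.
move=> lh hs; have [m _] := wD_meas hs (leqnn 0).
rewrite (@aeq_nrm _ 0 T h (wD T 0 h) (proj1 lh) m); last first.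
  by apply: ae_leb_imp (wD0_aeq lh) => s es si; rewrite es.
rewrite /sobolev_norm sobolev_ipE big_ord_recl big_ord0 addr0 /nrm; congr Num.sqrt.
Qed.

Lemma var_alg (u1 u2 v1 v2 s : R) : u1 <= s -> u2 <= s -> 0 <= v1 -> 0 <= v2 ->
  2 * u1 + u2 - (2 * v1 + v2) <= 3 * s.
Proof. lra. Qed.

(** Applied to the multipliers: the one with index 1 vanishes, so their sum effectively starts at
    2. *)
Lemma sum_shift1 (a w : nat -> R) (n : nat) : a 1%N = 0 ->
  \sum_(1 <= k < n.+1) a k * w k = \sum_(0 <= k < n.-1) a k.+2 * w k.+2.
Proof.
case: n => [|n] a1; first by rewrite !big_geq.
by rewrite big_add1/= big_nat_recl// a1 mul0r add0r.
Qed.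

(** Here the multiplier lags one index behind its weight, hence the offset [k.+3] and one term fewer
    than in [sum_shift1]. *)
Lemma sum_shift2 (a w : nat -> R) (n : nat) : a 0%N = 0 -> a 1%N = 0 ->
  \sum_(1 <= k < n.+1) a k.-1 * w k = \sum_(0 <= k < n.-2) a k.+2 * w k.+3.
Proof.
case: n => [|[|n]] a0 a1; first by rewrite !big_geq.
  by rewrite big_nat1 a0 mul0r big_geq.
by rewrite big_add1/= big_nat_recl// big_nat_recl// a0 a1 !mul0r !add0r.
Qed.

End TimeSums.

(** * Uniform bounds for the scheme and its multipliers *)

Section Scheme.
Context {R : realType}.
Implicit Types (L T omega b E K gam tau : R) (g G h : R -> R) (N k : nat).
Implicit Types (r : nat -> R -> 'rV[R]_3) (eg : 'rV[R]_3) (f : R * R -> 'rV[R]_3).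

#[local] Opaque I wD.

Lemma coord_norm_le (u : 'rV[R]_3) i : `|u ord0 i| <= `|u|.
Proof.
rewrite [leRHS]/Num.norm/= mx_normrE.
exact: (le_bigmax _ (fun ij : 'I_1 * 'I_3 => `|u ij.1 ij.2|) (ord0, i)).
Qed.

(** Compactness of the rectangle gives the bound. Continuity is known only within the rectangle, so
    a slice at a grid time is shown continuous at interior points, which gives measurability. *)
Lemma f_bound L T f : 0 < L -> 0 < T ->
  {within [set` `[0, L]] `*` [set` `[0, T]], continuous f} ->
  exists2 Fb : R, 0 <= Fb & forall N k i, (0 < N)%N -> (k <= N)%N ->
    L2 0 L (coordf (f_ T N f k) i) /\ nrm 0 L (coordf (f_ T N f k) i) <= Fb.
Proof.
move=> L0 T0 fc; set A := _ `*` _ in fc.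
have cA : compact A by apply: compact_setX; exact: segment_compact.
have [M hM] : exists M : R, forall z, A z -> `|f z| <= M.
  have /compact_bounded[M [_ hM]] := continuous_compact fc cA.
  exists (M + 1) => z Az; have M1 : M < M + 1 by lra.
  by apply: (hM _ M1); exists z.
have co z i : A z -> `|f z ord0 i| <= M.
  move=> Az; apply: le_trans (hM _ Az); exact: (coord_norm_le (f z) i).
have M0 : 0 <= M.
  have A0 : A (0, 0) by split; rewrite /= in_itv/= lexx ltW.
  by apply: le_trans (hM _ A0).
exists (M * Num.sqrt L) => [|N k i N0 kN]; first by rewrite mulr_ge0// sqrtr_ge0.
have tin : 0 <= t_ T N k <= T by rewrite t_ge0// t_le.
have As s : 0 <= s -> s <= L -> A (s, t_ T N k).
  by move=> s0 sL; split; rewrite /= in_itv/= ?s0.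
have m : measurable_fun `]0, L[ (coordf (f_ T N f k) i).
  apply: open_continuous_measurable_fun; first exact: interval_open.
  move=> s; rewrite inE/= in_itv/= => /andP[s0 sL].
  have sA : A (s, t_ T N k) by apply: As; exact: ltW.
  have /subspace_continuousP/(_ _ sA) := fc.
  move=> /cvgrPdist_le fs; apply/cvgrPdist_le => e e0.
  have := fs _ e0; rewrite /within/= => -[[U V]] /= [nU nV] hUV.
  near=> z; rewrite /coordf /f_.
  have z0 : 0 < z by near: z; exact: lt_nbhsr.
  have zL : z < L by near: z; exact: lt_nbhsl.
  have Uz : U z by near: z.
  have /= := hUV (z, t_ T N k) (conj Uz (nbhs_singleton nV)).
  move=> /(_ (As z (ltW z0) (ltW zL))); apply: le_trans.
  have := coord_norm_le (f (s, t_ T N k) - f (z, t_ T N k)) i.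
  by rewrite !mxE.
have bd s : s \in `]0, L[ -> `|coordf (f_ T N f k) i s| <= M.
  by rewrite in_itv/= => /andP[s0 sL]; apply: co; apply: As; exact: ltW.
have l2 := L2_bdd m bd; split => //.
rewrite -{1}(ger0_norm M0) -[L in Num.sqrt L]subr0 -nrm_cst; last exact: ltW.
by apply: le_nrm => //; exact: L2_cst.
Unshelve. all: by end_near. Qed.

Lemma linear_rep L eg : repV L eg (fun s => (L - s) *: eg)
  (fun i s => (L - s) * eg ord0 i) (fun i _ => - eg ord0 i) (fun _ _ => 0).
Proof.
move=> i; have e : coordf (fun s => (L - s) *: eg) i = (fun s => (L - s) * eg ord0 i).
  by apply/funext => s; rewrite /coordf mxE.
split=> //; last by rewrite subrr mul0r.
rewrite e; split; last exact: AC_cst.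
have hA : abs_cont L (fun s => (L - s) * eg ord0 i) (fun=> - eg ord0 i).
  split; first exact: L2_cst.
  by move=> x y x0 xy yL; rewrite I_cst//; ring.
by split => //; [exact: AC_meas hA _ _|exact: aeqW].
Qed.

Lemma coord_le1 eg i : enorm eg = 1 -> `|eg ord0 i| <= 1.
Proof.
move=> h; rewrite -h /enorm -sqrtr_sqr ler_sqrt; last first.
  by apply: sumr_ge0 => j _; rewrite -expr2 sqr_ge0.
rewrite /dotp (bigD1 i)//= expr2 lerDl.
by apply: sumr_ge0 => j _; rewrite -expr2 sqr_ge0.
Qed.

Lemma unit_speed_linear L eg : enorm eg = 1 -> unit_speed L (fun i _ => - eg ord0 i).
Proof.
move=> h s _ _; rewrite /sqn (eq_bigr (fun i => eg ord0 i * eg ord0 i)); last first.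
  by move=> i _; rewrite mulrNN.
rewrite -[1](expr1n _ 2) -h sqr_sqrtr//.
by apply: sumr_ge0 => j _; rewrite -expr2 sqr_ge0.
Qed.

(** Pythagoras: the increment is orthogonal to [P], so $|P'|^2 = |P|^2 + |P'-P|^2$. *)
Lemma unit_speed_step L (P P' : 'I_3 -> R -> R) : unit_speed L P ->
  (forall s, 0 <= s -> s <= L -> \sum_i (P' i s - P i s) * P i s = 0) -> unit_speed L P'.
Proof.
move=> hP hc s s0 sL; apply: le_trans (hP s s0 sL) _.
have -> : sqn P' s = sqn P s + 2 * \sum_i (P' i s - P i s) * P i s
   + \sum_i (P' i s - P i s) ^+ 2.
  rewrite mulr_sumr /sqn -!big_split/=; apply: eq_bigr => i _; ring.
rewrite hc// mulr0 addr0 lerDl; apply: sumr_ge0 => i _; exact: sqr_ge0.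
Qed.

Lemma rep_nrm2 L eg q (W P Q : 'I_3 -> R -> R) i : 0 < L -> repV L eg q W P Q ->
  nrm 0 L (wD L 2 (coordf q i)) = nrm 0 L (Q i).
Proof.
move=> L0 hr; have hv := rep_calV L0 hr; have [h2 _ _] := hr i.
have [_ /AC_L2 lQ] := h2.
have lw := calV_L2'' i hv.
by apply: aeq_nrm (proj1 lw) (proj1 lQ) _; exact: rep2_wD2 (ltW L0) h2.
Qed.

Lemma energy0 L eg omega b tau : 0 < L ->
  energy L omega b tau (fun s => (L - s) *: eg) (fun s => (L - s) *: eg) = 0.
Proof.
move=> L0; rewrite /energy !big1 ?mulr0 ?addr0// => i _.
  by rewrite -nrm_sqr (rep_nrm2 i L0 (linear_rep L eg)) nrm_sqr I_eq0// => s _; rewrite expr0n.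
by rewrite I_eq0// => s _; rewrite subrr expr0n.
Qed.

#[local] Opaque energy sobolev_ip.

(** [bdAC] hides its derivative under an existential; uniqueness of weak derivatives transfers the
    bound to the derivative at hand. *)
Lemma AC_der_nrm (a k : R) (u v : R -> R) : 0 <= a -> abs_cont a u v -> bdAC a k u -> nrm 0 a v <= k.
Proof.
move=> a0 h [v' [h' _ hn]]; apply: le_trans hn.
rewrite (aeq_nrm (proj1 (AC_L2 h)) (proj1 (AC_L2 h')))//.
exact: weak_uniq (AC_weak1 a0 h) (AC_weak1 a0 h').
Qed.

Lemma nrm_wD1_le L g : sobolev 1 L g -> nrm 0 L (wD L 1 g) <= sobolev_norm 1 L g.
Proof.
move=> hg; rewrite /sobolev_norm /nrm ler_sqrt; last exact: ip_ge0.
rewrite sobolev_ipE !big_ord_recl big_ord0 addr0.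
have -> : I 0 L (fun s => wD L 1 g s ^+ 2) = I 0 L (fun s => wD L 1 g s * wD L 1 g s).
  by apply: eq_I => s _; rewrite expr2.
by rewrite lerDr; apply: I_ge0 => s _; rewrite -expr2 sqr_ge0.
Qed.

Lemma lower_order_alg (b s1 s2 X Y : R) : 0 <= b -> `|s1| <= X -> `|s2| <= Y ->
  `|- (2 * (b * s1 - s2))| <= 2 * (b * X + Y).
Proof.
move=> b0 h1 h2; rewrite normrN normrM (ger0_norm (ler0n _ 2)) ler_wpM2l//.
apply: le_trans (ler_normB _ _) (lerD _ h2).
by rewrite normrM (ger0_norm b0) ler_wpM2l.
Qed.

Lemma multiplier_alg (w t b c a1 a2 a3 b1 b2 b3 f1 f2 f3 : R) :
  a1 = c * a2 + a3 -> b1 = c * b2 + b3 -> f1 = c * f2 + f3 ->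
  - (2 * (w * (t * a1) + b * b1 - f1)) =
  c * - (2 * (w * (t * a2) + b * b2 - f2)) + - (2 * (w * (t * a3) + b * b3 - f3)).
Proof. by move=> -> -> ->; ring. Qed.

Definition incr r k (i : 'I_3) : R -> R := fun s => coordf (r k) i s - coordf (r k.-1) i s.

(** [j] selects the increment and [k] the curve of the field. Keeping them apart is what allows the
    summation by parts: a second difference of the curves is a difference in [j] at fixed [k]. *)
Definition second_diff_pairing L r (P : nat -> 'I_3 -> R -> R) G (j k : nat) : R :=
  \sum_i I 0 L (fun s => incr r j i s * PhiI L G (P k) i s).

Context (L T omega b : R) (eg : 'rV[R]_3) (f : R * R -> 'rV[R]_3).
Context (L0 : 0 < L) (T0 : 0 < T) (w0 : 0 < omega) (b0 : 0 < b) (he : enorm eg = 1).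
Context (fc : {within [set` `[0, L]] `*` [set` `[0, T]], continuous f}).

Local Notation is_scheme := (scheme L T omega b eg f).
Local Notation lam := (lambda_ L T omega b f).
Local Notation lam_pairing := (lambda_tau_pairing L T omega b f).

(** Minimality enters only through admissibility: the constraint passes the lower bound on the speed
    from one curve to the next, starting from the two straight curves, whose speed is 1. *)
Lemma scheme_rep N r :
  is_scheme N r -> forall k, (k <= N)%N ->
  calV L eg (r k) /\ exists WPQ : ('I_3 -> R -> R) * ('I_3 -> R -> R) * ('I_3 -> R -> R),
    repV L eg (r k) WPQ.1.1 WPQ.1.2 WPQ.2 /\ unit_speed L WPQ.1.2.
Proof.
move=> [r0 r1 rs].
have base q : q = (fun s => (L - s) *: eg) -> calV L eg q /\
   exists WPQ : ('I_3 -> R -> R) * ('I_3 -> R -> R) * ('I_3 -> R -> R),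
    repV L eg q WPQ.1.1 WPQ.1.2 WPQ.2 /\ unit_speed L WPQ.1.2.
  move=> ->; split; first exact: rep_calV (linear_rep L eg).
  exists (fun i s => (L - s) * eg ord0 i, fun i _ => - eg ord0 i, fun _ _ => 0).
  by split; [exact: linear_rep|exact: unit_speed_linear].
elim=> [|k IH] kN; first exact: base.
case: k IH kN => [|k] IH kN; first exact: base.
have [hv [[[W P] Q] [/= hr hu]]] := IH (ltnW kN).
have := rs k.+1; rewrite kN => /(_ isT)[hK _]; have [hv' _] := hK; split => //.
have [W' [P' hr']] := calV_rep L0 hv'.
exists (W', P', fun i => wD L 2 (coordf (r k.+2) i)); split => //=.
apply: unit_speed_step hu _.
exact: (proj1 (constr_rep L0 hr hr') hK).
Qed.

Lemma scheme_energy N r Fb : (0 < N)%N -> 0 <= Fb ->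
  (forall k i, (k <= N)%N -> L2 0 L (coordf (f_ T N f k) i) /\ nrm 0 L (coordf (f_ T N f k) i) <= Fb) ->
  is_scheme N r -> forall k, (k < N)%N ->
  Num.sqrt (energy L omega b (tau_ T N) (r k) (r k.+1)) <=
   k%:R * (tau_ T N * (6 * Fb / Num.sqrt omega)).
Proof.
move=> N0 Fb0 hF hs; have t0 := tau_gt0 T0 N0.
elim=> [|k IH] kN.
  by have [-> -> _] := hs; rewrite energy0// sqrtr0 mul0r.
have hv := scheme_rep hs.
have [hv0 _] := hv k (ltnW (ltnW kN)); have [hv1 _] := hv k.+1 (ltnW kN).
have [_ _ /(_ k.+1)] := hs; rewrite kN => /(_ isT) hmin.
have lF i := proj1 (hF k.+2 i kN); have nF i := proj2 (hF k.+2 i kN).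
apply: le_trans (energy_growth L0 w0 b0 t0 hv0 hv1 lF nF hmin) _.
apply: le_trans (lerD (IH (ltnW kN)) (lexx _)) _.
by apply: eq_ler; rewrite -[k.+1%:R]natr1; ring.
Qed.

(** The initial energy is 0, and [k * tau <= T] turns the linear growth of the root of the energy
    into the bound [M]. The kinetic and the bending part give one estimate each; [E] adds the two
    constants so as to serve for both. *)
Lemma scheme_bounds : exists2 E, 0 <= E & forall N r, (0 < N)%N -> is_scheme N r ->
  forall k i, (k < N)%N ->
  nrm 0 L (fun s => coordf (r k.+1) i s - coordf (r k) i s) <= E * tau_ T N /\
  nrm 0 L (wD L 2 (coordf (r k.+1) i)) <= E.
Proof.
have [Fb Fb0 hF] := f_bound L0 T0 fc.
pose M := T * (6 * Fb / Num.sqrt omega).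
have sw : 0 < Num.sqrt omega by rewrite sqrtr_gt0.
have sb : 0 < Num.sqrt b by rewrite sqrtr_gt0.
have M0 : 0 <= M by apply: mulr_ge0; [exact: ltW|apply: divr_ge0; [exact: mulr_ge0|exact: ltW]].
have m1 : 0 <= M / Num.sqrt omega by apply: divr_ge0 => //; exact: ltW.
have m2 : 0 <= M / Num.sqrt b by apply: divr_ge0 => //; exact: ltW.
exists (M / Num.sqrt omega + M / Num.sqrt b); first exact: addr_ge0.
move=> N r N0 hs k i kN; have t0 := tau_gt0 T0 N0.
have hE : Num.sqrt (energy L omega b (tau_ T N) (r k) (r k.+1)) <= M.
  apply: le_trans (@scheme_energy _ _ _ N0 Fb0 _ hs k kN) _.
    by move=> k' i' kN'; exact: hF.
  rewrite mulrA /M; apply: ler_wpM2r.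
    by apply: divr_ge0; [exact: mulr_ge0|exact: ltW].
  by apply: t_le => //; exact: ltnW.
split.
  apply: le_trans (@energy_diff _ L omega b (tau_ T N) (r k) (r k.+1) i w0 b0 t0) _.
  rewrite mulrC ler_wpM2r ?(ltW t0)//.
  apply: (@le_trans _ _ (M / Num.sqrt omega)); last by rewrite lerDl.
  by rewrite ler_pM2r// invr_gt0.
apply: le_trans (@energy_second _ L omega b (tau_ T N) (r k) (r k.+1) i w0 b0) _.
apply: (@le_trans _ _ (M / Num.sqrt b)); last by rewrite lerDr.
by rewrite ler_pM2r// invr_gt0.
Qed.

(* x j k is the pairing of r_j - r_{j-1} with (e'_{k+1})^{-1}[g]: up to the
   bounded remainder rho, the multiplier is a difference in j. *)
Lemma lambda_decomp : exists A0 B0 R0 : R, [/\ 0 <= A0, 0 <= B0, 0 <= R0 &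
  forall N r, (0 < N)%N -> is_scheme N r ->
  forall g, sobolev0 1 L g -> exists (x : nat -> nat -> R) (rho : nat -> R),
  let gam := sobolev_norm 1 L g in let tau := tau_ T N in
  [/\ x 1%N 1%N = 0,
      forall k, (k.+2 <= N)%N -> lam N r k.+2 g =
         - (2 * omega * (tau ^+ 2)^-1 * (x k.+2 k.+1 - x k.+1 k.+1)) + rho k,
      forall k, (k.+2 <= N)%N -> `|rho k| <= R0 * gam,
      forall j k, (0 < j)%N -> (j <= N)%N -> (k <= N)%N -> `|x j k| <= A0 * tau * gam &
      forall k, (k.+2 <= N)%N -> `|x k.+2 k.+2 - x k.+2 k.+1| <= B0 * tau ^+ 2 * gam]].
Proof.
have [E E0 hE] := scheme_bounds.
have [Fb Fb0 hF] := f_bound L0 T0 fc.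
have [K K1 hK] := @dirX_bound _ L E (ltW L0) E0.
have K0 : 0 <= K by apply: le_trans K1.
pose sa := 1 + Num.sqrt L; have sa0 : 0 <= sa by rewrite addr_ge0// sqrtr_ge0.
(* [b1 * gam] will bound [G * dirX] together with its derivative, and [p1 * gam] the $L^2$ norm of
   [PhiI]; the factors 3 below come from summing over coordinates. *)
pose b1 := 2 * sa * K; have b10 : 0 <= b1 by rewrite !mulr_ge0.
pose p1 := L * b1 * Num.sqrt L.
have p10 : 0 <= p1 by rewrite !mulr_ge0 ?sqrtr_ge0 ?(ltW L0).
exists (3 * (E * p1)), (96 * sa ^+ 2 * K ^+ 2 * E ^+ 2),
  (2 * (b * (3 * (E * b1)) + 3 * (Fb * p1))); split.
- exact: mulr_ge0 (ler0n _ 3) (mulr_ge0 E0 p10).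
- exact: (mulr_ge0 (mulr_ge0 (mulr_ge0 (ler0n _ 96) (sqr_ge0 _)) (sqr_ge0 _)) (sqr_ge0 _)).
- apply: mulr_ge0 (ler0n _ 2) (addr_ge0 _ _).
    exact: mulr_ge0 (ltW b0) (mulr_ge0 (ler0n _ 3) (mulr_ge0 E0 b10)).
  exact: mulr_ge0 (ler0n _ 3) (mulr_ge0 Fb0 p10).
move=> N r N0 hs g hg; have t0 := tau_gt0 T0 N0.
have hrep := scheme_rep hs.
have hV k : (k <= N)%N -> calV L eg (r k) by case/hrep.
have : forall k, exists WPQ : ('I_3 -> R -> R) * ('I_3 -> R -> R) * ('I_3 -> R -> R),
    (k <= N)%N -> repV L eg (r k) WPQ.1.1 WPQ.1.2 WPQ.2 /\ unit_speed L WPQ.1.2.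
  (* Dummy data beyond [N] make the choice total. *)
  move=> k; have [kN|kN] := leqP k N; last by exists (fun _ _ => 0, fun _ _ => 0, fun _ _ => 0).
  by have [_ [WPQ h]] := hrep k kN; exists WPQ.
move=> /choice[WPQ hW].
pose W k := (WPQ k).1.1; pose P k := (WPQ k).1.2; pose Q k := (WPQ k).2.
have rP k : (k <= N)%N -> repV L eg (r k) (W k) (P k) (Q k) by case/hW.
have uP k : (k <= N)%N -> unit_speed L (P k) by case/hW.
have n2 k i : (k <= N)%N -> nrm 0 L (wD L 2 (coordf (r k) i)) <= E.
  (* The bound of [scheme_bounds] is stated for [k.+1]; index 0 is covered because [r 0 = r 1]. *)
  case: k => [_|k kN]; last by have [] := hE _ _ N0 hs k i kN.
  have [-> e1 _] := hs; rewrite -e1; by have [] := hE _ _ N0 hs 0%N i N0.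
have nQ k i : (k <= N)%N -> nrm 0 L (Q k i) <= E.
  by move=> kN; rewrite -(rep_nrm2 i L0 (rP _ kN)); exact: n2.
have aW k i : (k <= N)%N -> abs_cont L (W k i) (P k i).
  by move=> kN; have [[[_ _ h] _] _ _] := rP _ kN i.
have aP k i : (k <= N)%N -> abs_cont L (P k i) (Q k i).
  by move=> kN; have [[_ h] _ _] := rP _ kN i.
have hX k : (k <= N)%N -> forall i, bdAC L K (dirX (P k) i) /\ bdAC L K (fun s => (sqn (P k) s)^-1).
  move=> kN; apply: (hK _ (Q k)).
  - by move=> i; exact: aP.
  - by move=> i; have [_ _ ->] := rP _ kN i; rewrite normrN; exact: coord_le1.
  - by move=> i; exact: nQ.
  - exact: uP.
have : forall k, exists X' : 'I_3 -> R -> R, (k <= N)%N -> forall i, abs_cont L (dirX (P k) i) (X' i).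
  move=> k; have [kN|kN] := leqP k N; last by exists (fun _ _ => 0).
  have [X' h] := dirX_AC (fun i => aP k i kN) (uP k kN); by exists X'.
move=> /choice[X' hX'].
have [G [rG GL]] := rep1_end0 L0 hg.
have [_ _ aG] := rG.
pose gam := sobolev_norm 1 L g; have gam0 : 0 <= gam by exact: sqrtr_ge0.
have ng : nrm 0 L (wD L 1 g) <= gam by apply: nrm_wD1_le; case: hg.
have bG := G_bd (ltW L0) aG GL ng; rewrite -/sa in bG.
have bGX k i : (k <= N)%N -> bdAC L (b1 * gam) (fun x => G x * dirX (P k) i x).
  move=> kN; apply: bdAC_le (bdACM bG (proj1 (hX k kN i))).
  by rewrite /b1; apply: eq_ler; ring.
have lPhi k i : (k <= N)%N -> L2 0 L (PhiI L G (P k) i).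
  move=> kN; have := ACM aG (hX' k kN i) => h.
  exact: AC_L2f (PhiI_AC (ltW L0) h).
have nPhi k i : (k <= N)%N -> nrm 0 L (PhiI L G (P k) i) <= p1 * gam.
  move=> kN; have -> : p1 * gam = (L * (b1 * gam)) * Num.sqrt L by rewrite /p1; ring.
  apply: nrm_le_bnd; [exact: ltW|exact: lPhi|move=> s s0 sL].
  by apply: PhiI_bnd => //; exact: bGX.
have lr k i : (k <= N)%N -> L2 0 L (coordf (r k) i) by move=> /hV h; exact: calV_L2 h.
have ld k i : (k <= N)%N -> L2 0 L (incr r k i).
  by move=> kN; apply: L2B; apply: lr => //; exact: leq_trans (leq_pred _) kN.
have nd k i : (0 < k)%N -> (k <= N)%N -> nrm 0 L (incr r k i) <= E * tau_ T N.
  by case: k => // k _ kN; have [] := hE _ _ N0 hs k i kN.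
exists (second_diff_pairing L r P G),
  (fun k => - (2 * (b * \sum_i I 0 L (fun s => wD L 2 (coordf (r k.+2) i) s *
          (wD L 1 g s * dirX (P k.+1) i s + G s * X' k.+1 i s))
     - \sum_i I 0 L (fun s => coordf (f_ T N f k.+2) i s * PhiI L G (P k.+1) i s)))).
cbv zeta; rewrite -/gam; set tau := tau_ T N; split.
(* The initial velocity vanishes, as the first two curves coincide. *)
- rewrite /second_diff_pairing big1// => i _.
  have [e0 e1 _] := hs.
  by rewrite I_eq0// => s _; rewrite /incr/= e0 e1 subrr mul0r.
- move=> k kN; have k1N : (k.+1 <= N)%N by exact: ltnW.
  have k0N : (k <= N)%N by exact: ltnW.
  rewrite /lambda_ (J'_formula _ _ _ L0 (hV k k0N) (rP k.+1 k1N) (hV k.+2 kN)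
    (fun i => proj1 (hF N k.+2 i N0 kN)) (uP k.+1 k1N) rG (hX' k.+1 k1N)).
  have -> : \sum_i I 0 L (fun s => (coordf (r k.+2) i s - 2 * coordf (r k.+1) i s + coordf (r k) i s)
      * PhiI L G (P k.+1) i s) = second_diff_pairing L r P G k.+2 k.+1 - second_diff_pairing L r P G k.+1 k.+1.
    rewrite /second_diff_pairing -sumrB; apply: eq_bigr => i _.
    rewrite -IB; last 2 first.
    - by apply: L2_mul; [exact: ld|exact: lPhi].
    - by apply: L2_mul; [exact: ld|exact: lPhi].
    by apply: eq_I => s _; rewrite /incr/=; ring.
  rewrite -/tau; move: (second_diff_pairing _ _ _ _ _ _) (second_diff_pairing _ _ _ _ _ _) => x1 x2.
  by move: (\sum_i _) (\sum_i _) => s1 s2; ring.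
- move=> k kN; have k1N : (k.+1 <= N)%N by exact: ltnW.
  have c1 : `|\sum_i I 0 L (fun s => wD L 2 (coordf (r k.+2) i) s *
          (wD L 1 g s * dirX (P k.+1) i s + G s * X' k.+1 i s))| <= 3 * (E * (b1 * gam)).
    apply: sum3_bound => i; have hA := ACM aG (hX' k.+1 k1N i).
    apply: le_trans (cauchy_schwarz (calV_L2'' i (hV _ kN)) (AC_L2 hA)) _.
    apply: ler_pM; rewrite ?nrm_ge0//; first exact: n2.
    exact: AC_der_nrm (ltW L0) hA (bGX _ _ k1N).
  have c2 : `|\sum_i I 0 L (fun s => coordf (f_ T N f k.+2) i s * PhiI L G (P k.+1) i s)| <= 3 * (Fb * (p1 * gam)).
    apply: sum3_bound => i; have [lF nF] := hF N k.+2 i N0 kN.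
    apply: le_trans (cauchy_schwarz lF (lPhi _ i k1N)) _.
    by apply: ler_pM; rewrite ?nrm_ge0//; exact: nPhi.
  apply: le_trans (lower_order_alg (ltW b0) c1 c2) _.
  by apply: eq_ler; ring.
- move=> j k j0 jN kN.
  have -> : 3 * (E * p1) * tau * gam = 3 * ((E * tau) * (p1 * gam)) by ring.
  apply: sum3_bound => i.
  apply: le_trans (cauchy_schwarz (ld _ i jN) (lPhi _ i kN)) _.
  by apply: ler_pM; rewrite ?nrm_ge0//; [exact: nd|exact: nPhi].
- move=> k kN; have k1N : (k.+1 <= N)%N by exact: ltnW.
  have [_ _ /(_ k.+1)] := hs; rewrite kN => /(_ isT)[hKc _].
  have hc := proj1 (constr_rep L0 (rP _ k1N) (rP _ kN)) hKc.
  apply: (@Phi_diff _ L K E gam tau (P k.+2) (P k.+1) (Q k.+2) (Q k.+1) (W k.+2) (W k.+1)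
    (incr r k.+2) G (wD L 1 g)) => //; try exact: ltW.
  + by move=> i; exact: aW.
  + by move=> i; exact: aW.
  + by move=> i; have [_ ->] := rP _ kN i.
  + by move=> i; have [_ ->] := rP _ k1N i.
  + by move=> i; have [] := hX _ kN i.
  + by have [] := hX _ kN ord0.
  + by move=> i; have [] := hX _ k1N i.
  + exact: uP.
  + exact: uP.
  + by move=> i; exact: ld.
  + move=> i; have [[[_ e2 _] _] _ _] := rP _ kN i; have [[[_ e1 _] _] _ _] := rP _ k1N i.
    by apply: ae_leb_imp2 e2 e1 => s h2 h1 sL; rewrite /incr/= h1// h2.
  + by move=> i; exact: nd.
Qed.

(** The chosen derivatives inside [J'] are linear only up to null sets, so linearity is read off
    [J'_formula], in which [P] and [X'] do not depend on the argument of the multiplier. *)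
Lemma lambda_lin N r : (0 < N)%N ->
  is_scheme N r -> forall k, (k <= N)%N -> forall c g h,
  sobolev0 1 L g -> sobolev0 1 L h ->
  lam N r k (fun s => c * g s + h s) =
  c * lam N r k g + lam N r k h.
Proof.
move=> N0 hs [|[|k]] kN c g h hg hh; [by rewrite /= mulr0 addr0..|].
have [Fb Fb0 hF] := f_bound L0 T0 fc.
have hrep := scheme_rep hs.
have k1N : (k.+1 <= N)%N by exact: ltnW.
have k0N : (k <= N)%N by exact: ltnW.
have [hv2 _] := hrep _ kN; have [hv0 _] := hrep _ k0N.
have [hv1 [[[W P] Q] [/= rP uP]]] := hrep _ k1N.
have aP i : abs_cont L (P i) (Q i) by have [[_ e] _ _] := rP i.
have [X' hX'] := dirX_AC aP uP.
have [G [rG _]] := rep1_end0 L0 hg; have [H [rH _]] := rep1_end0 L0 hh.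
have rL := rep1_lin c rG rH.
have lF i := proj1 (hF N k.+2 i N0 kN).
have JF u U u' (ru : rep1 L u U u') := @J'_formula _ L eg omega b (tau_ T N) (r k) (r k.+1) (f_ T N f k.+2) (r k.+2)
  W P Q u U u' X' L0 hv0 rP hv2 lF uP ru hX'.
rewrite /lambda_ (JF _ _ _ rG) (JF _ _ _ rH) (JF _ _ _ rL).
have aX U u' (aU : abs_cont L U u') i := ACM aU (hX' i).
have aG : abs_cont L G (wD L 1 g) by case: rG.
have aH : abs_cont L H (wD L 1 h) by case: rH.
have lPhi U u' (aU : abs_cont L U u') i : L2 0 L (PhiI L U P i).
  exact: AC_L2f (PhiI_AC (ltW L0) (aX _ _ aU i)).
have PhiL i s : 0 <= s -> PhiI L (fun x => c * G x + H x) P i s = c * PhiI L G P i s + PhiI L H P i s.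
  move=> s0; rewrite /PhiI.
  have iG : itg s L (fun x => G x * dirX P i x) by apply: itg_sub (L2_itg (AC_L2f (aX _ _ aG i))).
  have iH : itg s L (fun x => H x * dirX P i x) by apply: itg_sub (L2_itg (AC_L2f (aX _ _ aH i))).
  rewrite (@eq_I _ _ _ _ (fun x => c * (G x * dirX P i x) + H x * dirX P i x)); last by move=> x _; ring.
  by rewrite ID ?IZ//; [ring|exact: itgZ].
have la i : L2 0 L (fun s => coordf (r k.+2) i s - 2 * coordf (r k.+1) i s + coordf (r k) i s).
  apply: L2D; last exact: calV_L2 hv0.
  by apply: L2B; [exact: calV_L2 hv2|apply: L2Z; exact: calV_L2 hv1].
have comb (F1 F2 F3 : 'I_3 -> R) : (forall i, F1 i = c * F2 i + F3 i) ->
    \sum_i F1 i = c * \sum_i F2 i + \sum_i F3 i.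
  by move=> e; rewrite mulr_sumr -big_split/=; apply: eq_bigr => i _; exact: e.
have Ilin (u v w u3 : R -> R) : L2 0 L u -> L2 0 L v -> L2 0 L w ->
    (forall s, s \in `]0, L[ -> u3 s = c * v s + w s) ->
    I 0 L (fun s => u s * u3 s) = c * I 0 L (fun s => u s * v s) + I 0 L (fun s => u s * w s).
  move=> lu lv lw e; rewrite -IZ; last exact: L2_mul.
  rewrite -ID; [|by apply: itgZ; exact: L2_mul|exact: L2_mul].
  by apply: eq_I => s /e ->; ring.
have e1 := comb _ _ _ (fun i => Ilin _ _ _ _ (la i) (lPhi _ _ aG i) (lPhi _ _ aH i)
   (fun s si => PhiL i s (ltW (andP (si : (0 < s) && (s < L))).1))).
have e3 := comb _ _ _ (fun i => Ilin _ _ _ _ (lF i) (lPhi _ _ aG i) (lPhi _ _ aH i)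
   (fun s si => PhiL i s (ltW (andP (si : (0 < s) && (s < L))).1))).
have e2 : \sum_i I 0 L (fun s => wD L 2 (coordf (r k.+2) i) s *
    ((c * wD L 1 g s + wD L 1 h s) * dirX P i s + (c * G s + H s) * X' i s)) =
  c * (\sum_i I 0 L (fun s => wD L 2 (coordf (r k.+2) i) s * (wD L 1 g s * dirX P i s + G s * X' i s)))
  + \sum_i I 0 L (fun s => wD L 2 (coordf (r k.+2) i) s * (wD L 1 h s * dirX P i s + H s * X' i s)).
  apply: comb => i; apply: Ilin.
  - exact: calV_L2'' hv2.
  - exact: AC_L2 (aX _ _ aG i).
  - exact: AC_L2 (aX _ _ aH i).
  - by move=> s _; ring.
exact: multiplier_alg e1 e2 e3.
Qed.

Lemma pairing_sum N r g h : (0 < N)%N -> L2 0 T h ->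
  lam_pairing N r g h =
  \sum_(1 <= k < N.+1) (lam N r k g * alpha T N k h +
     lam N r k.-1 g * beta T N k h).
Proof.
move=> N0 lh.
exact: (@pairing_split _ T N (fun k => lam N r k g)
  (fun k => lam N r k.-1 g) h T0 N0 (L2_itg lh)).
Qed.

(** For fixed [N] only: the constant contains a term of order [1/tau], which is harmless for
    membership in the dual but useless for the uniform estimate. *)
Lemma lambda_bound N r : (0 < N)%N -> is_scheme N r ->
  exists2 A : R, 0 <= A & forall k g, (k <= N)%N -> sobolev0 1 L g ->
    `|lam N r k g| <= A * sobolev_norm 1 L g.
Proof.
move=> N0 hs; have [A0 [B0 [R0 [A00 B00 R00 hd]]]] := lambda_decomp.
have t0 := tau_gt0 T0 N0; set tau := tau_ T N in t0.
have p0 : 0 <= 2 * omega * (tau ^+ 2)^-1 by rewrite mulr_ge0 ?invr_ge0 ?sqr_ge0// mulr_ge0// ltW.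
have q0 : 0 <= A0 * tau by rewrite mulr_ge0// ltW.
exists (2 * omega * (tau ^+ 2)^-1 * (2 * (A0 * tau)) + R0).
  by rewrite addr_ge0// mulr_ge0// mulr_ge0.
move=> k g kN hg; have gam0 : 0 <= sobolev_norm 1 L g by exact: sqrtr_ge0.
case: k kN => [|[|k]] kN.
- by rewrite normr0 mulr_ge0// addr_ge0// mulr_ge0// mulr_ge0.
- by rewrite normr0 mulr_ge0// addr_ge0// mulr_ge0// mulr_ge0.
have [x [rho [_ hl hr hx _]]] := hd N r N0 hs g hg.
rewrite hl//; apply: le_trans (ler_normD _ _) _; rewrite [leRHS]mulrDl.
apply: lerD; last exact: hr.
rewrite normrN normrM (ger0_norm p0) -[leRHS]mulrA; apply: ler_wpM2l => //.
apply: le_trans (ler_normB _ _) _.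
have k1 : (k.+1 <= N)%N by exact: ltnW.
apply: le_trans (lerD (hx k.+2 k.+1 isT kN k1) (hx k.+1 k.+1 isT k1 k1)) _.
by rewrite -/tau; apply: eq_ler; ring.
Qed.

(** Each functional [mu] integrates over one cell against a weight with values in [0, 1], so it is
    bounded in $L^2$. There are two rank-one terms per cell, each with constant [C]. *)
Lemma pairing_dual N r : (0 < N)%N -> is_scheme N r ->
  in_tensor_dual 1 0 L T (lam_pairing N r).
Proof.
move=> N0 hs; have [A A0 hA] := lambda_bound N0 hs.
have ll := lambda_lin N0 hs.
have lL2 h : sobolev0 0 T h -> L2 0 T h by case=> h1 _; exact: sob_L2 h1.
pose C := A * Num.sqrt T.
have scal k c g : (k <= N)%N -> sobolev0 1 L g ->
    lam N r k (fun s => c * g s) = c * lam N r k g.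
  move=> kN hg; have s0 := @sobolev0_0 _ 1 L L0 isT.
  have := ll k kN c _ _ hg s0; rewrite (@sobolev0_lin0 _ _ 1 _ L0 isT (ll k kN)) addr0 => <-.
  by congr (lambda_ _ _ _ _ _ _ _ _); apply/funext => s; rewrite addr0.
apply: (@in_tensor_dual_bounded _ 1 0 L T _ (\sum_(1 <= k < N.+1) (C + C))) => //.
  move=> c g h hg hh; rewrite !pairing_sum//; [|exact: lL2..].
  rewrite mulr_sumr big_nat [RHS]big_nat; apply: eq_bigr => k /andP[k1 kN].
  by rewrite !scal//; [ring|exact: leq_trans (leq_pred _) _].
move=> u hu.
have hl k q : (k <= N)%N -> forall m, (0 < m <= N)%N ->
  cell_weight T N m q ->
  `|\sum_(x <- u) lam N r k x.1 * cell T N m (fun t => q t * x.2 t)| <= C * tensor_norm 1 0 L T u.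
  move=> kN m hm hq.
  apply: (@rank_one_bound _ 1 0 L T (lam N r k) (fun h => cell T N m (fun t => q t * h t))) => //.
  - exact: ll.
  - by move=> g hg; exact: hA.
  - by move=> c g h hg hh; apply: cell_lin => //; exact: lL2.
  - move=> h hh; rewrite -sobolev_norm0; [|exact: lL2|by case: hh].
    by apply: cell_bound => //; exact: lL2.
have -> : \sum_(x <- u) lam_pairing N r x.1 x.2 =
  \sum_(1 <= k < N.+1) (\sum_(x <- u) lam N r k x.1 * alpha T N k x.2 +
     \sum_(x <- u) lam N r k.-1 x.1 * beta T N k x.2).
  transitivity (\sum_(x <- u) \sum_(1 <= k < N.+1) (lam N r k x.1 * alpha T N k x.2 +
     lam N r k.-1 x.1 * beta T N k x.2)).
    rewrite big_seq [RHS]big_seq; apply: eq_bigr => x /hu[_ h2]; apply: pairing_sum => //; exact: lL2.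
  by rewrite exchange_big; apply: eq_bigr => k _; rewrite big_split.
apply: le_trans (ler_norm_sum _ _ _) _; rewrite mulr_suml !big_nat.
apply: ler_sum => k hk; have /andP[k0 kN] := hk; rewrite mulrDl.
apply: le_trans (ler_normD _ _) _; apply: lerD; apply: hl => //.
- exact: ramp_weight.
- exact: leq_trans (leq_pred _) _.
- exact: co_ramp_weight.
Qed.

(** The pairing splits into a sum of $\lambda_k$ against [ramp] and one of $\lambda_{k-1}$ against
    [1 - ramp]. Both families of weights vary slowly from cell to cell, so [weighted_sum] applies to
    each separately. *)
Lemma pairing_bound : exists C : R, 0 < C /\
  forall N r, (0 < N)%N -> is_scheme N r ->
  forall g h, sobolev0 1 L g -> sobolev0 1 T h ->
    `|lam_pairing N r g h| <= C * sobolev_norm 1 L g * sobolev_norm 1 T h.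
Proof.
have [A0 [B0 [R0 [A00 B00 R00 hd]]]] := lambda_decomp.
pose D := 2 * omega * (4 * A0 + T * B0) + T * R0.
have D0 : 0 <= D by rewrite addr_ge0// !mulr_ge0 ?(ltW T0) ?(ltW w0)// addr_ge0// mulr_ge0// ltW.
(* The summand 1 secures strict positivity, since [D] is only known to be nonnegative. *)
exists (2 * (D * Num.sqrt T) + 1); split.
  by rewrite ltr_wpDl// mulr_ge0// mulr_ge0// sqrtr_ge0.
move=> N r N0 hs g h hg hh.
have gam0 : 0 <= sobolev_norm 1 L g by exact: sqrtr_ge0.
have eta0 : 0 <= sobolev_norm 1 T h by exact: sqrtr_ge0.
have s0 : 0 <= Num.sqrt T := sqrtr_ge0 T.
(* The variation of the weights is measured on the representative [H] of [h], which vanishes at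
   [T]. *)
have [H [[_ hH aH] HT]] := rep1_end0 T0 hh.
have lh : L2 0 T h by case: hh => h1 _; exact: sob_L2 h1.
have lH : L2 0 T H by exact: AC_L2f aH.
have nh : nrm 0 T (wD T 1 h) <= sobolev_norm 1 T h by apply: nrm_wD1_le; case: hh.
have [x [rho [x11 hl hr hx hxx]]] := hd N r N0 hs g hg.
rewrite pairing_sum//; clear hd.
move: (sobolev_norm 1 L g) (sobolev_norm 1 T h) gam0 eta0 nh hr hx hxx => gam eta gam0 eta0 nh hr hx hxx.
pose la k := lam N r k g.
pose Vh k := I 0 (t_ T N k) (fun s => `|wD T 1 h s|).
have tau0 := tau_gt0 T0 N0.
have hVh k : (k <= N)%N -> 0 <= Vh k <= Num.sqrt T * eta.
  move=> kN; have /andP[-> h2] := @var_total _ _ _ _ T0 (AC_L2 aH) k N0 kN.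
  exact: le_trans h2 (ler_wpM2l s0 nh).
have hk2 k : (0 < k <= N)%N -> cell T N k (ramp T N k) = 2^-1 * tau_ T N.
  by move=> /andP[k0 _]; rewrite ramp_mass// mulrC.
have hk3 k : (0 < k <= N)%N -> cell T N k (fun t => 1 - ramp T N k t) = 2^-1 * tau_ T N.
  by move=> hk; rewrite co_ramp_mass// mulrC.
have half0 : 0 <= 2^-1 :> R by rewrite invr_ge0.
have half1 : 2^-1 <= 1 :> R by rewrite invf_le1// ler1n.
have [wa1 wa2] := @weight_bounds _ T N (ramp T N) H (wD T 1 h) eta 2^-1 T0 N0 aH HT nh half0 half1
  (fun k hk => ramp_weight T0 N0 (proj1 (andP hk))) hk2.
have [wb1 wb2] := @weight_bounds _ T N (fun k t => 1 - ramp T N k t) H (wD T 1 h) eta 2^-1 T0 N0 aH HT nh half0 half1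
  (fun k hk => co_ramp_weight T0 N0 (proj1 (andP hk))) hk3.
rewrite -/Vh in wa2 wb2.
have -> : \sum_(1 <= k < N.+1) (la k * alpha T N k h + la k.-1 * beta T N k h) =
  \sum_(1 <= k < N.+1) la k * alpha T N k H + \sum_(1 <= k < N.+1) la k.-1 * beta T N k H.
  rewrite -big_split/= big_nat [RHS]big_nat; apply: eq_bigr => k hk.
  have /andP[k0 _] := hk; rewrite /alpha /beta (cell_ext T0 N0 hk (ramp_weight T0 N0 k0) lh lH hH).
  by rewrite (cell_ext T0 N0 hk (co_ramp_weight T0 N0 k0) lh lH hH).
have Dge : 0 <= D * (Num.sqrt T * eta) * gam by rewrite !mulr_ge0.
have key c V j : (j.+2 <= N)%N ->
    (forall k, (k <= j)%N -> `|c k.+2| <= tau_ T N * (Num.sqrt T * eta)) ->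
    (forall k, (k < j)%N -> `|c k.+3 - c k.+2| <= V k.+3 - V k.+2) ->
    V j.+2 - V 2%N <= 3 * (tau_ T N * (Num.sqrt T * eta)) ->
    `|\sum_(0 <= k < j.+1) la k.+2 * c k.+2| <= D * gam * (Num.sqrt T * eta).
  move=> jN c1 c2 c3.
  by apply: (@weighted_sum _ T omega A0 B0 R0 gam (Num.sqrt T * eta) N la rho c V x j) => //;
    [exact: ltW|exact: mulr_ge0].
(* Each sum [2 * Vh k.+1 + Vh k] lies between 0 and three times [Num.sqrt T * eta], which bounds the
   total growth of the majorant. *)
have tot k m : (k < N)%N -> (m.+1 <= N)%N ->
    tau_ T N * (2 * Vh k.+1 + Vh k) - tau_ T N * (2 * Vh m.+1 + Vh m) <= 3 * (tau_ T N * (Num.sqrt T * eta)).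
  move=> kN mN; have /andP[_ u1] := hVh _ kN; have /andP[_ u2] := hVh _ (ltnW kN).
  have /andP[v1 _] := hVh _ mN; have /andP[v2 _] := hVh _ (ltnW mN).
  rewrite -mulrBr mulrCA ler_wpM2l ?(ltW tau0)//.
  exact: var_alg.
have F1 : `|\sum_(1 <= k < N.+1) la k * alpha T N k H| <= D * gam * (Num.sqrt T * eta).
  (* The empty sum is the case [N = 1], in which there is no nonzero multiplier. *)
  rewrite sum_shift1//; case E : N.-1 => [|j].
    by rewrite big_geq// normr0 mulrAC.
  have jN : (j.+2 <= N)%N by move: E N0; case: (N) => //= m ->.
  apply: (key (fun k => alpha T N k H) (fun k => tau_ T N * (2 * Vh k + Vh k.-1))) => //.
  - by move=> k kj; apply: wa1; exact: leq_trans jN.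
  - by move=> k kj; apply: wa2 => //; exact: leq_trans jN.
  - by apply: tot => //; exact: leq_trans jN.
have F2 : `|\sum_(1 <= k < N.+1) la k.-1 * beta T N k H| <= D * gam * (Num.sqrt T * eta).
  rewrite sum_shift2//; case E : N.-2 => [|j].
    by rewrite big_geq// normr0 mulrAC.
  have jN : (j.+3 <= N)%N by move: E N0; case: (N) => [|[|m]] //= ->.
  (* The multiplier with index [k] now meets the weight of the following cell, so the weights and
     their majorant are shifted by one. *)
  apply: (key (fun k => beta T N k.+1 H) (fun k => tau_ T N * (2 * Vh k.+1 + Vh k))) => //.
  - exact: ltnW.
  - by move=> k kj; apply: wb1; exact: leq_trans jN.
  - by move=> k kj; apply: wb2 => //; exact: leq_trans jN.
  - by apply: tot => //; exact: leq_trans jN.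
apply: le_trans (ler_normD _ _) _; apply: le_trans (lerD F1 F2) _.
have -> : D * gam * (Num.sqrt T * eta) + D * gam * (Num.sqrt T * eta) =
  (2 * (D * Num.sqrt T)) * gam * eta by ring.
by rewrite !ler_wpM2r// lerDl.
Qed.

End Scheme.

Theorem proposition11 (R : realType) (L T omega b : R)
    (L_gt0 : 0 < L) (T_gt0 : 0 < T) (omega_gt0 : 0 < omega) (b_gt0 : 0 < b)
    (eg : 'rV[R]_3) (eg_unit : enorm eg = 1)
    (f : R * R -> 'rV[R]_3)
    (f_cont : {within [set` `[0, L]] `*` [set` `[0, T]], continuous f}) :
  (forall (N : nat) (r : nat -> R -> 'rV[R]_3),
     (0 < N)%N -> scheme L T omega b eg f N r ->
     in_tensor_dual 1 0 L T (lambda_tau_pairing L T omega b f N r)) /\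
  (exists C : R, 0 < C /\
     forall (N : nat) (r : nat -> R -> 'rV[R]_3),
       (0 < N)%N -> scheme L T omega b eg f N r ->
       forall g h : R -> R, sobolev0 1 L g -> sobolev0 1 T h ->
         `|lambda_tau_pairing L T omega b f N r g h|
           <= C * sobolev_norm 1 L g * sobolev_norm 1 T h).
Proof.
split; first by move=> N r N0 hs; exact: pairing_dual hs.
exact: pairing_bound eg_unit f_cont.
Qed.
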